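(* Let $\Phi:M\to M$ be a partially hyperbolic automorphism of a Heisenberg nilmanifold. The set of Ruelle resonances of $\Phi$ is $$\{1\}\cup\{u_{z,i}\,\lambda^{-k-1/2}\mid z\in\mathbb Z\setminus\{0\},\ i\in\{1,\dots,|z|\},\ k\in\mathbb N\}.$$ There exists a basis $\{D^{(k)}_{z,i}\mid z\in\mathbb Z\setminus\{0\},\ i\in\{1,\dots,|z|\},\ k\in\mathbb N\}$ of the space of Ruelle eigenstates such that, for all $z,i,k$, $$\Phi_*(D^{(k)}_{z,i})=u_{z,i}\,\lambda^{-k-1/2}\,D^{(k)}_{z,i}+\sum_{j<k}c_{k,j}(\lambda)\,u_{z,i}\,\lambda^{-j-1/2}\,D^{(j)}_{z,i},$$ with coefficients $c_{k,j}(\lambda)$ that are not all equal to zero.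
   Context: $\mathbb N=\{0,1,2,\dots\}$. $N$ is the $3$-dimensional Heisenberg group, $\Gamma<N$ a lattice and $M=\Gamma\backslash N$. $\Phi$ is an automorphism of $M$ (induced by an automorphism of $N$ preserving $\Gamma$) for which there are a frame $\{X,Y,Z\}$ of vector fields on $M$ coming from the Lie algebra of $N$, with $[X,Y]=Z$, $[X,Z]=[Y,Z]=0$, and a number $\lambda>1$ such that $\Phi_*(X)=\lambda X$, $\Phi_*(Y)=\lambda^{-1}Y$, $\Phi_*(Z)=Z$. The nilmanifold and frame are normalized so that the eigenvalues of $Z$ on $L^2(M)$ are $\sqrt{-1}\,z$, $z\in\mathbb Z$, and for $z\ne0$ the corresponding eigenspace is a direct sum of $|z|$ irreducible unitary representations of $N$. $\mathcal E'(M)$ is the space of distributions on $M$; vector fields act on distributions by $(XD)(f)=-D(Xf)$, and $(\Phi_*D)(f)=D(f\circ\Phi)$. $\mathcal I_{X,k}(M)=\{D\in\mathcal E'(M)\mid X^kD=0\}$ for $k\ge1$, $\mathcal I_X(M)=\mathcal I_{X,1}(M)$, and $\mathcal I_{X,\infty}(M)=\bigcup_{k\ge1}\mathcal I_{X,k}(M)$. The Ruelle resonances of $\Phi$ are the eigenvalues of $\Phi_*$ on $\mathcal I_{X,\infty}(M)$, and the Ruelle eigenstates are the corresponding generalized eigenvectors; the basis in the statement omits the state given by the invariant volume (with eigenvalue $1$), and is a basis in the sense that for every $z\ne0$ and $K\ge1$ the distributions $D^{(k)}_{z,i}$ with $0\le k<K$, $1\le i\le|z|$, form a basis of $\{D\in\mathcal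 I_{X,K}(M)\mid ZD=\sqrt{-1}\,z\,D\}$. The unit complex numbers $u_{z,i}$ are those given by the following known result: for every $z\in\mathbb Z\setminus\{0\}$ the space $\{D\in\mathcal I_X(M)\mid ZD=\sqrt{-1}\,z\,D\}$ has a basis $D_{z,1},\dots,D_{z,|z|}$ with $\Phi_*(D_{z,i})=u_{z,i}\lambda^{-1/2}D_{z,i}$ and $|u_{z,i}|=1$. The coefficients $c_{k,j}(\lambda)$ do not depend on $z,i$. *)

(* Defs.v *)
From HB Require Import structures.
From mathcomp Require Import all_boot all_order all_algebra.
From mathcomp Require Import complex ring.
From mathcomp Require Import all_classical all_reals all_analysis.

Set Implicit Arguments.
Unset Strict Implicit.
Unset Printing Implicit Defensive.

Import Order.TTheory GRing.Theory Num.Theory numFieldNormedType.Exports.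

Local Open Scope classical_set_scope.
Local Open Scope ring_scope.
Local Open Scope complex_scope.

(* The Heisenberg group: ((x, y), z) stands for the unitriangular matrix
   [1 x z; 0 1 y; 0 0 1]. The same type is used for the Lie algebra, seen as
   the tangent space at the identity 0 = ((0, 0), 0). *)
Notation heis R := (R * R * R)%type.

Section HeisenbergGroup.
Variable R : realType.
Implicit Types (g h v : heis R) (f : heis R -> R).

Definition hmul g h : heis R :=
  (g.1.1 + h.1.1, g.1.2 + h.1.2, g.2 + h.2 + g.1.1 * h.1.2).

Definition hinv g : heis R :=
  (- g.1.1, - g.1.2, - g.2 + g.1.1 * g.1.2).

Definition is_subgroup (Gamma : set (heis R)) :=
  Gamma 0 /\ forall g h, Gamma g -> Gamma h -> Gamma (hmul g (hinv h)).

(* In a nilpotent Lie group the lattices are the discrete cocompact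
   subgroups. *)
Definition is_lattice (Gamma : set (heis R)) :=
  [/\ is_subgroup Gamma,
      exists2 e : R, 0 < e & forall g, Gamma g -> ball (0 : heis R) e g -> g = 0
    & exists2 K : set (heis R), compact K &
        forall g, exists gamma k, [/\ Gamma gamma, K k & g = hmul gamma k]].

Fixpoint Cn (n : nat) f : Prop :=
  (forall x, differentiable f x) /\
  if n is m.+1 then forall v, Cn m (fun x => 'D_v f x) else True.

Definition Cinfty f := forall n, Cn n f.

Definition Cinfty_map (phi : heis R -> heis R) :=
  [/\ Cinfty (fun x => (phi x).1.1), Cinfty (fun x => (phi x).1.2)
    & Cinfty (fun x => (phi x).2)].

Lemma Cn_diff n f : Cn n f -> forall x, differentiable f x.
Proof. by case: n => [|n] []. Qed.

Lemma CnW n f : Cn n.+1 f -> Cn n f.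
Proof.
elim: n f => [|n IH] f [df Df]; split => // v.
exact/IH/Df.
Qed.

Lemma Cn_cst n (a : R) : Cn n (fun=> a).
Proof.
elim: n a => [|n IH] a; (split=> [x|//]; first exact: differentiable_cst) => v.
rewrite (_ : 'D_v _ = fun=> 0); first exact: IH.
by apply/funext => x; rewrite derive_cst.
Qed.

Lemma CnD n f1 f2 : Cn n f1 -> Cn n f2 -> Cn n (fun x => f1 x + f2 x).
Proof.
elim: n f1 f2 => [|n IH] f1 f2 [d1 D1] [d2 D2].
  by split=> // x; exact: differentiableD.
split=> [x|v]; first exact: differentiableD.
rewrite (_ : 'D_v _ = (fun x => 'D_v f1 x + 'D_v f2 x)).
  exact: IH (D1 v) (D2 v).
by apply/funext => x; rewrite deriveD//; exact: diff_derivable.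
Qed.

Lemma CnM n f1 f2 : Cn n f1 -> Cn n f2 -> Cn n (fun x => f1 x * f2 x).
Proof.
elim: n f1 f2 => [|n IH] f1 f2.
  by move=> [d1 _] [d2 _]; split=> // x; exact: differentiableM.
move=> C1 C2; have [d1 D1] := C1; have [d2 D2] := C2.
split=> [x|v]; first exact: differentiableM.
rewrite (_ : 'D_v _ = (fun x => f1 x * 'D_v f2 x + f2 x * 'D_v f1 x)).
  apply: CnD; apply: IH; [exact: CnW|exact: D2|exact: CnW|exact: D1].
by apply/funext => x; rewrite deriveM//; exact: diff_derivable.
Qed.

Lemma derive_heis_comp f (phi : heis R -> heis R) x v :
  Cinfty_map phi -> (forall y, differentiable f y) ->
  'D_v (f \o phi) x =
    'D_v (fun y => (phi y).1.1) x * 'D_((1, 0, 0) : heis R) f (phi x) +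
    'D_v (fun y => (phi y).1.2) x * 'D_((0, 1, 0) : heis R) f (phi x) +
    'D_v (fun y => (phi y).2) x * 'D_((0, 0, 1) : heis R) f (phi x).
Proof.
move=> [/(_ 0%N) /Cn_diff d1 /(_ 0%N) /Cn_diff d2 /(_ 0%N) /Cn_diff d3] df.
have phiE : phi = fun y => (((phi y).1.1, (phi y).1.2), (phi y).2).
  by apply/funext => y; case: (phi y) => [[]].
have d12 : differentiable (fun y => ((phi y).1.1, (phi y).1.2)) x.
  exact: differentiable_pair.
have dphi : differentiable phi x by rewrite phiE; exact: differentiable_pair.
have dphiE : 'd phi x v =
    (('d (fun y => (phi y).1.1) x v, 'd (fun y => (phi y).1.2) x v),
     'd (fun y => (phi y).2) x v).
  by rewrite {1}phiE diff_pair// diff_pair.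
have dE : 'd (f \o phi) x v = 'd f (phi x) ('d phi x v).
  exact: (congr1 (fun l => l v) (diff_comp dphi (df (phi x)))).
have key a b c : 'd f (phi x) ((a, b), c) =
    a * 'D_((1, 0, 0) : heis R) f (phi x) +
    b * 'D_((0, 1, 0) : heis R) f (phi x) +
    c * 'D_((0, 0, 1) : heis R) f (phi x).
  rewrite !(deriveE _ (df (phi x))).
  have -> : ((a, b), c) = a *: ((1, 0, 0) : heis R) +
      b *: ((0, 1, 0) : heis R) + c *: ((0, 0, 1) : heis R).
    by congr (_, _, _); rewrite /= /GRing.scale/= ?(mulr1, mulr0, addr0, add0r).
  by rewrite !linearD !linearZ.
rewrite deriveE; last exact: differentiable_comp.
rewrite dE dphiE key.
by rewrite (deriveE v (d1 x)) (deriveE v (d2 x)) (deriveE v (d3 x)).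
Qed.

Lemma differentiable_heis_map (phi : heis R -> heis R) x :
  Cinfty_map phi -> differentiable phi x.
Proof.
move=> [/(_ 0%N) /Cn_diff d1 /(_ 0%N) /Cn_diff d2 /(_ 0%N) /Cn_diff d3].
rewrite (_ : phi = fun y => (((phi y).1.1, (phi y).1.2), (phi y).2)).
  by apply: differentiable_pair => //; exact: differentiable_pair.
by apply/funext => y; case: (phi y) => [[]].
Qed.

Lemma Cinfty_derive f v : Cinfty f -> Cinfty (fun x => 'D_v f x).
Proof. by move=> Cf n; have [_ /(_ v)] := Cf n.+1. Qed.

Lemma Cinfty_comp f phi : Cinfty f -> Cinfty_map phi -> Cinfty (f \o phi).
Proof.
move=> Cf Cphi n; have [C1 C2 C3] := Cphi.
elim: n f Cf => [|n IH] f Cf.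
  split=> // x; apply: differentiable_comp; first exact: differentiable_heis_map.
  exact: Cn_diff (Cf 0%N) _.
split=> [x|v].
  apply: differentiable_comp; first exact: differentiable_heis_map.
  exact: Cn_diff (Cf 0%N) _.
rewrite (_ : 'D_v _ = (fun x =>
    'D_v (fun y => (phi y).1.1) x * 'D_((1, 0, 0) : heis R) f (phi x) +
    'D_v (fun y => (phi y).1.2) x * 'D_((0, 1, 0) : heis R) f (phi x) +
    'D_v (fun y => (phi y).2) x * 'D_((0, 0, 1) : heis R) f (phi x))).
  have H e : Cn n (fun x => 'D_e f (phi x)) := IH _ (Cinfty_derive e Cf).
  apply: CnD; last exact: CnM (Cinfty_derive v C3 n) (H _).
  apply: CnD; first exact: CnM (Cinfty_derive v C1 n) (H _).
  exact: CnM (Cinfty_derive v C2 n) (H _).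
apply/funext => x; apply: derive_heis_comp => // y; exact: Cn_diff (Cf 0%N) _.
Qed.

Lemma CinftyD f1 f2 : Cinfty f1 -> Cinfty f2 -> Cinfty (fun x => f1 x + f2 x).
Proof. by move=> C1 C2 n; exact: CnD. Qed.

Lemma CinftyM f1 f2 : Cinfty f1 -> Cinfty f2 -> Cinfty (fun x => f1 x * f2 x).
Proof. by move=> C1 C2 n; exact: CnM. Qed.

Lemma Cinfty_cst (a : R) : Cinfty (fun=> a).
Proof. by move=> n; exact: Cn_cst. Qed.

Lemma derive_linear (l : {linear heis R -> R}) x v :
  continuous l -> 'D_v l x = l v.
Proof.
move=> cl; rewrite deriveE; last exact: linear_differentiable.
by rewrite diff_lin.
Qed.

Lemma Cinfty_linear (l : {linear heis R -> R}) : continuous l -> Cinfty l.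
Proof.
move=> cl n; have dl x : differentiable l x by exact: linear_differentiable.
case: n => [|n]; first by split.
split=> // v; rewrite (_ : 'D_v _ = fun=> l v); first exact: Cn_cst.
by apply/funext => x; rewrite derive_linear.
Qed.

Let c1 : {linear heis R -> R} := fst \o fst.
Let c2 : {linear heis R -> R} := snd \o fst.
Let c3 : {linear heis R -> R} := snd.

Let continuous_c1 : continuous c1.
Proof. by move=> x; apply: continuous_comp; exact: cvg_fst. Qed.

Let continuous_c2 : continuous c2.
Proof.
by move=> x; apply: continuous_comp; [exact: cvg_fst|exact: cvg_snd].
Qed.

Let continuous_c3 : continuous c3.
Proof. by move=> x; exact: cvg_snd. Qed.

Lemma Cinfty_hmul g : Cinfty_map (hmul g).
Proof.
have C1 := Cinfty_linear continuous_c1.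
have C2 := Cinfty_linear continuous_c2.
have C3 := Cinfty_linear continuous_c3.
split; [exact: CinftyD (Cinfty_cst _) C1|exact: CinftyD (Cinfty_cst _) C2|].
apply: CinftyD (CinftyM (Cinfty_cst _) C2).
exact: CinftyD (Cinfty_cst _) C3.
Qed.

Lemma hmulg0 g : hmul g 0 = g.
Proof. by case: g => [[x y] z]; rewrite /hmul /= mulr0 !addr0. Qed.

Lemma hmulA g h k : hmul g (hmul h k) = hmul (hmul g h) k.
Proof.
rewrite /hmul /= !addrA; congr (_, _, _).
ring.
Qed.

Lemma derive_hmul f g v : Cinfty f ->
  'D_v (f \o hmul g) 0 =
    v.1.1 * 'D_((1, 0, 0) : heis R) f g + v.1.2 * 'D_((0, 1, 0) : heis R) f g +
    (v.2 + g.1.1 * v.1.2) * 'D_((0, 0, 1) : heis R) f g.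
Proof.
move=> Cf; rewrite derive_heis_comp; last 2 first.
- exact: Cinfty_hmul.
- exact: Cn_diff (Cf 0%N).
have diffl (l : {linear heis R -> R}) (x : heis R) :
  continuous l -> derivable l x v.
  by move=> cl; apply: diff_derivable; exact: linear_differentiable.
have E (l : {linear heis R -> R}) (a : R) : continuous l ->
    'D_v (fun h => a + l h) 0 = l v.
  move=> cl; rewrite (_ : (fun h => _) = cst a + (l : heis R -> R))//.
  by rewrite deriveD ?derive_cst ?add0r ?derive_linear//; exact: diffl.
have E3 : 'D_v (fun h => (hmul g h).2) 0 = v.2 + g.1.1 * v.1.2.
  have E2 : 'D_v (fun h : heis R => g.1.1 * c2 h) 0 = g.1.1 * v.1.2.
    by rewrite (deriveZ _ (diffl c2 0 continuous_c2)) derive_linear.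
  have d3 : derivable (fun h : heis R => g.2 + c3 h) 0 v.
    exact: (@derivableD _ _ _ (cst g.2) c3 0 v (derivable_cst _ _ _) (diffl c3 0 continuous_c3)).
  have d2 : derivable (fun h : heis R => g.1.1 * c2 h) 0 v.
    exact: (@derivableZ _ _ _ c2 g.1.1 0 v (diffl c2 0 continuous_c2)).
  transitivity ('D_v (fun h => g.2 + c3 h) 0 + 'D_v (fun h => g.1.1 * c2 h) 0).
    exact: deriveD d3 d2.
  by rewrite E2 E.
by rewrite E3 hmulg0 (E c1) ?(E c2).
Qed.

Lemma Cinfty_lie f v : Cinfty f -> Cinfty (fun g => 'D_v (f \o hmul g) 0).
Proof.
move=> Cf; rewrite (_ : (fun g => _) = fun g =>
    v.1.1 * 'D_((1, 0, 0) : heis R) f g + v.1.2 * 'D_((0, 1, 0) : heis R) f g +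
    (v.2 + g.1.1 * v.1.2) * 'D_((0, 0, 1) : heis R) f g); last first.
  by apply/funext => g; exact: derive_hmul.
have Cc a : Cinfty (fun=> a) by exact: Cinfty_cst.
have CD e : Cinfty (fun x => 'D_e f x) by exact: Cinfty_derive.
have C1 := Cinfty_linear continuous_c1.
apply: CinftyD; first by apply: CinftyD; exact: CinftyM (Cc _) (CD _).
exact: CinftyM (CinftyD (Cc _) (CinftyM C1 (Cc _))) (CD _).
Qed.

End HeisenbergGroup.

Section TestFunctions.
Variable R : realType.
Implicit Types (Gamma : set (heis R)) (f : heis R -> R[i]^o).

Definition smooth f :=
  Cinfty (fun x => complex.Re (f x)) /\ Cinfty (fun x => complex.Im (f x)).

Definition left_invariant Gamma f :=
  forall gamma x, Gamma gamma -> f (hmul gamma x) = f x.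

(* C^oo(M) for M = Gamma \ N. *)
Definition testpred Gamma : {pred heis R -> R[i]^o} :=
  mem [set f | smooth f /\ left_invariant Gamma f].

Record testfn Gamma := TestFn {
  testfun :> heis R -> R[i]^o;
  _ : testfun \in testpred Gamma }.

HB.instance Definition _ Gamma := [isSub for @testfun Gamma].
HB.instance Definition _ Gamma := [Choice of testfn Gamma by <:].

Lemma testfnP Gamma (f : testfn Gamma) : smooth f /\ left_invariant Gamma f.
Proof. by have := valP f; rewrite inE. Qed.

Lemma testpred_submod_closed Gamma : submod_closed (testpred Gamma).
Proof.
split=> [|a f g].
  by rewrite inE; split=> //; split; exact: Cinfty_cst.
rewrite !inE => -[[Rf If] invf] [[Rg Ig] invg]; split; last first.
  by move=> gamma x Gg; rewrite /= /GRing.add/= /GRing.scale/= invf// invg.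
have Cc (b : R) : Cinfty (fun=> b) by exact: Cinfty_cst.
split.
- rewrite (_ : (fun x => _) = fun x =>
    (complex.Re a * complex.Re (f x) + - complex.Im a * complex.Im (f x)) +
    complex.Re (g x)).
    apply: CinftyD => //; apply: CinftyD; exact: CinftyM.
  apply/funext => x; rewrite /= /GRing.add/= /GRing.scale/=.
  by case: a (f x) (g x) => [? ?] [? ?] [? ?] /=; rewrite mulNr.
- rewrite (_ : (fun x => _) = fun x =>
    (complex.Re a * complex.Im (f x) + complex.Im a * complex.Re (f x)) +
    complex.Im (g x)).
    apply: CinftyD => //; apply: CinftyD; exact: CinftyM.
  apply/funext => x; rewrite /= /GRing.add/= /GRing.scale/=.
  by case: a (f x) (g x) => [? ?] [? ?] [? ?].
Qed.

HB.instance Definition _ Gamma :=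
  GRing.isSubmodClosed.Build _ _ (testpred Gamma)
    (@testpred_submod_closed Gamma).
HB.instance Definition _ Gamma :=
  [SubChoice_isSubLmodule of testfn Gamma by <:].

(* The left-invariant vector field with value v at the identity. *)
Definition lie_derivative (v : heis R) f : heis R -> R[i]^o := fun g =>
  'D_v (fun h => complex.Re (f (hmul g h))) 0 +i*
  'D_v (fun h => complex.Im (f (hmul g h))) 0.

Lemma lie_derivative_subproof Gamma v (f : testfn Gamma) :
  lie_derivative v f \in testpred Gamma.
Proof.
have [[Rf If] invf] := testfnP f; rewrite inE; split.
  by split; [exact: Cinfty_lie Rf|exact: Cinfty_lie If].
move=> gamma x Gg; rewrite /lie_derivative.
have E h : f (hmul (hmul gamma x) h) = f (hmul x h) by rewrite -hmulA invf.
by congr (_ +i* _); congr ('D_v _ 0); apply/funext => h; rewrite E.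
Qed.

Definition vfield Gamma (v : heis R) (f : testfn Gamma) : testfn Gamma :=
  TestFn (lie_derivative_subproof v f).

(* The inverse of a smooth bijective homomorphism is smooth. *)
Record nil_automorphism Gamma := NilAutomorphism {
  autfun :> heis R -> heis R;
  aut_bij : bijective autfun;
  aut_mul : {morph autfun : g h / hmul g h};
  aut_smooth : Cinfty_map autfun;
  aut_lattice : autfun @` Gamma = Gamma }.

Lemma pullback_subproof Gamma (Phi : nil_automorphism Gamma) (f : testfn Gamma) :
  (f : heis R -> R[i]^o) \o Phi \in testpred Gamma.
Proof.
have [[Rf If] invf] := testfnP f; rewrite inE; split.
  split; [exact: Cinfty_comp Rf (aut_smooth Phi)|].
  exact: Cinfty_comp If (aut_smooth Phi).
move=> gamma x Gg /=; rewrite (aut_mul Phi) invf//.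
have : (Phi @` Gamma) (Phi gamma) by exists gamma.
by rewrite aut_lattice.
Qed.

Definition pullback Gamma (Phi : nil_automorphism Gamma) (f : testfn Gamma) :
  testfn Gamma := TestFn (pullback_subproof Phi f).

End TestFunctions.

Section Distributions.
Variables (R : realType) (Gamma : set (heis R)).
Implicit Types (D : testfn Gamma -> R[i]^o) (f : testfn Gamma).
Implicit Types (v X Y Z : heis R) (Phi : nil_automorphism Gamma).

(* The sup norm over M of the iterated derivative v_1 ... v_n f, where
   w = [:: v_1; ...; v_n]; these seminorms define the topology of C^oo(M). *)
Definition seminorm (w : seq (heis R)) f : R :=
  sup [set ComplexField.Normc.normc (foldr (@vfield R Gamma) f w x)
      | x in [set: heis R]].

Definition distributions : set (testfn Gamma -> R[i]^o) :=
  [set D | linear D /\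
     exists (C : R) (W : seq (seq (heis R))), forall f,
       ComplexField.Normc.normc (D f) <= C * \sum_(w <- W) seminorm w f].

Definition dvfield v D : testfn Gamma -> R[i]^o := fun f => - D (vfield v f).

Definition push_dist Phi D : testfn Gamma -> R[i]^o :=
  fun f => D (pullback Phi f).

Definition heisenberg_frame X Y Z :=
  [/\ forall a b c : R, a *: X + b *: Y + c *: Z = 0 ->
        [/\ a = 0, b = 0 & c = 0],
      forall f, vfield X (vfield Y f) - vfield Y (vfield X f) = vfield Z f,
      forall f, vfield X (vfield Z f) = vfield Z (vfield X f)
    & forall f, vfield Y (vfield Z f) = vfield Z (vfield Y f)].

(* Phi_*(v) = c v, since (Phi_* v) f = v (f o Phi) o Phi^-1. *)
Definition pushes_vfield Phi v (c : R) :=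
  forall f, vfield v (pullback Phi f) = c%:C *: pullback Phi (vfield v f).

Definition inv_dist X (k : nat) : set (testfn Gamma -> R[i]^o) :=
  [set D | distributions D /\ iter k (dvfield X) D = 0].

Definition inv_dist_oo X : set (testfn Gamma -> R[i]^o) :=
  [set D | exists2 k, (0 < k)%N & inv_dist X k D].

Definition Z_mode Z (z : int) : set (testfn Gamma -> R[i]^o) :=
  [set D | dvfield Z D = ('i%C * z%:~R) *: D].

Definition ruelle_resonance Phi X : set R[i] :=
  [set mu | exists D,
     [/\ inv_dist_oo X D, D <> 0 & push_dist Phi D = mu *: D]].

Definition ruelle_eigenstate Phi X : set (testfn Gamma -> R[i]^o) :=
  [set D | [/\ inv_dist_oo X D, D <> 0 & exists (mu : R[i]) (n : nat),
     iter n (fun E => push_dist Phi E - mu *: E) D = 0]].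

(* A Ruelle eigenstate is a generalized eigenvector for one resonance; a
   vector of a basis in which push_dist Phi is triangular but not diagonal is in
   general only a sum of eigenstates. *)
Definition ruelle_eigenstate_span Phi X : set (testfn Gamma -> R[i]^o) :=
  [set D | exists (n : nat) (E : 'I_n -> testfn Gamma -> R[i]^o),
     (forall i, ruelle_eigenstate Phi X (E i)) /\ D = \sum_i E i].

Definition is_basis (I : finType) (S : set (testfn Gamma -> R[i]^o))
    (e : I -> testfn Gamma -> R[i]^o) :=
  (forall i, S (e i)) /\
  forall D, S D -> exists! c : {ffun I -> R[i]}, D = \sum_i c i *: e i.

End Distributions.

(* L^2(M), with M represented by a measurable fundamental domain F of Gamma
   and with the Lebesgue measure, which is a Haar measure of N. Elements of
   L^2(M) are represented by Gamma-invariant measurable functions; the subspaces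
   below are closed in the L^2 seminorm, hence stable under equality a.e. *)
Section SquareIntegrable.
Variables (R : realType) (Gamma F : set (heis R)).
Implicit Types (f g : heis R -> R[i]^o) (H : set (heis R -> R[i]^o)).

Definition haar : set (heis R) -> \bar R :=
  ((@lebesgue_measure R \x @lebesgue_measure R) \x @lebesgue_measure R)%E.

Definition fundamental_domain :=
  measurable F /\
  forall x, exists! y, F y /\ exists2 gamma, Gamma gamma & x = hmul gamma y.

Definition cintegral f : R[i] :=
  Rintegral haar F (fun x => complex.Re (f x)) +i*
  Rintegral haar F (fun x => complex.Im (f x)).

Definition sqnorm f : \bar R :=
  (\int[haar]_(x in F) ((ComplexField.Normc.normc (f x)) ^+ 2)%:E)%E.

Definition L2 : set (heis R -> R[i]^o) :=
  [set f | [/\ left_invariant Gamma f,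
     measurable_fun setT (fun x => complex.Re (f x)),
     measurable_fun setT (fun x => complex.Im (f x))
   & (sqnorm f < +oo)%E]].

Definition dist_of_fun f : testfn Gamma -> R[i]^o :=
  fun phi => cintegral (fun x => f x * phi x).

(* Zf = mu f, the derivative being taken in the sense of distributions. *)
Definition L2_eigenspace (Z : heis R) (mu : R[i]) : set (heis R -> R[i]^o) :=
  [set f | L2 f /\ dvfield Z (dist_of_fun f) = mu *: dist_of_fun f].

(* Closed subspaces invariant under the regular representation of N. *)
Definition subrepresentation H :=
  [/\ H `<=` L2, H 0,
      forall (a : R[i]) f g, H f -> H g -> H (a *: f + g),
      forall f, L2 f ->
        (forall e : R, 0 < e -> exists2 g, H g & (sqnorm (f - g)%R < e%:E)%E) -> H f
    & forall n f, H f -> H (fun x => f (hmul x n))].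

Definition irreducible_subrep H :=
  [/\ subrepresentation H, exists2 f, H f & sqnorm f <> 0%E
    & forall H', subrepresentation H' -> H' `<=` H ->
        (forall f, H' f -> sqnorm f = 0%E) \/ H' = H].

Definition orthogonal_sub H1 H2 :=
  forall f g, H1 f -> H2 g -> cintegral (fun x => f x * (g x)^*%C) = 0.

End SquareIntegrable.

Definition normalized (R : realType) (Gamma : set (heis R)) (Z : heis R) :=
  exists F, [/\ fundamental_domain Gamma F,
    [set mu | exists2 f, L2_eigenspace Gamma F Z mu f & sqnorm F f <> 0%E] =
      [set 'i%C * z%:~R | z in [set: int]]
  & forall z : int, z != 0 ->
      exists H : 'I_`|z|%N -> set (heis R -> R[i]^o),
        [/\ forall i, irreducible_subrep Gamma F (H i),
            forall i j, i != j -> orthogonal_sub F (H i) (H j)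
          & L2_eigenspace Gamma F Z ('i%C * z%:~R) =
            [set f | exists h : 'I_`|z|%N -> heis R -> R[i]^o,
               (forall i, H i (h i)) /\ f = \sum_i h i]]].

(* Main.v *)
(* A nonzero distribution is detected by one of its Fourier modes along a
   one-parameter subgroup through the lattice (Fejer's theorem for averages of
   right translates), and the central modes commute with every left-invariant
   field and with [Phi]. Hence a resonance [mu] is carried by a single central
   mode [D] with [X^k D = 0]. If the frequency is nonzero, normalization places
   it in the integer spectrum of [Z]; there [X (Y^k D) = k i z Y^(k-1) D] for
   [X D = 0], so the [Y^k D_i] form a basis of the kernel of the powers of [X],
   and [Phi_* (Y^k D_i) = u_i lambda^(-k-1/2) Y^k D_i]. If the frequency is
   zero, [D] lives on a torus: a Fourier mode [E] there is an eigenvector of all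
   fields, [X E = 0] by nilpotency, and [Y E = i beta E], where periodicity
   under all [Phi^n gamma] in the lattice gives [cos (lambda^-n b) = 1] for every
   [n], so [beta = 0]; then [E] is an invariant mean, [D 1 <> 0] and [mu = 1]. *)

From HB Require Import structures.
Require Import Defs.
From mathcomp Require Import all_boot all_order all_algebra.
From mathcomp Require Import complex ring lra zify.
From mathcomp Require Import all_classical all_reals all_analysis measurable_realfun.

Set Implicit Arguments.
Unset Strict Implicit.
Unset Printing Implicit Defensive.

Import Order.TTheory GRing.Theory Num.Theory numFieldNormedType.Exports.

Local Open Scope classical_set_scope.
Local Open Scope ring_scope.
Local Open Scope complex_scope.

(** * Averages along one-parameter subgroups *)

(** A distribution is controlled only by seminorms of all orders, so Fejer convergence is needed in
    each of them. This is why the operators in use commute with the left-invariant fields: each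
    seminorm of the error then reduces to a sup estimate for one smooth function. An average over
    right translates by exp (t v) is sure to commute with the fields when [v] is central or when the
    function is constant along the centre, which fixes the order: the centre first, the torus
    afterwards. The relations of the frame and the eigenvalues of [Phi] are given as identities on
    test functions. They yield identities in the Lie algebra once some test function varies along
    the centre, and the spectrum in [normalized] provides one. A mode along the torus need not be
    preserved by [Phi], so [mu] is not followed down to [E]. It is read off at the constant function
    1, which [Phi] fixes: the modes send 1 to multiples of 1, hence [E 1 <> 0] forces [D 1 <> 0].
    Integrality is obtained on functions rather than on distributions: a nonzero function in the
    range of a central mode is a smooth eigenfunction in L^2. *)

Section Continuity.
Variables (R : realType) (T : topologicalType).
Implicit Types f g : T -> R.

Lemma contD f g : continuous f -> continuous g -> continuous (fun t => f t + g t).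
Proof. by move=> cf cg t; apply: cvgD; [exact: cf|exact: cg]. Qed.

Lemma contB f g : continuous f -> continuous g -> continuous (fun t => f t - g t).
Proof. by move=> cf cg t; apply: cvgB; [exact: cf|exact: cg]. Qed.

Lemma contM f g : continuous f -> continuous g -> continuous (fun t => f t * g t).
Proof. by move=> cf cg t; apply: cvgM; [exact: cf|exact: cg]. Qed.

Lemma contZ (a : R) f : continuous f -> continuous (fun t => a * f t).
Proof. by move=> cf t; apply: cvgM; [exact: cvg_cst|exact: cf]. Qed.

Lemma cont_comp (S U : topologicalType) (a : S -> T) (b : T -> U) :
  continuous a -> continuous b -> continuous (fun t => b (a t)).
Proof. by move=> ca cb t; apply: (continuous_comp (ca t) (cb _)). Qed.

End Continuity.

(** Sealed, so that unification does not unfold the Lebesgue integral. *)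
HB.lock Definition int01 (R : realType) (f : R -> R) : R :=
  Rintegral (@lebesgue_measure R) `[0, 1] f.

Section UnitIntervalIntegral.
Variable R : realType.
Implicit Types (f g : R -> R).
Let mu := @lebesgue_measure R.

Lemma int01_integrable f : continuous f -> mu.-integrable `[0, 1] (EFin \o f).
Proof.
move=> cf; apply: continuous_compact_integrable; first exact: segment_compact.
exact: continuous_subspaceT.
Qed.

Lemma int01D f g : continuous f -> continuous g ->
  int01 (fun t => f t + g t) = int01 f + int01 g.
Proof.
by move=> cf cg; rewrite unlock RintegralD//; exact: int01_integrable.
Qed.

Lemma int01Z (a : R) f : continuous f -> int01 (fun t => a * f t) = a * int01 f.
Proof. by move=> cf; rewrite unlock RintegralZl//; exact: int01_integrable. Qed.

Lemma int01N f : continuous f -> int01 (fun t => - f t) = - int01 f.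
Proof.
move=> cf; rewrite -mulN1r -int01Z//.
by congr (int01 _); apply/funext => t; rewrite mulN1r.
Qed.

Lemma int01B f g : continuous f -> continuous g ->
  int01 (fun t => f t - g t) = int01 f - int01 g.
Proof.
move=> cf cg; rewrite -int01N// int01D// => t.
by apply: cvgN; exact: cg.
Qed.

Lemma int01_cst (a : R) : int01 (fun=> a) = a.
Proof.
rewrite unlock Rintegral_cst//= lebesgue_measure_itv/= lte_fin ltr01.
by rewrite oppr0 addr0 /= mulr1.
Qed.

Lemma le_int01 f g : continuous f -> continuous g ->
  (forall t, 0 <= t <= 1 -> f t <= g t) -> int01 f <= int01 g.
Proof.
by move=> cf cg fg; rewrite unlock; apply: le_Rintegral => //; exact: int01_integrable.
Qed.

Lemma int01_norm_le f M : continuous f ->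
  (forall t, 0 <= t <= 1 -> `|f t| <= M) -> `|int01 f| <= M.
Proof.
move=> cf fM; rewrite ler_norml; apply/andP; split.
  rewrite -[X in X <= _]int01_cst; apply: le_int01 => //; first exact: cst_continuous.
  by move=> t /fM; rewrite ler_norml => /andP[].
rewrite -[X in _ <= X]int01_cst; apply: le_int01 => //; first exact: cst_continuous.
by move=> t /fM; rewrite ler_norml => /andP[].
Qed.

Lemma int01_FTC f g : continuous g ->
  (forall t : R, is_derive t 1 f (g t)) -> int01 g = f 1 - f 0.
Proof.
move=> cg df; rewrite unlock /Rintegral.
have cf : continuous f.
  move=> t; apply: differentiable_continuous; apply/derivable1_diffP.
  by have [] := df t.
rewrite (@continuous_FTC2 _ g f)//.
- exact: continuous_subspaceT.
- split; first by move=> t _; have [] := df t.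
  + by apply: cvg_at_right_filter; exact: cf.
  + by apply: cvg_at_left_filter; exact: cf.
- by move=> t _; rewrite derive1E; have [_ ->] := df t.
Qed.

End UnitIntervalIntegral.

Section Flow.
Variable R : realType.
Implicit Types (x y u v h : heis R) (F : heis R -> R) (s t : R).

(* The one-parameter subgroup [t |-> exp (t v)]. *)
Definition hexp v t : heis R :=
  (t * v.1.1, t * v.1.2, t * v.2 + t ^+ 2 * v.1.1 * v.1.2 / 2).

Lemma hexp0 v : hexp v 0 = 0.
Proof. by rewrite /hexp !mul0r expr2 !mul0r addr0. Qed.

Lemma hexpD v s t : hexp v (s + t) = hmul (hexp v s) (hexp v t).
Proof.
rewrite /hexp /hmul/=; congr (_, _, _); rewrite ?mulrDl//.
by field.
Qed.

Lemma continuous_fst2 : continuous (fun x : heis R => x.1.1).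
Proof. by move=> x; apply: continuous_comp; exact: cvg_fst. Qed.

Lemma continuous_snd2 : continuous (fun x : heis R => x.1.2).
Proof.
by move=> x; apply: continuous_comp; [exact: cvg_fst|exact: cvg_snd].
Qed.

Lemma continuous_snd1 : continuous (fun x : heis R => x.2).
Proof. by move=> x; exact: cvg_snd. Qed.

Lemma continuous_heis (T : topologicalType) (a b c : T -> R) :
  continuous a -> continuous b -> continuous c ->
  continuous (fun p => (a p, b p, c p) : heis R).
Proof.
move=> ca cb cc p.
have cab : (fun p => (a p, b p)) @ p --> (a p, b p).
  exact: (cvg_pair (ca p) (cb p)).
exact: (cvg_pair cab (cc p)).
Qed.

Lemma continuous_hexp v : continuous (hexp v).
Proof.
apply: continuous_heis => t.
- by apply: cvgM; [exact: cvg_id|exact: cvg_cst].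
- by apply: cvgM; [exact: cvg_id|exact: cvg_cst].
- apply: cvgD; first by apply: cvgM; [exact: cvg_id|exact: cvg_cst].
  apply: cvgM; last exact: cvg_cst; apply: cvgM; last exact: cvg_cst.
  by apply: cvgM; [|exact: cvg_cst]; exact: exprn_continuous.
Qed.

Lemma continuous_hmul (T : topologicalType) (a b : T -> heis R) :
  continuous a -> continuous b -> continuous (fun p => hmul (a p) (b p)).
Proof.
move=> ca cb.
have C (c : T -> heis R) : continuous c -> [/\ continuous (fun p => (c p).1.1),
    continuous (fun p => (c p).1.2) & continuous (fun p => (c p).2)].
  move=> cc; split=> p.
  - by apply: (@continuous_comp _ _ _ c (fun x => x.1.1)); [exact: cc|exact: continuous_fst2].
  - by apply: (@continuous_comp _ _ _ c (fun x => x.1.2)); [exact: cc|exact: continuous_snd2].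
  - by apply: (@continuous_comp _ _ _ c (fun x => x.2)); [exact: cc|exact: continuous_snd1].
have [a1 a2 a3] := C _ ca; have [b1 b2 b3] := C _ cb.
apply: continuous_heis => p; [by apply: cvgD; [exact: a1|exact: b1]|
  by apply: cvgD; [exact: a2|exact: b2]|].
apply: cvgD; first by apply: cvgD; [exact: a3|exact: b3].
by apply: cvgM; [exact: a1|exact: b2].
Qed.

Definition flow v x t := hmul x (hexp v t).

Lemma continuous_flow v x : continuous (flow v x).
Proof. by apply: continuous_hmul; [exact: cst_continuous|exact: continuous_hexp]. Qed.

Lemma continuous_flow2 v : continuous (fun p : R * heis R => flow v p.2 p.1).
Proof.
apply: continuous_hmul; first by move=> p; exact: cvg_snd.
move=> p; apply: (@continuous_comp _ _ _ fst (hexp v)); first exact: cvg_fst.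
exact: continuous_hexp.
Qed.

(** A tube argument: compactness of [0, 1] makes continuity at (t, x) uniform in [t]. It gives the
    uniform remainder needed to differentiate under the integral sign. *)
Lemma unit_interval_equicontinuous (k : R * heis R -> R) x (e : R) :
  continuous k -> 0 < e -> exists2 d : R, 0 < d &
    forall h t, `|h| < d -> 0 <= t <= 1 -> `|k (t, x + h) - k (t, x)| <= e.
Proof.
move=> ck e0.
have /compact_near_coveringP K := @segment_compact R 0 1.
have near_k : \forall h \near (0 : heis R), `[0, 1] `<=`
    (fun t => `|k (t, x + h) - k (t, x)| < e).
  apply: (K _ (nbhs (0 : heis R)) (fun h t => `|k (t, x + h) - k (t, x)| < e)) => t _.
  have cD : continuous (fun p : R * heis R => k (p.1, x + p.2) - k (p.1, x)).
    have c1 : continuous (fun p : R * heis R => p.1) by move=> p; exact: cvg_fst.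
    have c2 : continuous (fun p : R * heis R => x + p.2).
      by move=> p; apply: cvgD; [exact: cvg_cst|exact: cvg_snd].
    have c3 : continuous (fun p : R * heis R => x) by exact: cst_continuous.
    have c4 : continuous (fun p : R * heis R => (p.1, x + p.2)).
      by move=> p; exact: (cvg_pair (c1 p) (c2 p)).
    have c5 : continuous (fun p : R * heis R => (p.1, x)).
      by move=> p; exact: (cvg_pair (c1 p) (c3 p)).
    move=> p; apply: cvgB.
      exact: (continuous_comp (c4 p) (ck _)).
    exact: (continuous_comp (c5 p) (ck _)).
  have c1 := cD (t, 0); rewrite /continuous_at /= addr0 subrr in c1.
  have /cvgr0_norm_lt/(_ _ e0) := c1.
  by [].
have [d /= d0 Hd] := (nbhs_ballP _ _).1 near_k.
exists d => // h t hd t01.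
apply/ltW; apply: (Hd h); last by rewrite /= in_itv.
by rewrite -ball_normE /ball_/= sub0r normrN.
Qed.

End Flow.

(** The three coordinate derivatives are sealed, so that they stay atoms for [ring] and for
    unification. *)
HB.lock Definition D1 (R : realType) (F : heis R -> R) (x : heis R) : R :=
  'D_((1, 0, 0) : heis R) F x.
HB.lock Definition D2 (R : realType) (F : heis R -> R) (x : heis R) : R :=
  'D_((0, 1, 0) : heis R) F x.
HB.lock Definition D3 (R : realType) (F : heis R -> R) (x : heis R) : R :=
  'D_((0, 0, 1) : heis R) F x.

Section Differentials.
Variable R : realType.
Implicit Types (x y u v h : heis R) (F : heis R -> R) (s t : R).

Definition grad F x h : R := h.1.1 * D1 F x + h.1.2 * D2 F x + h.2 * D3 F x.

Lemma diff_heis F x h : differentiable F x -> 'd F x h = grad F x h.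
Proof.
move=> df; rewrite /grad !unlock !(deriveE _ df).
have {1}-> : h = h.1.1 *: ((1, 0, 0) : heis R) +
    h.1.2 *: ((0, 1, 0) : heis R) + h.2 *: ((0, 0, 1) : heis R).
  case: h => [[a b] c].
  by congr (_, _, _); rewrite /= /GRing.scale/= ?(mulr1, mulr0, addr0, add0r).
by rewrite !linearD !linearZ.
Qed.

Lemma derive_heis F x h : differentiable F x -> 'D_h F x = grad F x h.
Proof. by move=> df; rewrite deriveE// diff_heis. Qed.

Lemma norm_heis_le h : [/\ `|h.1.1| <= `|h|, `|h.1.2| <= `|h| & `|h.2| <= `|h|].
Proof. by case: h => [[a b] c]; rewrite !prod_normE /= !le_max !lexx/= !orbT. Qed.

Lemma linear_heis (a b c : R) : exists2 l : {linear heis R -> R},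
  continuous l & forall h, l h = h.1.1 * a + h.1.2 * b + h.2 * c.
Proof.
pose f h : R := h.1.1 * a + h.1.2 * b + h.2 * c.
have lf : linear f.
  move=> k h1 h2; rewrite /f /= /GRing.scale/=; ring.
pose m := GRing.isLinear.Build _ _ _ _ _ lf.
pose l : {linear heis R -> R} := HB.pack f m.
exists l => // h; rewrite /continuous_at /= /f.
apply: cvgD; [apply: cvgD|]; apply: cvgMl.
- exact: continuous_fst2.
- exact: continuous_snd2.
- exact: continuous_snd1.
Qed.

(** Differentiability from an explicit candidate for the gradient. It serves for the averages, whose
    gradient is guessed by differentiating under the integral sign. *)
Lemma differentiable_heisP F x (a b c : R) :
  (forall e : R, 0 < e -> exists2 d, 0 < d & forall h, `|h| < d ->
     `|F (x + h) - F x - (h.1.1 * a + h.1.2 * b + h.2 * c)| <= e * `|h|) ->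
  differentiable F x /\ forall h, 'D_h F x = h.1.1 * a + h.1.2 * b + h.2 * c.
Proof.
move=> H; have [l cl lE] := linear_heis a b c.
have Fl : (F : heis R -> R^o) \o shift x = cst (F x : R^o) + (l : heis R -> R^o) +o_ (0 : heis R) id.
  apply/eqaddoP => _/posnumP[e]; have [d d0 Hd] := H e%:num ltac:(done).
  near=> h => /=; rewrite !fctE /= lE opprD addrA [h + x]addrC.
  apply: Hd; near: h.
  apply/nbhs_ballP; exists d => //= h; rewrite -ball_normE /= sub0r normrN.
  by [].
have dE : 'd F x = l :> (heis R -> R) by exact: diff_unique cl Fl.
have dF : differentiable F x by apply/diff_locallyP; rewrite dE.
by split=> // h; rewrite deriveE// dE lE.
Unshelve. all: by end_near. Qed.

Lemma is_derive_curve F (a b c : R -> R) t (da db dc : R) :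
  differentiable F (a t, b t, c t) -> is_derive t (1 : R) a da ->
  is_derive t (1 : R) b db -> is_derive t (1 : R) c dc ->
  is_derive t (1 : R) (fun s => F (a s, b s, c s)) (grad F (a t, b t, c t) (da, db, dc)).
Proof.
move=> dF [da' <-] [db' <-] [dc' <-].
move/derivable1_diffP : da' => da'; move/derivable1_diffP : db' => db'.
move/derivable1_diffP : dc' => dc'.
have dab : differentiable (fun s => (a s, b s)) t by exact: differentiable_pair.
have dp : differentiable (fun s => ((a s, b s), c s)) t by exact: differentiable_pair.
have dFc : differentiable (F \o (fun s => ((a s, b s), c s))) t.
  exact: differentiable_comp.
apply: DeriveDef; first exact/derivable1_diffP.
rewrite !deriveE//.
have -> : 'd (fun s => F (a s, b s, c s)) t 1 =
    'd F (a t, b t, c t) ('d (fun s => ((a s, b s), c s)) t 1).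
  exact: (congr1 (fun l => l 1) (diff_comp dp dF)).
by rewrite diff_heis// diff_pair// diff_pair.
Qed.

Lemma heis_MVT F x h : (forall y, differentiable F y) ->
  exists2 t : R, 0 <= t <= 1 & F (x + h) - F x = grad F (x + t *: h) h.
Proof.
move=> dF.
have D t : is_derive t (1 : R) (fun s => F (x + s *: h)) (grad F (x + t *: h) h).
  have I (p q : R) : is_derive t (1 : R) (fun s => p + s * q) q.
    by apply: is_derive_eq; rewrite /GRing.scale/=; ring.
  have line s : x + s *: h = (x.1.1 + s * h.1.1, x.1.2 + s * h.1.2, x.2 + s * h.2).
    by case: x h => [[x1 x2] x3] [[h1 h2] h3].
  rewrite (_ : (fun s => _) = fun s => F (x.1.1 + s * h.1.1, x.1.2 + s * h.1.2, x.2 + s * h.2)); last first.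
    by apply/funext => s; rewrite line.
  rewrite line (_ : h = (h.1.1, h.1.2, h.2)); last by case: h {line} => [[]].
  exact: (is_derive_curve (dF _) (I x.1.1 h.1.1) (I x.1.2 h.1.2) (I x.2 h.2)).
have cF : {within `[0, 1], continuous (fun s : R => F (x + s *: h))}.
  apply: continuous_subspaceT => t; apply: differentiable_continuous.
  by apply/derivable1_diffP; have [] := D t.
have [t] := @MVT_segment R _ _ 0 1 ler01 (fun t _ => D t) cF.
by rewrite in_itv /= scale1r scale0r addr0 subr0 mulr1 => t01 ->; exists t.
Qed.

(** The left-invariant field of [v] in coordinates: the curve x exp (t v) has velocity (v1, v2, v3 +
    x1 v2) at t = 0. *)
Definition lie v F x : R := grad F x (v.1.1, v.1.2, v.2 + x.1.1 * v.1.2).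

Lemma is_derive_flow F v x t : (forall y, differentiable F y) ->
  is_derive t (1 : R) (fun s => F (flow v x s)) (lie v F (flow v x t)).
Proof.
move=> dF; rewrite /lie /flow /hmul /hexp /=.
apply: is_derive_curve => //.
- by apply: is_derive_eq; rewrite /GRing.scale/=; ring.
- by apply: is_derive_eq; rewrite /GRing.scale/=; ring.
- by apply: is_derive_eq; rewrite /GRing.scale/=; field.
Qed.

End Differentials.

Section Averages.
Variable R : realType.
Implicit Types (x y u v h : heis R) (F : heis R -> R) (k : R -> R) (s t : R).

(** The translations act on the right, so they commute with the lattice acting on the left and the
    average of an invariant function is invariant. *)
Definition avg v k F x : R := int01 (fun t => k t * F (flow v x t)).

Lemma continuous_avg_integrand v k F x : continuous k -> continuous F ->
  continuous (fun t => k t * F (flow v x t)).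
Proof.
move=> ck cF; apply: contM => //.
exact: cont_comp (continuous_flow (v := v) (x := x)) cF.
Qed.

Lemma differentiable_cont F : (forall x, differentiable F x) -> continuous F.
Proof. by move=> dF x; exact: differentiable_continuous. Qed.

Lemma Cinfty_differentiable F : Cinfty F -> forall x, differentiable F x.
Proof. by move=> /(_ 0%N)/Cn_diff. Qed.

Lemma Cinfty_continuous F : Cinfty F -> continuous F.
Proof. by move=> /Cinfty_differentiable/differentiable_cont. Qed.

Lemma Cinfty_D1 F : Cinfty F -> Cinfty (D1 F).
Proof. by rewrite unlock; exact: Cinfty_derive. Qed.

Lemma Cinfty_D2 F : Cinfty F -> Cinfty (D2 F).
Proof. by rewrite unlock; exact: Cinfty_derive. Qed.

Lemma Cinfty_D3 F : Cinfty F -> Cinfty (D3 F).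
Proof. by rewrite unlock; exact: Cinfty_derive. Qed.

Lemma avgD v k F G x : continuous k -> continuous F -> continuous G ->
  avg v k (fun y => F y + G y) x = avg v k F x + avg v k G x.
Proof.
move=> ck cF cG; rewrite /avg -int01D; [|exact: continuous_avg_integrand..].
by congr (int01 _); apply/funext => t; rewrite mulrDr.
Qed.

Lemma avgZ v k F x a : continuous k -> continuous F ->
  avg v k (fun y => a * F y) x = a * avg v k F x.
Proof.
move=> ck cF; rewrite /avg -int01Z; last exact: continuous_avg_integrand.
by congr (int01 _); apply/funext => t; rewrite mulrCA.
Qed.

Lemma avgN v k F x : continuous k -> continuous F ->
  avg v k (fun y => - F y) x = - avg v k F x.
Proof.
move=> ck cF; rewrite -mulN1r -avgZ//.
by congr avg; apply/funext => t; rewrite mulN1r.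
Qed.

Lemma avgZk v k F x a : continuous k -> continuous F ->
  avg v (fun t => a * k t) F x = a * avg v k F x.
Proof.
move=> ck cF; rewrite /avg -int01Z; last exact: continuous_avg_integrand.
by congr (int01 _); apply/funext => t; rewrite mulrA.
Qed.

Lemma avg_le v k F x (B M : R) : continuous k -> continuous F ->
  (forall t, 0 <= t <= 1 -> `|k t| <= B) -> (forall y, `|F y| <= M) ->
  `|avg v k F x| <= B * M.
Proof.
move=> ck cF kB FM; apply: int01_norm_le; first exact: continuous_avg_integrand.
by move=> t t01; rewrite normrM ler_pM// kB.
Qed.

Lemma avg_cst v k a x : continuous k -> avg v k (fun=> a) x = int01 k * a.
Proof.
move=> ck; rewrite /avg mulrC -int01Z//.
by congr (int01 _); apply/funext => t; rewrite mulrC.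
Qed.

Lemma avg_hmul v k F g x : avg v k F (hmul g x) = avg v k (F \o hmul g) x.
Proof. by congr (int01 _); apply/funext => t; rewrite /flow -hmulA. Qed.

Lemma avg_ext v k F G x : (forall y, F y = G y) -> avg v k F x = avg v k G x.
Proof. by move=> /funext ->. Qed.

Lemma kernel_bounded k : continuous k ->
  exists2 B : R, 0 <= B & forall t, 0 <= t <= 1 -> `|k t| <= B.
Proof.
move=> ck; have kc : compact (k @` `[0, 1]).
  by apply: continuous_compact; [exact: continuous_subspaceT|exact: segment_compact].
have [M [_ HM]] := compact_bounded kc.
exists (Num.max M 0 + 1); first by rewrite addr_ge0// le_max lexx orbT.
move=> t t01; apply: HM; first by rewrite ltr_pwDr// le_max lexx.
by exists t => //=; rewrite in_itv.
Qed.

Lemma continuousM_id k a : continuous k -> continuous (fun t => t * a * k t).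
Proof.
move=> ck; apply: contM => //; apply: contM; last exact: cst_continuous.
by move=> t; exact: cvg_id.
Qed.

Lemma avgZid v k F x a : continuous k -> continuous F ->
  avg v (fun t => t * a * k t) F x = a * avg v (fun t => t * 1 * k t) F x.
Proof.
move=> ck cF; rewrite -avgZk//; last exact: continuousM_id.
by congr (int01 _); apply/funext => t; rewrite mulr1 mulrCA !mulrA.
Qed.

(** Differentiation under the integral sign. The second kernel, t v2 k(t), appears because the last
    coordinate of x exp (t v) contains x1 t v2: moving [x] along [h] moves this point along (h1, h2,
    h3 + h1 t v2). *)
Lemma derive_avg v k F x : continuous k -> Cinfty F ->
  differentiable (avg v k F) x /\
  forall h, 'D_h (avg v k F) x =
    h.1.1 * (avg v k (D1 F) x + avg v (fun t => t * v.1.2 * k t) (D3 F) x) +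
    h.1.2 * avg v k (D2 F) x + h.2 * avg v k (D3 F) x.
Proof.
move=> ck CF; have dF := Cinfty_differentiable CF.
have cF := Cinfty_continuous CF.
have c1 := Cinfty_continuous (Cinfty_D1 CF).
have c2 := Cinfty_continuous (Cinfty_D2 CF).
have c3 := Cinfty_continuous (Cinfty_D3 CF).
have ck3 := continuousM_id (a := v.1.2) ck.
apply: differentiable_heisP => e e0.
have [B B0 kB] := kernel_bounded ck.
(* [B] bounds the kernel and the second factor the four products in the increment of the gradient;
   [B + 1] instead of [B] keeps [C] positive when the kernel vanishes. *)
pose C := (B + 1) * (3 + `|v.1.2|).
have C0 : 0 < C by apply: mulr_gt0; [rewrite ltr_wpDl|rewrite ltr_wpDr].
have eC : 0 < e / C by rewrite divr_gt0.
have ceq (G : heis R -> R) : continuous G ->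
    continuous (fun p : R * heis R => G (flow v p.2 p.1)).
  by move=> cG; exact: cont_comp (@continuous_flow2 R v) cG.
have [d1 d10 E1] := unit_interval_equicontinuous x (ceq _ c1) eC.
have [d2 d20 E2] := unit_interval_equicontinuous x (ceq _ c2) eC.
have [d3 d30 E3] := unit_interval_equicontinuous x (ceq _ c3) eC.
exists (Num.min d1 (Num.min d2 d3)); first by rewrite !lt_min d10 d20 d30.
move=> h; rewrite !lt_min => /andP[hd1 /andP[hd2 hd3]].
(* The displacement of [flow v x t] caused by the displacement [h] of [x]; it is linear in [h], so
   the mean value theorem applies to the whole segment. *)
pose A t : heis R := (h.1.1, h.1.2, h.2 + h.1.1 * (t * v.1.2)).
pose err t := F (flow v (x + h) t) - F (flow v x t) - grad F (flow v x t) (A t).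
have flowD t s : flow v (x + s *: h) t = flow v x t + s *: A t.
  rewrite /flow /hmul /hexp /=; congr (_, _, _); rewrite /= /GRing.scale/=; ring.
have errE : avg v k F (x + h) - avg v k F x -
   (h.1.1 * (avg v k (D1 F) x + avg v (fun t => t * v.1.2 * k t) (D3 F) x) +
    h.1.2 * avg v k (D2 F) x + h.2 * avg v k (D3 F) x) =
   int01 (fun t => k t * err t).
  have ca k' G y := @continuous_avg_integrand v k' G y.
  rewrite /avg -(int01D (ca _ _ _ ck c1) (ca _ _ _ ck3 c3)).
  have cD : continuous (fun t => k t * D1 F (flow v x t) +
      t * v.1.2 * k t * D3 F (flow v x t)).
    by apply: contD; exact: ca.
  rewrite -(int01Z h.1.1 cD) -(int01Z h.1.2 (ca _ _ _ ck c2)).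
  rewrite -(int01Z h.2 (ca _ _ _ ck c3)).
  rewrite -int01D; [|exact: contZ cD|exact: contZ (ca _ _ _ ck c2)].
  rewrite -int01D; [|by apply: contD; [exact: contZ cD|exact: contZ (ca _ _ _ ck c2)]|
    exact: contZ (ca _ _ _ ck c3)].
  rewrite -int01B; [|exact: ca..].
  rewrite -int01B; last 2 first.
  - by apply: contB; exact: ca.
  - apply: contD; last exact: contZ (ca _ _ _ ck c3).
    by apply: contD; [exact: contZ cD|exact: contZ (ca _ _ _ ck c2)].
  congr (int01 _); apply/funext => t; rewrite /err /grad /A/=; ring.
have err_le t : 0 <= t <= 1 -> `|err t| <= e / C * (3 + `|v.1.2|) * `|h|.
  move=> t01; rewrite /err -[h in flow v (x + h)]scale1r flowD scale1r.
  have [s s01 ->] := heis_MVT (flow v x t) (A t) dF.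
  rewrite -flowD /grad /=.
  have sh : `|s *: h| <= `|h|.
    by rewrite normrZ ler_piMl//; case/andP: s01 => s0 s1; rewrite ger0_norm.
  have L1 := E1 _ _ (le_lt_trans sh hd1) t01.
  have L2 := E2 _ _ (le_lt_trans sh hd2) t01.
  have L3 := E3 _ _ (le_lt_trans sh hd3) t01.
  rewrite /= in L1 L2 L3.
  have [h1 h2 h3] := norm_heis_le h.
  set a1 := D1 F _; set a2 := D2 F _; set a3 := D3 F _.
  set b1 := D1 F _; set b2 := D2 F _; set b3 := D3 F _.
  rewrite -/a1 -/a2 -/a3 -/b1 -/b2 -/b3 in L1 L2 L3.
  have -> : h.1.1 * a1 + h.1.2 * a2 + (h.2 + h.1.1 * (t * v.1.2)) * a3 -
      (h.1.1 * b1 + h.1.2 * b2 + (h.2 + h.1.1 * (t * v.1.2)) * b3) =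
      h.1.1 * (a1 - b1) + h.1.2 * (a2 - b2) + h.2 * (a3 - b3) +
      h.1.1 * (t * v.1.2) * (a3 - b3) by ring.
  have -> : e / C * (3 + `|v.1.2|) * `|h| = `|h| * (e / C) + `|h| * (e / C) +
     `|h| * (e / C) + `|h| * `|v.1.2| * (e / C) by ring.
  apply: (le_trans (ler_normD _ _)); apply: lerD; [apply: (le_trans (ler_normD _ _));
    apply: lerD; [apply: (le_trans (ler_normD _ _)); apply: lerD|]|].
  - rewrite normrM; apply: ler_pM; [exact: normr_ge0|exact: normr_ge0|exact: h1|exact: L1].
  - rewrite normrM; apply: ler_pM; [exact: normr_ge0|exact: normr_ge0|exact: h2|exact: L2].
  - rewrite normrM; apply: ler_pM; [exact: normr_ge0|exact: normr_ge0|exact: h3|exact: L3].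
  - rewrite !normrM; apply: ler_pM; [by rewrite !mulr_ge0|exact: normr_ge0| |exact: L3].
    apply: ler_pM; [exact: normr_ge0|by rewrite mulr_ge0|exact: h1|].
    by rewrite ler_piMl//; case/andP: t01 => t0 t1; rewrite ger0_norm.
have ceps : continuous (fun t => k t * err t).
  have cfl y (G : heis R -> R) : continuous G -> continuous (fun t => G (flow v y t)).
    by move=> cG; exact: cont_comp (continuous_flow (v := v) (x := y)) cG.
  apply: contM => //; apply: contB; first by apply: contB; exact: cfl cF.
  rewrite /grad /A /=; apply: contD; [apply: contD|]; apply: contM.
  - exact: cst_continuous.
  - exact: cfl c1.
  - exact: cst_continuous.
  - exact: cfl c2.
  - apply: contD; first exact: cst_continuous.
    apply: contM; first exact: cst_continuous.
    apply: contM; last exact: cst_continuous.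
    by move=> t; exact: cvg_id.
  - exact: cfl c3.
rewrite errE.
apply: (@le_trans _ _ (B * (e / C * (3 + `|v.1.2|) * `|h|))).
  apply: int01_norm_le => // t t01.
  rewrite normrM; apply: ler_pM; [exact: normr_ge0|exact: normr_ge0|exact: kB|].
  exact: err_le.
rewrite mulrA ler_wpM2r// /C.
rewrite [leLHS](_ : _ = e * (B / (B + 1))); last first.
  have B1 : B + 1 != 0 by rewrite gt_eqF// ltr_wpDl.
  have v3 : 3 + `|v.1.2| != 0 by rewrite gt_eqF// ltr_wpDr.
  by field; rewrite B1 v3.
apply: ler_piMr; first exact: ltW.
by rewrite ler_pdivrMr ?ltr_wpDl// mul1r lerDl.
Qed.

(** The induction has to range over the kernels, since each derivative also brings in the kernel t
    v2 k(t). *)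
Lemma Cinfty_avg v k F : continuous k -> Cinfty F -> Cinfty (avg v k F).
Proof.
move=> ck CF n; elim: n k F ck CF => [|n IH] k F ck CF.
  by split=> // x; have [] := derive_avg v x ck CF.
split=> [x|h]; first by have [] := derive_avg v x ck CF.
rewrite (_ : 'D_h _ = fun x =>
    h.1.1 * (avg v k (D1 F) x + avg v (fun t => t * v.1.2 * k t) (D3 F) x) +
    h.1.2 * avg v k (D2 F) x + h.2 * avg v k (D3 F) x); last first.
  by apply/funext => x; have [_ ->] := derive_avg v x ck CF.
have ck3 := continuousM_id (a := v.1.2) ck.
have C1 := IH _ _ ck (Cinfty_D1 CF).
have C2 := IH _ _ ck (Cinfty_D2 CF).
have C3 := IH _ _ ck (Cinfty_D3 CF).
have C4 := IH _ _ ck3 (Cinfty_D3 CF).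
apply: CnD; [apply: CnD|]; (apply: CnM; first exact: Cn_cst) => //.
exact: CnD.
Qed.

(** The commutator form: the bracket of [u] and [v] is [omega u v] times the central direction. *)
Definition omega u v : R := u.1.1 * v.1.2 - u.1.2 * v.1.1.

Lemma continuous_lie u F : Cinfty F -> continuous (lie u F).
Proof.
move=> CF; rewrite /lie /grad /=.
apply: contD; [apply: contD|]; apply: contM.
- exact: cst_continuous.
- exact: (Cinfty_continuous (Cinfty_D1 CF)).
- exact: cst_continuous.
- exact: (Cinfty_continuous (Cinfty_D2 CF)).
- apply: contD; first exact: cst_continuous.
  by apply: contM; [exact: continuous_fst2|exact: cst_continuous].
- exact: (Cinfty_continuous (Cinfty_D3 CF)).
Qed.

(** The correction comes from exp (s u) exp (t v) = exp (t v) exp (s (u + t [u, v])), whose bracket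
    is [omega u v] times the centre. *)
Lemma lie_avg u v k F x : continuous k -> Cinfty F ->
  lie u (avg v k F) x =
    avg v k (lie u F) x + avg v (fun t => t * omega u v * k t) (D3 F) x.
Proof.
move=> ck CF; have [_ dE] := derive_avg v x ck CF.
have proj (a b c : R) : [/\ 1 * a + 0 * b + 0 * c = a,
    0 * a + 1 * b + 0 * c = b & 0 * a + 0 * b + 1 * c = c] by split; ring.
have E1 : D1 (avg v k F) x = avg v k (D1 F) x +
    avg v (fun t => t * v.1.2 * k t) (D3 F) x.
  by rewrite {1}unlock; apply: (etrans (dE _)); exact: (let: And3 h _ _ := proj _ _ _ in h).
have E2 : D2 (avg v k F) x = avg v k (D2 F) x.
  by rewrite {1}unlock; apply: (etrans (dE _)); exact: (let: And3 _ h _ := proj _ _ _ in h).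
have E3 : D3 (avg v k F) x = avg v k (D3 F) x.
  by rewrite {1}unlock; apply: (etrans (dE _)); exact: (let: And3 _ _ h := proj _ _ _ in h).
rewrite {1}/lie /grad E1 E2 E3 /=.
have c1 := Cinfty_continuous (Cinfty_D1 CF).
have c2 := Cinfty_continuous (Cinfty_D2 CF).
have c3 := Cinfty_continuous (Cinfty_D3 CF).
have ckid a := continuousM_id (a := a) ck.
have cf := continuous_avg_integrand (v := v) (x := x).
have lE : avg v k (lie u F) x = u.1.1 * avg v k (D1 F) x +
    u.1.2 * avg v k (D2 F) x + (u.2 + x.1.1 * u.1.2) * avg v k (D3 F) x +
    avg v (fun t => t * (v.1.1 * u.1.2) * k t) (D3 F) x.
  rewrite /avg -!int01Z; [|exact: cf..].
  rewrite -int01D; [|exact/contZ/cf..].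
  rewrite -int01D; [|by apply: contD; exact/contZ/cf|exact/contZ/cf].
  rewrite -int01D; last 2 first.
  - by apply: contD; [apply: contD|]; exact/contZ/cf.
  - exact: cf.
  by congr (int01 _); apply/funext => t; rewrite /lie /grad /=; ring.
rewrite lE.
rewrite (avgZid v x v.1.2 ck c3) (avgZid v x (v.1.1 * u.1.2) ck c3).
rewrite (avgZid v x (omega u v) ck c3) /omega.
move: (avg v k (D1 F) x) (avg v k (D2 F) x) (avg v k (D3 F) x) => a1 a2 a3.
move: (avg v _ (D3 F) x) => a4; ring.
Qed.

(** Integration by parts along the orbit t -> x exp (t v), on which [lie v F] is the derivative of
    [F]. *)
Lemma avg_lie_parts v k k' F x : Cinfty F -> continuous k' ->
  (forall t : R, is_derive t (1 : R) k (k' t)) ->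
  avg v k (lie v F) x = k 1 * F (hmul x (hexp v 1)) - k 0 * F x - avg v k' F x.
Proof.
move=> CF ck' dk.
have ck : continuous k.
  move=> t; apply: differentiable_continuous; apply/derivable1_diffP.
  by have [] := dk t.
have cF := Cinfty_continuous CF.
apply/eqP; rewrite eq_sym subr_eq eq_sym; apply/eqP.
have cf := continuous_avg_integrand (v := v) (x := x).
have cl := continuous_lie (u := v) CF.
have cfl : continuous (fun t => k t * lie v F (flow v x t)) by apply: cf.
rewrite /avg -int01D; [|exact: cfl|exact: cf].
have -> : k 0 * F x = k 0 * F (flow v x 0) by rewrite /flow hexp0 hmulg0.
apply: (@int01_FTC _ (fun t => k t * F (flow v x t))).
  by apply: contD; [exact: cfl|exact: cf].
move=> t; have dF := is_derive_flow v x t (Cinfty_differentiable CF).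
have dP := @is_deriveM _ _ k (fun s => F (flow v x s)) t 1 _ _ (dk t) dF.
by apply: (is_derive_eq dP); rewrite /GRing.scale/=; ring.
Qed.

End Averages.

(** * Calculus on complex-valued test functions *)

Notation normc := ComplexField.Normc.normc.

Section ComplexNorm.
Variable R : realType.
Implicit Types z : R[i].

Lemma Re_le_normc z : `|complex.Re z| <= normc z.
Proof.
case: z => a b /=; rewrite -sqrtr_sqr ler_sqrt ?lerDl ?sqr_ge0//.
by rewrite addr_ge0 ?sqr_ge0.
Qed.

Lemma Im_le_normc z : `|complex.Im z| <= normc z.
Proof.
case: z => a b /=; rewrite -sqrtr_sqr ler_sqrt ?lerDr ?sqr_ge0//.
by rewrite addr_ge0 ?sqr_ge0.
Qed.

Lemma normc_le z : normc z <= `|complex.Re z| + `|complex.Im z|.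
Proof.
case: z => a b /=; rewrite -[leRHS]ger0_norm ?addr_ge0// -sqrtr_sqr.
rewrite ler_sqrt ?sqr_ge0// sqrrD !real_normK ?num_real//.
by rewrite [leRHS]addrAC lerDl mulrn_wge0// mulr_ge0.
Qed.

Lemma normc_ge0' z : 0 <= normc z.
Proof. by case: z => a b; exact: sqrtr_ge0. Qed.

Lemma complexE z1 z2 : complex.Re z1 = complex.Re z2 ->
  complex.Im z1 = complex.Im z2 -> z1 = z2.
Proof. by case: z1 z2 => [a b] [c d] /= -> ->. Qed.

End ComplexNorm.

(* [vfield], sealed to keep unification from unfolding derivatives. *)
HB.lock Definition vf (R : realType) (Gamma : set (heis R)) (v : heis R)
  (f : testfn Gamma) : testfn Gamma := vfield v f.

Section TestFunctionCalculus.
Variables (R : realType) (Gamma : set (heis R)).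
Implicit Types (f g : testfn Gamma) (x y u v : heis R) (k : R -> R).

Definition re f x : R := complex.Re (f x).
Definition im f x : R := complex.Im (f x).

Lemma Cinfty_re f : Cinfty (re f).
Proof. by have [[]] := testfnP f. Qed.

Lemma Cinfty_im f : Cinfty (im f).
Proof. by have [[]] := testfnP f. Qed.

Lemma cont_re f : continuous (re f).
Proof. exact: Cinfty_continuous (Cinfty_re f). Qed.

Lemma cont_im f : continuous (im f).
Proof. exact: Cinfty_continuous (Cinfty_im f). Qed.

Lemma testfn_inv f (g x : heis R) : Gamma g -> f (hmul g x) = f x.
Proof. by have [_] := testfnP f; apply. Qed.

Lemma testfn_ext f g : (forall x, f x = g x) -> f = g.
Proof. by move=> fg; apply: val_inj; apply/funext. Qed.

Lemma testfn_ext2 f g : re f = re g -> im f = im g -> f = g.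
Proof.
move=> fg1 fg2; apply: testfn_ext => x; apply: complexE.
  exact: (congr1 (fun F => F x) fg1).
exact: (congr1 (fun F => F x) fg2).
Qed.

Lemma testfnD f g x : (f + g) x = f x + g x. Proof. by []. Qed.
Lemma testfnZ (a : R[i]) f x : (a *: f) x = a * f x. Proof. by []. Qed.
Lemma testfnN f x : (- f) x = - f x. Proof. by []. Qed.
Lemma testfn0 x : (0 : testfn Gamma) x = 0. Proof. by []. Qed.

Lemma reD f g x : re (f + g) x = re f x + re g x.
Proof. by rewrite /re testfnD raddfD. Qed.

Lemma imD f g x : im (f + g) x = im f x + im g x.
Proof. by rewrite /im testfnD raddfD. Qed.

Lemma reZ (a : R[i]) f x :
  re (a *: f) x = complex.Re a * re f x - complex.Im a * im f x.
Proof. by rewrite /re /im testfnZ; case: a (f x) => [? ?] [? ?]. Qed.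

Lemma imZ (a : R[i]) f x :
  im (a *: f) x = complex.Re a * im f x + complex.Im a * re f x.
Proof. by rewrite /re /im testfnZ; case: a (f x) => [? ?] [? ?]. Qed.

Lemma lie_lin v (a b : R) F G x : (forall y, differentiable F y) ->
  (forall y, differentiable G y) ->
  lie v (fun y => a * F y + b * G y) x = a * lie v F x + b * lie v G x.
Proof.
move=> dF dG.
have E h : 'D_h (fun y => a * F y + b * G y) x = a * 'D_h F x + b * 'D_h G x.
  have dZ (c : R) (H : heis R -> R) : (forall y, differentiable H y) ->
      derivable (fun y => c * H y) x h /\ 'D_h (fun y => c * H y) x = c * 'D_h H x.
    move=> dH; have dh : derivable H x h by exact: diff_derivable.
    split; first exact: (@derivableZ _ _ _ H c x h dh).
    exact: (@deriveZ _ _ _ H c x h dh).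
  have [dF1 E1] := dZ a F dF; have [dG1 E2] := dZ b G dG.
  transitivity ('D_h (fun y => a * F y) x + 'D_h (fun y => b * G y) x).
    exact: (@deriveD _ _ _ (fun y => a * F y) (fun y => b * G y)).
  by rewrite E1 E2.
have EE : [/\ D1 (fun y => a * F y + b * G y) x = a * D1 F x + b * D1 G x,
    D2 (fun y => a * F y + b * G y) x = a * D2 F x + b * D2 G x &
    D3 (fun y => a * F y + b * G y) x = a * D3 F x + b * D3 G x].
  by rewrite !unlock; split; exact: E.
by rewrite /lie /grad; have [-> -> ->] := EE; ring.
Qed.

Lemma lie_linl u v (a b : R) F x :
  lie (a *: u + b *: v) F x = a * lie u F x + b * lie v F x.
Proof. by rewrite /lie /grad /= /GRing.scale/=; ring. Qed.

Lemma derive_hmul_lie v F x : Cinfty F -> 'D_v (F \o hmul x) 0 = lie v F x.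
Proof. by move=> CF; rewrite derive_hmul// /lie /grad !unlock. Qed.

Lemma re_vf v f x : re (vf v f) x = lie v (re f) x.
Proof. by rewrite unlock; exact: derive_hmul_lie (Cinfty_re f). Qed.

Lemma im_vf v f x : im (vf v f) x = lie v (im f) x.
Proof. by rewrite unlock; exact: derive_hmul_lie (Cinfty_im f). Qed.

Lemma vf_linear v : linear (@vf R Gamma v).
Proof.
move=> a f g; have dr h := Cinfty_differentiable (Cinfty_re h).
have di h := Cinfty_differentiable (Cinfty_im h).
have reE : re (a *: f + g) = fun y => 1 * (complex.Re a * re f y + - complex.Im a * im f y) + 1 * re g y.
  by apply/funext => y; rewrite reD reZ; ring.
have imE : im (a *: f + g) = fun y => 1 * (complex.Re a * im f y + complex.Im a * re f y) + 1 * im g y.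
  by apply/funext => y; rewrite imD imZ; ring.
have dl (c d : R) F G : (forall y : heis R, differentiable (F : heis R -> R) y) ->
    (forall y, differentiable (G : heis R -> R) y) ->
    forall y, differentiable (fun y => c * F y + d * G y) y.
  by move=> dF dG y; apply: differentiableD; apply: differentiableM.
apply: testfn_ext2; apply/funext => x.
  rewrite re_vf reD reZ !re_vf im_vf reE lie_lin//; last exact: dl.
  by rewrite lie_lin//; ring.
rewrite im_vf imD imZ re_vf !im_vf imE lie_lin//; last exact: dl.
by rewrite lie_lin//; ring.
Qed.

HB.instance Definition _ v :=
  GRing.isLinear.Build _ _ _ _ (@vf R Gamma v) (vf_linear v).

Lemma vf_linl u v (a b : R) f :
  vf (a *: u + b *: v) f = a%:C *: vf u f + b%:C *: vf v f.
Proof.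
have auxr (c p q : R) : complex.Re c%:C * p - complex.Im c%:C * q = c * p.
  by rewrite /= mul0r subr0.
have auxi (c p q : R) : complex.Re c%:C * p + complex.Im c%:C * q = c * p.
  by rewrite /= mul0r addr0.
apply: testfn_ext2; apply/funext => x.
  by rewrite reD !reZ !auxr !re_vf lie_linl.
by rewrite imD !imZ !auxi !im_vf lie_linl.
Qed.

Lemma vfD u v f : vf (u + v) f = vf u f + vf v f.
Proof. by have := vf_linl u v 1 1 f; rewrite !scale1r. Qed.

Lemma vfZ u (a : R) f : vf (a *: u) f = a%:C *: vf u f.
Proof. by have := vf_linl u u a 0 f; rewrite !scale0r !addr0. Qed.

Lemma avgt_subproof v k (ck : continuous k) f :
  (fun x => (avg v k (re f) x +i* avg v k (im f) x : R[i]^o)) \in testpred Gamma.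
Proof.
rewrite inE; split.
  split; first exact: Cinfty_avg ck (Cinfty_re f).
  exact: Cinfty_avg ck (Cinfty_im f).
move=> g x Gg; rewrite !avg_hmul; congr (_ +i* _); apply: avg_ext => y /=.
  by rewrite /re testfn_inv.
by rewrite /im testfn_inv.
Qed.

Definition avgt v k (ck : continuous k) f : testfn Gamma :=
  TestFn (avgt_subproof v ck f).

Lemma re_avgt v k (ck : continuous k) f : re (avgt v ck f) = avg v k (re f).
Proof. by []. Qed.

Lemma im_avgt v k (ck : continuous k) f : im (avgt v ck f) = avg v k (im f).
Proof. by []. Qed.

Lemma avgt_linear v k (ck : continuous k) : linear (avgt v ck).
Proof.
move=> a f g; have cr := cont_re; have ci := cont_im.
apply: testfn_ext2; apply/funext => x.
  rewrite reD reZ !re_avgt im_avgt.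
  rewrite -!avgZ// -avgN//; last exact: contZ.
  rewrite -avgD//; [|exact: contZ|].
    rewrite -avgD//.
      by apply: avg_ext => y; rewrite reD reZ.
    by apply: contB; exact: contZ.
  by move=> t; apply: cvgN; exact: (contZ (ci f)).
rewrite imD imZ !im_avgt re_avgt.
rewrite -!avgZ// -avgD//; [|exact: contZ..].
rewrite -avgD//; first by apply: avg_ext => y; rewrite imD imZ.
by apply: contD; exact: contZ.
Qed.

HB.instance Definition _ v k (ck : continuous k) :=
  GRing.isLinear.Build _ _ _ _ (avgt v ck) (avgt_linear v ck).

Definition e3 : heis R := (0, 0, 1).

Lemma lie_e3 F x : lie e3 F x = D3 F x.
Proof. by rewrite /lie /grad /=; ring. Qed.

Lemma vf_avgt u v k (ck : continuous k) f :
  vf u (avgt v ck f) = avgt v ck (vf u f) +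
    avgt v (continuousM_id (a := omega u v) ck) (vf e3 f).
Proof.
have rE w : re (vf w f) = lie w (re f) by apply/funext => y; rewrite re_vf.
have iE w : im (vf w f) = lie w (im f) by apply/funext => y; rewrite im_vf.
have e3E F : lie e3 F = D3 F by apply/funext => y; exact: lie_e3.
apply: testfn_ext2; apply/funext => x.
  by rewrite re_vf reD !re_avgt !rE e3E; apply: lie_avg => //; exact: Cinfty_re.
by rewrite im_vf imD !im_avgt !iE e3E; apply: lie_avg => //; exact: Cinfty_im.
Qed.

Lemma avgt0k v k (ck : continuous k) f : (forall t, k t = 0) -> avgt v ck f = 0.
Proof.
move=> k0; have E F x : avg v k F x = 0.
  by rewrite /avg -[RHS](int01_cst 0); congr int01; apply/funext => t; rewrite k0 mul0r.
by apply: testfn_ext => x; apply: complexE; exact: E.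
Qed.

(** The two cases are the two uses: central averages of arbitrary functions, where [omega u v]
    vanishes, and averages in any direction of functions that do not depend on the centre. *)
Lemma vf_avgt_comm u v k (ck : continuous k) f :
  omega u v = 0 \/ vf e3 f = 0 -> vf u (avgt v ck f) = avgt v ck (vf u f).
Proof.
rewrite vf_avgt; case=> [w0| ->]; last by rewrite linear0 addr0.
rewrite (avgt0k _ _ (vf e3 f)) ?addr0// => t; by rewrite w0 mulr0 mul0r.
Qed.

Lemma avgt_parts v k k' (ck : continuous k) (ck' : continuous k') f :
  (forall t : R, is_derive t (1 : R) k (k' t)) ->
  (forall x, f (hmul x (hexp v 1)) = f x) ->
  avgt v ck (vf v f) = (k 1 - k 0)%:C *: f - avgt v ck' f.
Proof.
move=> dk pf.
have rE : re (vf v f) = lie v (re f) by apply/funext => y; rewrite re_vf.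
have iE : im (vf v f) = lie v (im f) by apply/funext => y; rewrite im_vf.
apply: testfn_ext2; apply/funext => x.
  rewrite reD reZ re_avgt rE (avg_lie_parts v x (Cinfty_re f) ck' dk) {1}/re pf.
  by rewrite /re /=; ring.
rewrite imD imZ im_avgt iE (avg_lie_parts v x (Cinfty_im f) ck' dk) {1}/im pf.
by rewrite /im /=; ring.
Qed.

Lemma omega_self v : omega v v = 0.
Proof. by rewrite /omega mulrC subrr. Qed.

Lemma vf_avgt_parts v k k' (ck : continuous k) (ck' : continuous k') f :
  (forall t : R, is_derive t (1 : R) k (k' t)) ->
  (forall x, f (hmul x (hexp v 1)) = f x) ->
  vf v (avgt v ck f) = (k 1 - k 0)%:C *: f - avgt v ck' f.
Proof.
move=> dk pf; rewrite vf_avgt_comm ?(avgt_parts ck ck')//.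
by left; exact: omega_self.
Qed.

Lemma vf0_const v f x t : vf v f = 0 -> f (hmul x (hexp v t)) = f x.
Proof.
move=> vf0; have vf0r F : (forall y, differentiable F y) ->
    (forall y, lie v F y = 0) -> F (flow v x t) = F (flow v x 0).
  move=> dF lF; apply: (@is_derive_0_is_cst _ (fun s => F (flow v x s))) => s.
  by rewrite -(lF (flow v x s)); exact: is_derive_flow.
rewrite -/(flow v x t) -[in RHS](hmulg0 x) -(hexp0 v) -/(flow v x 0).
apply: complexE.
  apply: (vf0r (re f)); first exact: Cinfty_differentiable (Cinfty_re f).
  by move=> y; rewrite -re_vf vf0.
apply: (vf0r (im f)); first exact: Cinfty_differentiable (Cinfty_im f).
by move=> y; rewrite -im_vf vf0.
Qed.

(** Invariance is on the left and the translation on the right. The two differ by a commutator,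
    which is central and does not affect [f]. *)
Lemma hexp1_period v f : Gamma (hexp v 1) -> vf e3 f = 0 ->
  forall x, f (hmul x (hexp v 1)) = f x.
Proof.
move=> Gv f3 x.
have -> : hmul x (hexp v 1) = hmul (hexp v 1) (hmul x (hexp e3 (x.1.1 * v.1.2 - v.1.1 * x.1.2))).
  rewrite /hmul /hexp /e3 /=; congr (_, _, _); ring.
by rewrite testfn_inv// vf0_const.
Qed.

(** A central translation is the same on either side, so here nothing is asked of [f]. *)
Lemma central_period (w : heis R) f : w.1 = 0 -> Gamma w ->
  forall x, f (hmul x (hexp w 1)) = f x.
Proof.
move=> w0 Gw x; rewrite (_ : hmul x (hexp w 1) = hmul w x) ?testfn_inv//.
case: w w0 {Gw} => [[a b] c] [-> ->]; rewrite /hmul /hexp /=; congr (_, _, _); ring.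
Qed.

Lemma vfsC0_const f : (forall v, vf v f = 0) -> forall x, f x = f 0.
Proof.
(* [v] is the logarithm of [x], so that the flow of [v] joins 0 to [x] in time 1. *)
move=> vf0 x; pose v : heis R := (x.1.1, x.1.2, x.2 - x.1.1 * x.1.2 / 2).
rewrite -(vf0_const 0 1 (vf0 v)); congr (f _).
rewrite /hmul /hexp /v /=; case: x {v} => [[a b] c] /=; congr (_, _, _); ring.
Qed.

End TestFunctionCalculus.

(** * Fourier modes of distributions *)

Section Fejer.
Variable R : realType.
Implicit Types (t a : R) (n : int) (N m : nat).

Lemma continuous_cosM a : continuous (fun t => cos (a * t)).
Proof.
apply: cont_comp (@continuous_cos R); apply: contM; first exact: cst_continuous.
by move=> t; exact: cvg_id.
Qed.

Lemma continuous_sinM a : continuous (fun t => sin (a * t)).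
Proof.
apply: cont_comp (@continuous_sin R); apply: contM; first exact: cst_continuous.
by move=> t; exact: cvg_id.
Qed.

Lemma is_derive_cosM a t : is_derive t (1 : R) (fun t => cos (a * t)) (- a * sin (a * t)).
Proof.
have d1 : is_derive t (1 : R) (fun t => a * t) a.
  by apply: is_derive_eq; rewrite /GRing.scale/=; ring.
have := @is_derive1_comp _ cos (fun t => a * t) t _ _ (is_derive_cos _) d1.
by move=> d; apply: (is_derive_eq d); ring.
Qed.

Lemma is_derive_sinM a t : is_derive t (1 : R) (fun t => sin (a * t)) (a * cos (a * t)).
Proof.
have d1 : is_derive t (1 : R) (fun t => a * t) a.
  by apply: is_derive_eq; rewrite /GRing.scale/=; ring.
have := @is_derive1_comp _ sin (fun t => a * t) t _ _ (is_derive_sin _) d1.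
by move=> d; apply: (is_derive_eq d); ring.
Qed.

Definition freq n : R := n%:~R * (pi *+ 2).

Lemma freqB n1 n2 : freq (n1 - n2) = freq n1 - freq n2.
Proof. by rewrite /freq rmorphB/= mulrBl. Qed.

Lemma freqD n1 n2 : freq (n1 + n2) = freq n1 + freq n2.
Proof. by rewrite /freq rmorphD/= mulrDl. Qed.

Lemma cos_sin_freq n : cos (freq n) = 1 /\ sin (freq n) = 0.
Proof.
have P (k : nat) : cos (k%:~R * (pi *+ 2) : R) = 1 /\ sin (k%:~R * (pi *+ 2) : R) = 0.
  rewrite -pmulrn mulr_natl -[_ *+ k]add0r.
  by rewrite (periodicn (@cosD2pi R)) (periodicn (@sinD2pi R)) cos0 sin0.
rewrite /freq; case: n => k; first exact: P.
rewrite NegzE rmorphN /= mulNr cosN sinN.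
by have [-> ->] := P k.+1; rewrite oppr0.
Qed.

Lemma freq_eq0 n : (freq n == 0) = (n == 0).
Proof.
rewrite /freq mulf_eq0 intr_eq0 orbC (_ : _ == 0 = false)//.
by apply/negbTE; rewrite mulrn_eq0 /= gt_eqF// pi_gt0.
Qed.

Lemma int01_cos n : int01 (fun t => cos (freq n * t)) = (n == 0)%:R.
Proof.
have [->|n0] := eqVneq n 0.
  rewrite -[RHS](int01_cst 1); congr (int01 _); apply/funext => t.
  by rewrite /freq mul0r mul0r cos0.
have f0 : freq n != 0 by rewrite freq_eq0.
have dS t : is_derive t (1 : R) (fun t => (freq n)^-1 * sin (freq n * t)) (cos (freq n * t)).
  have d := is_derive_sinM (freq n) t.
  have dP := @is_deriveZ _ _ _ _ (freq n)^-1 t 1 _ d.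
  by apply: (is_derive_eq dP); rewrite /GRing.scale/= mulrA mulVf// mul1r.
rewrite (int01_FTC (@continuous_cosM _) dS).
have [_ s0] := cos_sin_freq n.
by rewrite mulr1 s0 !mulr0 sin0 mulr0 subrr.
Qed.

Lemma cont_sum (T : topologicalType) (I : Type) (r : seq I) (F : I -> T -> R) :
  (forall i, continuous (F i)) -> continuous (fun p => \sum_(i <- r) F i p).
Proof.
move=> cF; elim: r => [|i r IH].
  rewrite (_ : (fun p => _) = fun=> 0); first exact: cst_continuous.
  by apply/funext => p; rewrite big_nil.
rewrite (_ : (fun p => _) = fun p => F i p + \sum_(j <- r) F j p).
  exact: contD.
by apply/funext => p; rewrite big_cons.
Qed.

Lemma int01_sum (I : Type) (r : seq I) (F : I -> R -> R) :
  (forall i, continuous (F i)) ->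
  int01 (fun t => \sum_(i <- r) F i t) = \sum_(i <- r) int01 (F i).
Proof.
move=> cF; elim: r => [|i r IH].
  rewrite big_nil -[RHS](int01_cst 0); congr (int01 _); apply/funext => t.
  by rewrite big_nil.
rewrite big_cons -IH -int01D//; last exact: cont_sum.
by congr (int01 _); apply/funext => t; rewrite big_cons.
Qed.

(* The Fejer kernel, [N^-1 |\sum_(j < N) e (j t)|^2] expanded. *)
Definition fejer N t : R :=
  N%:R^-1 * \sum_(j < N) \sum_(k < N) cos (freq (j%:Z - k%:Z) * t).

Lemma continuous_fejer N : continuous (fejer N).
Proof.
apply: contZ; apply: cont_sum => j; apply: cont_sum => k.
exact: continuous_cosM.
Qed.

Lemma fejer_ge0 N t : 0 <= fejer N t.
Proof.
rewrite mulr_ge0// [X in 0 <= X](_ : _ =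
    (\sum_(j < N) cos (freq j%:Z * t)) ^+ 2 + (\sum_(j < N) sin (freq j%:Z * t)) ^+ 2).
  by rewrite addr_ge0 ?sqr_ge0.
rewrite !expr2 !mulr_suml -big_split/=; apply: eq_bigr => j _.
rewrite !mulr_sumr -big_split/=; apply: eq_bigr => k _.
by rewrite freqB mulrBl cosB.
Qed.

Lemma int01_fejer N : (0 < N)%N -> int01 (fejer N) = 1.
Proof.
move=> N0; rewrite int01Z; last first.
  by apply: cont_sum => j; apply: cont_sum => k; exact: continuous_cosM.
rewrite int01_sum; last by move=> j; apply: cont_sum => k; exact: continuous_cosM.
rewrite (eq_bigr (fun=> 1)) => [|j _].
  by rewrite sumr_const card_ord mulVf// pnatr_eq0 -lt0n.
rewrite int01_sum; last by move=> k; exact: continuous_cosM.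
rewrite (eq_bigr (fun k : 'I_N => (k == j)%:R)) => [|k _].
  by rewrite (bigD1 j)//= eqxx big1 ?addr0// => k /negbTE ->.
by rewrite int01_cos subr_eq0 eqz_nat eq_sym.
Qed.

(** The number of pairs of consecutive indices below N, which is N times the first cosine
    coefficient of the Fejer kernel. *)
Lemma sum_succ N : \sum_(j < N) \sum_(k < N) ((j.+1 == k :> nat)%:R : R) = N.-1%:R.
Proof.
rewrite (eq_bigr (fun j : 'I_N => (j.+1 < N)%:R)) => [|j _]; last first.
  have [jN|Nj] := ltnP j.+1 N.
    rewrite (bigD1 (Ordinal jN))//= eqxx big1 ?addr0// => k.
    by rewrite -val_eqE/= eq_sym => /negbTE ->.
  by rewrite big1// => k _; rewrite gtn_eqF// (leq_trans (ltn_ord k)).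
case: N => [|N]; first by rewrite big_ord0.
rewrite big_ord_recr/= ltnn addr0 (eq_bigr (fun=> 1)).
  by rewrite sumr_const card_ord.
by move=> j _; rewrite ltnS ltn_ord.
Qed.

(** The first cosine coefficient of the kernel is 1 - 1/N. Since 1 - cos vanishes only at the
    integers, the integral measures how much mass the kernel leaves away from them. *)
Lemma int01_fejer_cos N : (0 < N)%N ->
  int01 (fun t => fejer N t * (1 - cos (freq 1 * t))) = N%:R^-1.
Proof.
move=> N0; have cc n := @continuous_cosM (freq n).
have cf := @continuous_fejer N.
have c1 : continuous (fun t => fejer N t * cos (freq 1 * t)) by exact: contM.
rewrite (_ : (fun t => _) = fun t => fejer N t - fejer N t * cos (freq 1 * t)); last first.
  by apply/funext => t; rewrite mulrBr mulr1.
rewrite int01B// int01_fejer//.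
rewrite (_ : (fun t => _) = fun t => N%:R^-1 * \sum_(j < N) \sum_(k < N)
    2^-1 * (cos (freq (j%:Z - k%:Z + 1) * t) + cos (freq (j%:Z - k%:Z - 1) * t))); last first.
  apply/funext => t; rewrite /fejer -mulrA; congr (_ * _).
  rewrite mulr_suml; apply: eq_bigr => j _; rewrite mulr_suml; apply: eq_bigr => k _.
  move: (j%:Z - k%:Z) => d.
  by rewrite freqD freqB mulrDl mulrBl cosD cosB; field.
have c2 (n : int) : continuous (fun t => 2^-1 * (cos (freq (n + 1) * t) + cos (freq (n - 1) * t))).
  by apply: contZ; apply: contD; exact: cc.
rewrite int01Z; last by apply: cont_sum => j; apply: cont_sum => k; exact: c2.
rewrite int01_sum; last by move=> j; apply: cont_sum => k; exact: c2.
rewrite (eq_bigr (fun j : 'I_N => 2^-1 * (\sum_(k < N) ((j.+1 == k :> nat)%:R : R)) +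
   2^-1 * \sum_(k < N) ((k.+1 == j :> nat)%:R : R))) => [|j _]; last first.
  rewrite int01_sum; last by move=> k; exact: c2.
  rewrite !mulr_sumr -big_split/=; apply: eq_bigr => k _.
  rewrite int01Z; last by apply: contD; exact: cc.
  rewrite int01D; [|exact: cc..].
  rewrite mulrDr !int01_cos.
  have -> : (j%:Z - k%:Z + 1 == 0) = (j.+1 == k :> nat) by apply/eqP/eqP; lia.
  by have -> : (j%:Z - k%:Z - 1 == 0) = (k.+1 == j :> nat) by apply/eqP/eqP; lia.
rewrite big_split/= -!mulr_sumr sum_succ exchange_big sum_succ.
have -> : N%:R = N.-1%:R + 1 :> R by rewrite natr1 prednK.
have : N.-1%:R + 1 != 0 :> R by rewrite natr1 pnatr_eq0.
by move=> h; field.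
Qed.

(** A weak form of Jordan's inequality. As long as cos t is at least 1/4 the mean value theorem
    gives it; beyond that sin^2 t exceeds 15/16, while t / 4 stays below 1/2. *)
Lemma sin_ge_quarter t : 0 <= t <= pi / 2 -> t / 4 <= sin t.
Proof.
move=> /andP[t0 t1]; have p0 := @pi_gt0 R; have p2 := @pihalf_lt2 R.
have [c c0t sE] : exists2 c, c \in `[0, t]%R & sin t - sin 0 = cos c * (t - 0).
  apply: MVT_segment => //; apply: continuous_subspaceT; exact: continuous_sin.
rewrite sin0 !subr0 in sE.
have cc : cos t <= cos c.
  move: c0t; rewrite in_itv/= => /andP[c0 ct].
  rewrite leNgt ltr_cos ?in_itv/= -?leNgt//; lra.
have [h|h] := leP (4^-1) (cos t).
  rewrite sE mulrC ler_wpM2r//; exact: le_trans h cc.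
have s0 : 0 <= sin t by apply: sin_ge0_pi; lra.
have ct0 : 0 <= cos t by apply: cos_ge0_pihalf; lra.
have := cos2Dsin2 t; nra.
Qed.

(** For the distance s of [t] to the nearer endpoint, m (s - 1/m)^2 >= 0 gives s <= 1/m + m s^2, and
    s^2 <= 4 sin^2 (pi s) = 2 (1 - cos (2 pi s)). The right-hand side can be integrated exactly
    against the Fejer kernel. *)
Lemma dist_le_cos t m : 0 <= t <= 1 -> (0 < m)%N ->
  exists2 s, s = t \/ s = 1 - t &
    s <= m%:R^-1 + 2 * m%:R * (1 - cos (freq 1 * t)).
Proof.
move=> /andP[t0 t1] m0.
have H s : 0 <= s <= 2^-1 -> s <= m%:R^-1 + 2 * m%:R * (1 - cos (freq 1 * s)).
  move=> /andP[s0 s1]; have p0 := @pi_gt0 R.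
  have p2 := @pi_ge2 R.
  have q : pi * s / 4 <= sin (pi * s) by apply: sin_ge_quarter; nra.
  have q2 : s / 2 <= sin (pi * s) by nra.
  have -> : freq 1 * s = (pi * s) *+ 2 by rewrite /freq mul1r mulrnAl.
  rewrite cos_mulr2n.
  have -> : 1 - (cos (pi * s) ^+ 2 *+ 2 - 1) = 2 * sin (pi * s) ^+ 2.
    by rewrite sin2cos2; ring.
  have M0 : 0 < m%:R :> R by rewrite ltr0n.
  have mm : m%:R * m%:R^-1 = 1 :> R by rewrite divff// gt_eqF.
  have i0 : 0 < m%:R^-1 :> R by rewrite invr_gt0.
  have q3 : s ^+ 2 <= 4 * sin (pi * s) ^+ 2 by nra.
  apply: (@le_trans _ _ (m%:R^-1 + m%:R * s ^+ 2)); last by nra.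
  set M := m%:R in M0 mm i0 *; set I := M^-1 in mm i0 *.
  have : 0 <= M * (s - I) ^+ 2 by rewrite mulr_ge0 ?sqr_ge0// ltW.
  have -> : M * (s - I) ^+ 2 = M * s ^+ 2 - 2 * (M * I) * s + (M * I) * I by ring.
  rewrite mm; lra.
have [h|h] := leP t (2^-1).
  by exists t; [left|apply: H; rewrite t0 h].
exists (1 - t); first by right.
have -> : cos (freq 1 * t) = cos (freq 1 * (1 - t)).
  rewrite mulrBr mulr1 cosB; have [-> ->] := cos_sin_freq 1.
  by rewrite mul1r mul0r addr0.
by apply: H; lra.
Qed.

(** Along the closed orbit [F] is Lipschitz with constant [L], and both ends of [0, 1] give the
    value F x, so the error at [t] is at most L times the distance to the nearer end. The order m *
    m balances the two terms of [dist_le_cos]: L (1/m + 2 m / m^2) = 3 L / m. *)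
Lemma avg_fejer_le (v x : heis R) (F : heis R -> R) (L : R) m : (0 < m)%N ->
  Cinfty F -> F (hmul x (hexp v 1)) = F x -> (forall y, `|lie v F y| <= L) ->
  `|F x - avg v (fejer (m * m)) F x| <= 3 * L / m%:R.
Proof.
move=> m0 CF pF LF; have dF := Cinfty_differentiable CF.
have N0 : (0 < m * m)%N by rewrite muln_gt0 m0.
have cf := @continuous_fejer (m * m).
have cg : continuous (fun t => F (flow v x t)).
  exact: cont_comp (continuous_flow (v := v) (x := x)) (Cinfty_continuous CF).
have L0 : 0 <= L by exact: le_trans (normr_ge0 _) (LF x).
pose G t := F (flow v x t).
have G0 : G 0 = F x by rewrite /G /flow hexp0 hmulg0.
have G1 : G 1 = F x by rewrite /G.
have lipG s t : s <= t -> `|G t - G s| <= L * (t - s).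
  move=> st; have cG : {within `[s, t], continuous G} by exact: continuous_subspaceT.
  have dG y : y \in `]s, t[%R -> is_derive y (1 : R) G (lie v F (flow v x y)).
    by move=> _; exact: is_derive_flow.
  have [c _ ->] := MVT_segment st dG cG.
  by rewrite normrM [X in _ * X]ger0_norm ?subr_ge0// ler_wpM2r// subr_ge0.
have -> : F x - avg v (fejer (m * m)) F x =
    int01 (fun t => fejer (m * m) t * (F x - G t)).
  rewrite -{1}[F x]mul1r -(int01_fejer N0) mulrC -int01Z// /avg -int01B.
  - by congr (int01 _); apply/funext => t; rewrite mulrBr mulrC.
  - exact: contZ.
  - exact: contM.
have cr : continuous (fun t => fejer (m * m) t *
    (L * (m%:R^-1 + 2 * m%:R * (1 - cos (freq 1 * t))))).
  apply: contM => //; apply: contZ; apply: contD; first exact: cst_continuous.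
  apply: contZ; apply: contB; first exact: cst_continuous.
  exact: continuous_cosM.
have cl : continuous (fun t => fejer (m * m) t * (F x - G t)).
  by apply: contM => //; apply: contB => //; exact: cst_continuous.
have bound t : 0 <= t <= 1 -> `|F x - G t| <=
    L * (m%:R^-1 + 2 * m%:R * (1 - cos (freq 1 * t))).
  move=> t01; have [s sE sle] := dist_le_cos t01 m0.
  apply: le_trans (ler_wpM2l L0 sle); case/andP: t01 => t0 t1.
  case: sE => ->; first by rewrite -G0 distrC -{2}[t]subr0; exact: lipG.
  by rewrite -G1; exact: lipG.
apply: (@le_trans _ _ (int01 (fun t => fejer (m * m) t *
    (L * (m%:R^-1 + 2 * m%:R * (1 - cos (freq 1 * t))))))).
  rewrite ler_norml -int01N//; apply/andP; split; apply: le_int01 => //.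
  - by move=> t; apply: cvgN; exact: cr.
  - move=> t t01; rewrite -mulrN ler_wpM2l ?fejer_ge0//.
    by have := bound t t01; rewrite ler_norml => /andP[].
  - move=> t t01; rewrite ler_wpM2l ?fejer_ge0//.
    by have := bound t t01; rewrite ler_norml => /andP[].
rewrite (_ : (fun t => _) = fun t => L * (m%:R^-1 * fejer (m * m) t) +
    L * (2 * m%:R * (fejer (m * m) t * (1 - cos (freq 1 * t))))); last first.
  by apply/funext => t; ring.
have c3 : continuous (fun t => fejer (m * m) t * (1 - cos (freq 1 * t))).
  apply: contM => //; apply: contB; first exact: cst_continuous.
  exact: continuous_cosM.
have c4 : continuous (fun t => m%:R^-1 * fejer (m * m) t) by exact: contZ.
have c5 : continuous (fun t => 2 * m%:R * (fejer (m * m) t * (1 - cos (freq 1 * t)))).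
  exact: contZ.
rewrite int01D; [|exact: contZ..].
rewrite (int01Z _ c4) (int01Z _ cf) (int01Z _ c5) (int01Z _ c3).
rewrite int01_fejer// int01_fejer_cos//.
have M0 : m%:R != 0 :> R by rewrite pnatr_eq0 -lt0n.
by rewrite natrM le_eqVlt; apply/orP; left; apply/eqP; field.
Qed.

End Fejer.

(** * Distributions and the operators acting on them *)

Section Distributions.
Variables (R : realType) (Gamma : set (heis R)).
Implicit Types (D : testfn Gamma -> R[i]^o) (T : testfn Gamma -> testfn Gamma).
Implicit Types (f g : testfn Gamma) (x y u v : heis R) (w : seq (heis R)).
Implicit Types (k : R -> R) (n : int) (z : R[i]).

Definition bounded_by f (M : R) := forall x, normc (f x) <= M.

(** Invariance moves every point into the compact set [K]. The bound makes the [sup] in [seminorm] a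
    genuine supremum. *)
Lemma testfn_bounded f : is_lattice Gamma -> exists2 M, 0 <= M & bounded_by f M.
Proof.
move=> [_ _ [K cK covK]].
have B (F : heis R -> R) : continuous F -> exists2 M : R, 0 <= M & forall x : heis R, K x -> `|F x| <= M.
  move=> cF; have cFK : compact (F @` K).
    by apply: continuous_compact => //; exact: continuous_subspaceT.
  have [M [_ HM]] := compact_bounded cFK.
  exists (Num.max M 0 + 1); first by rewrite addr_ge0// le_max lexx orbT.
  by move=> x Kx; apply: HM; [rewrite ltr_pwDr// le_max lexx|exists x].
have [M1 M10 B1] := B _ (@cont_re _ _ f); have [M2 M20 B2] := B _ (@cont_im _ _ f).
exists (M1 + M2); first exact: addr_ge0.
move=> x; have [g [y [Gg Ky ->]]] := covK x.
rewrite testfn_inv//; apply: (le_trans (normc_le _)).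
by apply: lerD; [exact: B1|exact: B2].
Qed.

Definition wder w f : testfn Gamma := foldr (@vf R Gamma) f w.

Lemma vfieldE : @vfield R Gamma = @vf R Gamma.
Proof. by rewrite unlock. Qed.

Lemma seminormE w f : seminorm w f = sup [set normc (wder w f x) | x in setT].
Proof. by rewrite /seminorm vfieldE. Qed.

Lemma seminorm_le w f M : bounded_by (wder w f) M -> seminorm w f <= M.
Proof.
move=> wM; rewrite seminormE; apply: ge_sup.
  by exists (normc (wder w f 0)), 0.
by move=> _ [x _ <-].
Qed.

Lemma le_seminorm w f : is_lattice Gamma -> bounded_by (wder w f) (seminorm w f).
Proof.
move=> lat x; rewrite seminormE; apply: ub_le_sup; last by exists x.
have [M _ HM] := testfn_bounded (wder w f) lat.
by exists M => _ [y _ <-].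
Qed.

Lemma seminorm_ge0 w f : is_lattice Gamma -> 0 <= seminorm w f.
Proof. by move=> lat; apply: le_trans (le_seminorm w f lat 0); exact: normc_ge0'. Qed.

Lemma wder_linear w : linear (wder w).
Proof.
by move=> a f g; elim: w => [//|v w IH] /=; rewrite IH linearP.
Qed.

Lemma wder_rcons w v f : wder (rcons w v) f = wder w (vf v f).
Proof. by rewrite /wder foldr_rcons. Qed.

(* Operators through which derivatives, bounds, and hence distributions
   factor. *)
Definition good T := [/\ linear T, forall v f, vf v (T f) = T (vf v f) &
  exists2 B : R, 0 <= B & forall f M, bounded_by f M -> bounded_by (T f) (B * M)].

Lemma wder_comm T w f : (forall v g, vf v (T g) = T (vf v g)) ->
  wder w (T f) = T (wder w f).
Proof. by move=> cT; elim: w => [//|v w IH] /=; rewrite IH cT. Qed.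

Lemma dist_linear D : distributions D -> linear D. Proof. by case. Qed.

Lemma linear_pack D : linear D -> exists l : {linear testfn Gamma -> R[i]^o}, D = l.
Proof.
move=> lD; pose m := GRing.isLinear.Build _ _ _ _ _ lD.
by pose l : {linear testfn Gamma -> R[i]^o} := HB.pack D m; exists l.
Qed.

Lemma distP D : is_lattice Gamma -> distributions D <-> linear D /\
  exists (C : R) (W : seq (seq (heis R))), 0 <= C /\ forall f,
     normc (D f) <= C * \sum_(w <- W) seminorm w f.
Proof.
move=> lat; split=> [[lD [C [W H]]]|[lD [C [W [_ H]]]]]; last by split=> //; exists C, W.
split=> //; exists `|C|, W; split=> // f; apply: (le_trans (H f)).
apply: ler_wpM2r; last exact: ler_norm.
by apply: sumr_ge0 => w _; exact: seminorm_ge0.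
Qed.

Lemma dist_good D T : is_lattice Gamma -> distributions D -> good T ->
  distributions (D \o T).
Proof.
move=> lat /(distP _ lat)[lD [C [W [C0 H]]]] [lT cT [B B0 bT]].
apply/(distP _ lat); split=> [a f g|]; first by rewrite /= lT lD.
exists (C * B), W; split; first exact: mulr_ge0.
move=> f; apply: (le_trans (H _)); rewrite -mulrA ler_wpM2l//.
rewrite mulr_sumr; apply: ler_sum => w _.
apply: seminorm_le; rewrite wder_comm//; apply: bT.
exact: le_seminorm.
Qed.

Lemma dist_vf D v : distributions D -> distributions (dvfield v D).
Proof.
move=> [lD [C [W H]]]; split=> [a f g|].
  by rewrite /dvfield vfieldE linearP lD opprD scalerN.
exists C, [seq rcons w v | w <- W] => f; rewrite /dvfield vfieldE.
rewrite normcN.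
apply: (le_trans (H _)); rewrite big_map le_eqVlt; apply/orP; left; apply/eqP.
congr (_ * _); apply: eq_bigr => w _.
by rewrite !seminormE wder_rcons.
Qed.

Lemma goodD T1 T2 : good T1 -> good T2 -> good (fun f => T1 f + T2 f).
Proof.
move=> [l1 c1 [B1 B10 b1]] [l2 c2 [B2 B20 b2]]; split.
- by move=> a f g; rewrite l1 l2 scalerDr addrACA.
- by move=> v f; rewrite linearD /= c1 c2.
- exists (B1 + B2); first exact: addr_ge0.
  move=> f M fM x; rewrite testfnD mulrDl; apply: (le_trans (le_normcD _ _)).
  by apply: lerD; [exact: b1|exact: b2].
Qed.

Lemma goodZ z T : good T -> good (fun f => z *: T f).
Proof.
move=> [l c [B B0 b]]; split.
- by move=> a f g; rewrite l scalerDr !scalerA mulrC.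
- by move=> v f; rewrite linearZ /= c.
- exists (normc z * B); first by rewrite mulr_ge0// normc_ge0'.
  move=> f M fM x; rewrite testfnZ ComplexField.Normc.normcM -mulrA.
  by apply: ler_wpM2l; [exact: normc_ge0'|exact: b].
Qed.

Lemma good_comp T1 T2 : good T1 -> good T2 -> good (T1 \o T2).
Proof.
move=> [l1 c1 [B1 B10 b1]] [l2 c2 [B2 B20 b2]]; split.
- by move=> a f g; rewrite /= l2 l1.
- by move=> v f; rewrite /= c1 c2.
- exists (B1 * B2); first exact: mulr_ge0.
  by move=> f M fM; rewrite -mulrA; apply: b1; exact: b2.
Qed.

Lemma avgt_bounded v k (ck : continuous k) : exists2 B : R, 0 <= B &
  forall f M, bounded_by f M -> bounded_by (avgt v ck f) (B * M).
Proof.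
have [B B0 kB] := kernel_bounded ck; exists (B + B); first exact: addr_ge0.
move=> f M fM x; apply: (le_trans (normc_le _)); rewrite mulrDl; apply: lerD.
  apply: (avg_le _ _ ck (@cont_re _ _ f)) => // y.
  exact: le_trans (Re_le_normc _) (fM y).
apply: (avg_le _ _ ck (@cont_im _ _ f)) => // y.
exact: le_trans (Im_le_normc _) (fM y).
Qed.

Lemma good_central v k (ck : continuous k) : v.1 = 0 -> good (avgt v ck).
Proof.
move=> v0; split; [exact: avgt_linear| |exact: avgt_bounded].
move=> u f; rewrite vf_avgt_comm//; left.
by rewrite /omega v0 /= !mulr0 subrr.
Qed.

Lemma good_avgt v k (ck : continuous k) T : good T -> (forall f, vf (e3 R) (T f) = 0) ->
  good (avgt v ck \o T).
Proof.
move=> [lT cT [B B0 bT]] T3; split.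
- by move=> a f g; rewrite /= lT linearP.
- by move=> u f; rewrite /= vf_avgt_comm; [rewrite cT|right; exact: T3].
- have [B1 B10 b1] := avgt_bounded v ck; exists (B1 * B); first exact: mulr_ge0.
  by move=> f M fM; rewrite -mulrA; apply: b1; exact: bT.
Qed.

(** The average of f (x exp (t v)) against exp (- 2 pi i n t), split into cosine and sine because
    averages take real kernels. *)
Definition fourier v n f : testfn Gamma :=
  avgt v (@continuous_cosM R (freq R n)) f +
  (- 'i%C) *: avgt v (@continuous_sinM R (freq R n)) f.

Lemma fourier_linear v n : linear (fourier v n).
Proof.
move=> a f g; rewrite /fourier !linearP /= !scalerDr !scalerA.
by rewrite addrACA [a * _]mulrC.
Qed.

HB.instance Definition _ v n :=
  GRing.isLinear.Build _ _ _ _ (fourier v n) (fourier_linear v n).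

Lemma good_fourier_central v n : v.1 = 0 -> good (fourier v n).
Proof. by move=> v0; apply: goodD; [|apply: goodZ]; exact: good_central. Qed.

Lemma good_fourier v n T : good T -> (forall f, vf (e3 R) (T f) = 0) ->
  good (fourier v n \o T).
Proof.
move=> gT T3.
exact: goodD (good_avgt v _ gT T3) (goodZ _ (good_avgt v _ gT T3)).
Qed.

Lemma avgtZk v k1 k2 a (ck1 : continuous k1) (ck2 : continuous k2) f :
  (forall t, k1 t = a * k2 t) -> avgt v ck1 f = a%:C *: avgt v ck2 f.
Proof.
move=> kE; have kE' : k1 = fun t => a * k2 t by apply/funext.
have E F x : continuous F -> avg v k1 F x = a * avg v k2 F x.
  by move=> cF; rewrite kE' avgZk.
apply: testfn_ext2; apply/funext => x.
  by rewrite (reZ _ (avgt v ck2 f)) /= mul0r subr0; apply: E; exact: cont_re.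
by rewrite (imZ _ (avgt v ck2 f)) /= mul0r addr0; apply: E; exact: cont_im.
Qed.

(** Integration by parts: the boundary terms cancel because [f] has period 1 along [v] and
    [freq R n] is a multiple of 2 pi. *)
Lemma vf_fourier v n f : (forall x, f (hmul x (hexp v 1)) = f x) ->
  vf v (fourier v n f) = ('i%C * (freq R n)%:C) *: fourier v n f.
Proof.
move=> pf; rewrite /fourier linearD linearZ/=.
have [c1 s1] := cos_sin_freq R n.
have cs : continuous (fun t => - freq R n * sin (freq R n * t)).
  by apply: contZ; exact: continuous_sinM.
have cc : continuous (fun t => freq R n * cos (freq R n * t)).
  by apply: contZ; exact: continuous_cosM.
rewrite (vf_avgt_parts _ cs (is_derive_cosM _) pf).
rewrite (vf_avgt_parts _ cc (is_derive_sinM _) pf).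
rewrite !mulr1 !mulr0 c1 s1 cos0 sin0 !subrr !scale0r !sub0r.
rewrite (avgtZk v cs (@continuous_sinM R (freq R n)) f (fun t => erefl)).
rewrite (avgtZk v cc (@continuous_cosM R (freq R n)) f (fun t => erefl)).
rewrite rmorphN scaleNr opprK scalerN scalerDr !scalerA addrC.
rewrite !mulNr mulrN scaleNr opprK; congr (_ + _ *: _).
by rewrite mulrAC -expr2 sqr_i mulN1r opprK.
Qed.

(** The Fejer kernel is a trigonometric polynomial, and the average against a cosine is half the sum
    of the modes n and -n. *)
Lemma avgt_fejer0 D T v : linear D -> (forall n f, D (fourier v n (T f)) = 0) ->
  forall N f, D (avgt v (@continuous_fejer R N) (T f)) = 0.
Proof.
move=> lD D0 N f; have [l lE] := linear_pack lD.
have cosE n : avgt v (@continuous_cosM R (freq R n)) (T f) =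
    (2^-1 : R)%:C *: (fourier v n (T f) + fourier v (- n) (T f)).
  have fN : freq R (- n) = - freq R n by rewrite /freq rmorphN mulNr.
  have ncE : avgt v (@continuous_cosM R (freq R (- n))) (T f) =
      (1 : R)%:C *: avgt v (@continuous_cosM R (freq R n)) (T f).
    by apply: avgtZk => t; rewrite fN mulNr cosN mul1r.
  have nsE : avgt v (@continuous_sinM R (freq R (- n))) (T f) =
      (- 1 : R)%:C *: avgt v (@continuous_sinM R (freq R n)) (T f).
    by apply: avgtZk => t; rewrite fN mulNr sinN mulN1r.
  rewrite /fourier ncE nsE scale1r rmorphN rmorph1 scaleN1r scalerN.
  rewrite addrACA subrr addr0 scalerDr -scalerDl -rmorphD.
  by rewrite -[2^-1]div1r -splitr rmorph1 scale1r.
have cos0' n : D (avgt v (@continuous_cosM R (freq R n)) (T f)) = 0.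
  by rewrite cosE lE linearZ/= linearD/= -lE !D0 addr0 scaler0.
have avgE (F : heis R -> R) x : continuous F -> avg v (@fejer R N) F x = N%:R^-1 *
    \sum_(j < N) \sum_(k < N) avg v (fun t => cos (freq R (j%:Z - k%:Z) * t)) F x.
  move=> cF.
  have ci n := continuous_avg_integrand (v := v) (x := x) (@continuous_cosM R (freq R n)) cF.
  rewrite {1}/avg.
  under eq_bigr => j _ do rewrite /avg -int01_sum//.
  rewrite -int01_sum; last by move=> j; apply: cont_sum => i; exact: ci.
  rewrite -int01Z; last by apply: cont_sum => j; apply: cont_sum => i; exact: ci.
  congr (int01 _); apply/funext => t; rewrite /fejer -mulrA; congr (_ * _).
  by rewrite mulr_suml; apply: eq_bigr => j _; rewrite mulr_suml.
have -> : avgt v (@continuous_fejer R N) (T f) = (N%:R^-1 : R)%:C *: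
    \sum_(j < N) \sum_(k < N) avgt v (@continuous_cosM R (freq R (j%:Z - k%:Z))) (T f).
  have reS (I : Type) (r : seq I) (F : I -> testfn Gamma) x :
      re (\sum_(i <- r) F i) x = \sum_(i <- r) re (F i) x.
    by elim/big_ind2: _ => // [f1 a f2 b <- <-]; exact: reD.
  have imS (I : Type) (r : seq I) (F : I -> testfn Gamma) x :
      im (\sum_(i <- r) F i) x = \sum_(i <- r) im (F i) x.
    by elim/big_ind2: _ => // [f1 a f2 b <- <-]; exact: imD.
  set S := \sum_(j < N) _.
  apply: testfn_ext2; apply/funext => x.
    rewrite (reZ _ S) /= mul0r subr0 re_avgt avgE; last exact: cont_re.
    by rewrite /S reS; congr (_ * _); apply: eq_bigr => j _; rewrite reS.
  rewrite (imZ _ S) /= mul0r addr0 im_avgt avgE; last exact: cont_im.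
  by rewrite /S imS; congr (_ * _); apply: eq_bigr => j _; rewrite imS.
rewrite lE linearZ/= linear_sum big1 ?scaler0// => j _.
by rewrite linear_sum big1// => i _; rewrite -lE cos0'.
Qed.

Lemma normc_eq0 z : normc z = 0 -> z = 0.
Proof. exact: ComplexField.Normc.eq0_normc. Qed.

(** If all modes vanished, [D] would vanish on every Fejer average of [T f]. These averages converge
    to [T f] in each seminorm, because derivatives pass through both [T] and the averaging, and
    [D (T f) = D f]. The operator [T] restricts to functions that are periodic along [v] and for
    which averaging commutes with the fields. *)
Lemma fourier_complete D T v : is_lattice Gamma -> distributions D -> good T ->
  (forall k (ck : continuous k), good (avgt v ck \o T)) ->
  (forall f x, T f (hmul x (hexp v 1)) = T f x) ->
  (forall f, D (T f) = D f) -> D <> 0 ->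
  exists n, D \o (fourier v n \o T) <> 0.
Proof.
move=> lat dD gT gA pT DT D0; apply: contrapT => /forallNP H; apply: D0.
have H0 n f : D (fourier v n (T f)) = 0.
  by have /contrapT/(congr1 (fun E => E f)) := H n.
have lD := dist_linear dD; have F0 := avgt_fejer0 lD H0.
have [l lE] := linear_pack lD.
apply/funext => f; apply: normc_eq0; apply/eqP.
have /(distP _ lat)[_ [C [W [C0 HC]]]] := dD.
have [_ cT _] := gT.
(* Twice the constant 3 of [avg_fejer_le], for the real and the imaginary part. *)
pose L w := 6 * seminorm (v :: w) (T f).
have key m : (0 < m)%N -> normc (D f) <= C * (\sum_(w <- W) L w) / m%:R.
  move=> m0; pose A : testfn Gamma -> testfn Gamma := avgt v (@continuous_fejer R (m * m)).
  have -> : D f = D (T f - A (T f)) by rewrite lE linearB/= -lE DT F0 subr0.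
  apply: (le_trans (HC _)); rewrite -mulrA ler_wpM2l// mulr_suml.
  apply: ler_sum => w _; apply: seminorm_le => x.
  have [_ cA _] := gA _ (@continuous_fejer R (m * m)).
  have wE : wder w (T f - A (T f)) = T (wder w f) - A (T (wder w f)).
    have := wder_linear w (-1) (A (T f)) (T f); rewrite !scaleN1r ![- _ + _]addrC => ->.
    by rewrite (wder_comm _ _ cT) (wder_comm w f cA).
  rewrite wE; set h := T (wder w f).
  have hE : h = wder w (T f) by rewrite /h -(wder_comm _ _ cT).
  have hb : bounded_by (vf v h) (seminorm (v :: w) (T f)).
    by rewrite hE; exact: (le_seminorm (v :: w)).
  set S := seminorm _ _ in hb *.
  apply: (le_trans (normc_le _)).
  have -> : L w / m%:R = 3 * S / m%:R + 3 * S / m%:R by rewrite /L -/S; ring.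
  have hp : h (hmul x (hexp v 1)) = h x by exact: pT.
  apply: lerD.
  - have -> : complex.Re ((h - A h) x) = re h x - re (A h) x.
      by rewrite testfnD testfnN raddfB.
    apply: avg_fejer_le => //; first exact: Cinfty_re.
      by rewrite /re hp.
    by move=> y; rewrite -re_vf; exact: le_trans (Re_le_normc _) (hb y).
  - have -> : complex.Im ((h - A h) x) = im h x - im (A h) x.
      by rewrite testfnD testfnN raddfB.
    apply: avg_fejer_le => //; first exact: Cinfty_im.
      by rewrite /im hp.
    by move=> y; rewrite -im_vf; exact: le_trans (Im_le_normc _) (hb y).
rewrite eq_le normc_ge0' andbT leNgt; apply/negP => n0.
set Q := C * _ in key.
have Q0 : 0 < Q.
  by have := lt_le_trans n0 (key 1%N isT); rewrite divr1.
have := archi_boundP (ltW (divr_gt0 Q0 n0)); set m := Num.bound _ => mE.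
have m0 : (0 < m)%N.
  by rewrite -(ltr0n R); apply: le_lt_trans mE; rewrite ltW// divr_gt0.
have := key m m0; rewrite leNgt => /negP; apply.
by rewrite ltr_pdivrMr ?ltr0n// mulrC -ltr_pdivrMr.
Qed.

End Distributions.

(** * Functions on the base torus and the invariant mean *)

Section ZeroMode.
Variables (R : realType) (Gamma : set (heis R)).
Implicit Types (D E : testfn Gamma -> R[i]^o) (T : testfn Gamma -> testfn Gamma).
Implicit Types (f g : testfn Gamma) (x y u v w : heis R).
Implicit Types (n : int) (z : R[i]).

Lemma good_id : good (id : testfn Gamma -> testfn Gamma).
Proof. by split=> //; exists 1 => // f M fM x; rewrite mul1r. Qed.

Lemma freq0 : freq R 0 = 0.
Proof. by rewrite /freq mul0r. Qed.

Lemma continuous_idR : continuous (fun t : R => t).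
Proof. by move=> t; exact: cvg_id. Qed.

(** Integration by parts with the kernel t: a function minus its mean along [v] is a derivative
    along [v]. A functional that kills such derivatives therefore cannot tell a function from its
    mean. *)
Lemma sub_fourier0 v f : (forall x, f (hmul x (hexp v 1)) = f x) ->
  f - fourier v 0 f = vf v (avgt v continuous_idR f).
Proof.
move=> pf; have c1 : continuous (fun _ : R => 1 : R) by exact: cst_continuous.
rewrite (vf_avgt_parts _ c1 _ pf) subr0 scale1r; congr (_ - _).
rewrite /fourier (avgt0k _ (@continuous_sinM _ _)) ?scaler0 ?addr0; last first.
  by move=> t; rewrite freq0 mul0r sin0.
rewrite (avgtZk v _ c1 f (a := 1)) ?scale1r// => t.
by rewrite freq0 mul0r cos0 mulr1.
Qed.

Lemma dist_fourier0 D v f : linear D -> (forall g, D (vf v g) = 0) ->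
  (forall x, f (hmul x (hexp v 1)) = f x) -> D (fourier v 0 f) = D f.
Proof.
move=> lD Dv pf; have [l lE] := linear_pack lD.
apply/eqP; rewrite eq_sym -subr_eq0 lE -linearB -lE sub_fourier0//.
exact/eqP/Dv.
Qed.

Lemma vf_e3Z (a : R) f : vf (0, 0, a) f = a%:C *: vf (e3 R) f.
Proof.
rewrite -vfZ; congr (vf _ _).
by rewrite /e3; congr (_, _, _); rewrite /= /GRing.scale/= ?mulr0 ?mulr1.
Qed.

Variables (tau : R) (tau0 : tau != 0).
Let w : heis R := (0, 0, tau).
Hypothesis Gw : Gamma w.

Let zero_mode f : testfn Gamma := fourier w 0 f.

Let wp f x : f (hmul x (hexp w 1)) = f x.
Proof. exact: central_period. Qed.

Lemma good_zero_mode : good zero_mode.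
Proof. exact: good_fourier_central. Qed.

Lemma vf_central f : vf w f = tau%:C *: vf (e3 R) f.
Proof. exact: vf_e3Z. Qed.

Lemma vf_zero_mode f : vf (e3 R) (zero_mode f) = 0.
Proof.
have := vf_fourier 0 (wp f); rewrite freq0 mulr0 scale0r vf_central.
by move/eqP; rewrite scaler_eq0 -(rmorph0 (real_complex R)) (inj_eq (@complexI R)) (negbTE tau0)/= => /eqP.
Qed.

Lemma vf_zero_modeC u f : vf u (zero_mode f) = zero_mode (vf u f).
Proof. by have [_ -> _] := good_zero_mode. Qed.

(** The centre is averaged out first; only then is the mode along a non-central [v] known to commute
    with all the fields, and [hexp v 1] in the lattice to act trivially on the right. *)
Definition torus_mode v n f : testfn Gamma := fourier v n (zero_mode f).

Lemma good_torus_mode v n : good (torus_mode v n).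
Proof. exact: good_fourier good_zero_mode vf_zero_mode. Qed.

Lemma zero_mode_period v f : Gamma (hexp v 1) ->
  forall x, zero_mode f (hmul x (hexp v 1)) = zero_mode f x.
Proof. by move=> Gv; apply: hexp1_period => //; exact: vf_zero_mode. Qed.

Lemma vf_torus_mode v n f : Gamma (hexp v 1) ->
  vf v (torus_mode v n f) = ('i%C * (freq R n)%:C) *: torus_mode v n f.
Proof. by move=> Gv; apply: vf_fourier; exact: zero_mode_period. Qed.

Lemma vf_torus_modeC u v n f : vf u (torus_mode v n f) = torus_mode v n (vf u f).
Proof. by have [_ -> _] := good_torus_mode v n. Qed.

Lemma dist_zero_mode D f : linear D -> (forall g, D (vf (e3 R) g) = 0) ->
  D (zero_mode f) = D f.
Proof.
move=> lD D3; apply: dist_fourier0 => // g; have [l lE] := linear_pack lD.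
by rewrite vf_central lE linearZ/= -lE D3 scaler0.
Qed.

Lemma torus_mode_neq0 D v : is_lattice Gamma -> distributions D ->
  (forall g, D (vf (e3 R) g) = 0) -> Gamma (hexp v 1) -> D <> 0 ->
  exists n, D \o torus_mode v n <> 0.
Proof.
move=> lat dD D3 Gv D0; apply: (fourier_complete lat dD good_zero_mode _ _ _ D0).
- by move=> k ck; exact: good_avgt good_zero_mode vf_zero_mode.
- by move=> f; exact: zero_mode_period.
- by move=> f; apply: dist_zero_mode => //; exact: dist_linear dD.
Qed.

Lemma central_mode_neq0 D : is_lattice Gamma -> distributions D -> D <> 0 ->
  exists n, D \o fourier w n <> 0.
Proof.
move=> lat dD D0; apply: (fourier_complete lat dD good_id _ wp _ D0) => // k ck.
exact: good_central.
Qed.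

(* If [v E = i theta E] then translating [E] by [exp v] multiplies it by
   [exp (- i theta)]; for [exp v] in the lattice this translation is trivial. *)
Lemma cos_eigen E v (theta : R) : linear E -> (forall g, E (vf (e3 R) g) = 0) ->
  (forall g, E (vf v g) = ('i%C * theta%:C) * E g) -> Gamma (hexp v 1) ->
  E <> 0 -> cos theta = 1.
Proof.
move=> lE E3 Ev Gv E0; have [l lE'] := linear_pack lE.
have [f Ef] : exists f, E f <> 0.
  by apply: contrapT => /forallNP H; apply: E0; apply/funext => f; exact: contrapT (H f).
pose f0 := zero_mode f.
have pf0 : forall x, f0 (hmul x (hexp v 1)) = f0 x by exact: zero_mode_period.
have Ef0 : E f0 = E f by exact: dist_zero_mode.
have cs : continuous (fun t => - theta * sin (theta * t)).
  by apply: contZ; exact: continuous_sinM.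
have cc : continuous (fun t => theta * cos (theta * t)).
  by apply: contZ; exact: continuous_cosM.
pose C := avgt v (@continuous_cosM R theta) f0.
pose S := avgt v (@continuous_sinM R theta) f0.
have CE : vf v C = (cos theta - 1)%:C *: f0 + theta%:C *: S.
  rewrite (vf_avgt_parts _ cs (is_derive_cosM _) pf0).
  rewrite (avgtZk v cs (@continuous_sinM R theta) f0 (fun t => erefl)).
  by rewrite mulr1 mulr0 cos0 rmorphN scaleNr opprK.
have SE : vf v S = (sin theta)%:C *: f0 - theta%:C *: C.
  rewrite (vf_avgt_parts _ cc (is_derive_sinM _) pf0).
  rewrite (avgtZk v cc (@continuous_cosM R theta) f0 (fun t => erefl)).
  by rewrite mulr1 mulr0 sin0 subr0.
have E1 : ('i%C * theta%:C) * E C = (cos theta - 1)%:C * E f + theta%:C * E S.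
  by rewrite -Ev CE lE' linearD !linearZ /= -lE' Ef0.
have E2 : ('i%C * theta%:C) * E S = (sin theta)%:C * E f - theta%:C * E C.
  by rewrite -Ev SE lE' linearB !linearZ /= -lE' Ef0.
(* Eliminating [E C] and [E S] from the two identities leaves (exp (- i theta) - 1) E f = 0. *)
have E3' : ((cos theta - 1)%:C - 'i%C * (sin theta)%:C) * E f = 0.
  have -> : ((cos theta - 1)%:C - 'i%C * (sin theta)%:C) * E f =
     ((cos theta - 1)%:C * E f + theta%:C * E S) - 'i%C * ((sin theta)%:C * E f - theta%:C * E C)
     - theta%:C * E S - 'i%C * theta%:C * E C by ring.
  rewrite -E1 -E2.
  have -> : 'i%C * ('i%C * theta%:C * E S) = - (theta%:C * E S).
    by rewrite !mulrA -expr2 sqr_i mulN1r mulNr.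
  ring.
move/eqP: E3'; rewrite mulf_eq0 (introF eqP Ef) orbF => /eqP.
by move/(congr1 (@complex.Re R)) => /=; rewrite mul0r mul1r !subr0 => /eqP; rewrite subr_eq0 => /eqP.
Qed.

Lemma one_subproof : (fun=> 1) \in testpred Gamma.
Proof.
by rewrite inE; split=> //; split; exact: Cinfty_cst.
Qed.

Definition test_one : testfn Gamma := TestFn one_subproof.

Variables v1 v2 : heis R.
Hypotheses (G1 : Gamma (hexp v1 1)) (G2 : Gamma (hexp v2 1)).
Hypothesis span12 : forall u, exists a b c : R, u = a *: v1 + b *: v2 + c *: e3 R.

Definition invariant_mean f : R[i]^o := torus_mode v2 0 (torus_mode v1 0 f) 0.

(** The average is killed by [v1], [v2] and the centre, since mode 0 along a direction is killed by
    that direction and commutes with the others. These three span, so it is constant, and its value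
    at 0 is the mean. *)
Lemma torus_average_cst f :
  torus_mode v2 0 (torus_mode v1 0 f) = invariant_mean f *: test_one.
Proof.
set h := torus_mode v2 0 _.
have h3 : vf (e3 R) h = 0.
  rewrite /h vf_torus_modeC vf_torus_modeC.
  have -> : torus_mode v1 0 (vf (e3 R) f) = 0; last first.
    by rewrite /torus_mode /zero_mode !linear0.
  have z0 : zero_mode (vf (e3 R) f) = 0 by rewrite -vf_zero_modeC vf_zero_mode.
  by rewrite /torus_mode z0 linear0.
have h1 : vf v1 h = 0.
  rewrite /h vf_torus_modeC vf_torus_mode// freq0 mulr0 scale0r.
  by rewrite /torus_mode /zero_mode !linear0.
have h2 : vf v2 h = 0 by rewrite /h vf_torus_mode// freq0 mulr0 scale0r.
apply: testfn_ext => x; rewrite testfnZ [test_one x]/= mulr1.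
apply: vfsC0_const => u; have [a [b [c ->]]] := span12 u.
by rewrite !vfD !vfZ h1 h2 h3 !scaler0 !addr0.
Qed.

(** Uniqueness of the Haar functional: each averaging changes its argument by derivatives, which [E]
    kills, and after both averagings the argument is constant. *)
Lemma invariant_unique E f : linear E -> (forall u g, E (vf u g) = 0) ->
  E f = invariant_mean f * E test_one.
Proof.
move=> lE Ev; have [l lE'] := linear_pack lE.
have EQ v g : Gamma (hexp v 1) -> E (torus_mode v 0 g) = E g.
  move=> Gv; rewrite dist_fourier0//; first exact: dist_zero_mode.
  exact: zero_mode_period.
by rewrite -(EQ v1)// -(EQ v2)// torus_average_cst lE' linearZ.
Qed.

Lemma invariant_mean_vf u f : invariant_mean (vf u f) = 0.
Proof.
rewrite /invariant_mean -!vf_torus_modeC torus_average_cst linearZ/=.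
have -> : vf u test_one = 0; last by rewrite scaler0.
have D0 F v x : (forall y, F y = F 0) -> lie v F x = 0 :> R.
  move=> Fc; have -> : F = fun=> F 0 by apply/funext.
  by rewrite /lie /grad !unlock !derive_cst !mulr0 !addr0.
by apply: testfn_ext2; apply/funext => x; rewrite (re_vf, im_vf) D0.
Qed.

Lemma invariant_mean_dist : is_lattice Gamma -> distributions invariant_mean.
Proof.
move=> lat; have gg := good_comp (good_torus_mode v2 0) (good_torus_mode v1 0).
have [lT _ [B B0 bT]] := gg.
split=> [a f g|].
  by rewrite /invariant_mean -[torus_mode _ _ _]/((torus_mode v2 0 \o torus_mode v1 0) _) lT.
exists B, [:: [::]] => f; rewrite big_seq1.
exact: (bT _ _ (le_seminorm [::] f lat) 0).
Qed.

Lemma avgt_one (k : R -> R) (ck : continuous k) v :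
  avgt v ck test_one = (int01 k)%:C *: test_one.
Proof.
apply: testfn_ext2; apply/funext => x.
  by rewrite (reZ _ test_one) re_avgt /= avg_cst// /re /= mul0r subr0 mulr1.
by rewrite (imZ _ test_one) im_avgt /= avg_cst// /re/im /= !mulr0 mul0r addr0.
Qed.

Lemma fourier_one v n : exists z, fourier v n test_one = z *: test_one.
Proof. by rewrite /fourier !avgt_one scalerA -scalerDl; eexists. Qed.

Lemma invariant_mean1 : invariant_mean test_one = 1.
Proof.
have c0 : int01 (fun t => cos (freq R 0 * t)) = 1 by rewrite int01_cos eqxx.
have s0 : int01 (fun t => sin (freq R 0 * t)) = 0.
  rewrite -[RHS](int01_cst 0); congr (int01 _); apply/funext => t.
  by rewrite freq0 mul0r sin0.
have F v : fourier v 0 test_one = test_one.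
  by rewrite /fourier !avgt_one c0 s0 scale1r scale0r scaler0 addr0.
by rewrite /invariant_mean /torus_mode /zero_mode !F.
Qed.

End ZeroMode.

(** * The frame and the automorphism *)

Section SecondDerivatives.
Variable R : realType.
Implicit Types (x y a b u v h : heis R) (F : heis R -> R).

Lemma derive_shift F x y h : 'D_h (fun p => F (p + y)) x = 'D_h F (x + y).
Proof.
rewrite /derive; congr (lim (_ @ 0^')); apply/funext => t /=.
by rewrite addrA.
Qed.

Lemma derive_scale F x (e : R) h : differentiable F x -> 'D_(e *: h) F x = e * 'D_h F x.
Proof. by move=> dF; rewrite !deriveE// linearZ. Qed.

(** The mixed second difference with steps e a and e b is symmetric in the two directions. Two mean
    value theorems, applied in either order, express it as e^2 times one or the other mixed
    derivative at points near [x]; continuity of both closes the gap. *)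
Lemma Schwarz F x a b : Cinfty F ->
  'D_b (fun y => 'D_a F y) x = 'D_a (fun y => 'D_b F y) x.
Proof.
move=> CF.
have Ca := Cinfty_derive a CF; have Cb := Cinfty_derive b CF.
have Cba := Cinfty_derive b Ca; have Cab := Cinfty_derive a Cb.
have dF := Cinfty_differentiable CF.
have mvt (G : heis R -> R) y h : (forall y, differentiable G y) ->
    exists2 t : R, 0 <= t <= 1 & G (y + h) - G y = 'D_h G (y + t *: h).
  by move=> dG; have [t t01 ->] := heis_MVT y h dG; exists t => //; rewrite derive_heis.
have incr c d (e : R) : 0 < e -> exists s t : R, [/\ 0 <= s <= 1, 0 <= t <= 1 &
    F (x + e *: c + e *: d) - F (x + e *: c) - (F (x + e *: d) - F x) =
    e ^+ 2 * 'D_d (fun y => 'D_c F y) (x + s *: (e *: c) + t *: (e *: d))].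
  move=> e0; pose G y := F (y + e *: d) - F y.
  have dsh : forall y, differentiable (fun p => F (p + e *: d)) y.
    by move=> y; apply: differentiable_comp.
  have dG : forall y, differentiable G y by move=> y; exact: differentiableB.
  have [s s01 sE] := mvt G x (e *: c) dG.
  have [t t01 tE] := mvt (fun y => 'D_c F y) (x + s *: (e *: c)) (e *: d)
    (Cinfty_differentiable (Cinfty_derive c CF)).
  exists s, t; split=> //.
  rewrite [LHS](_ : _ = G (x + e *: c) - G x) // sE.
  have -> : 'D_(e *: c) G (x + s *: (e *: c)) =
      e * ('D_c F (x + s *: (e *: c) + e *: d) - 'D_c F (x + s *: (e *: c))).
    rewrite (derive_scale _ _ (dG _)); congr (_ * _).
    rewrite -(derive_shift F _ (e *: d)).
    by apply: deriveB; exact: diff_derivable.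
  rewrite tE derive_scale; last exact: Cinfty_differentiable (Cinfty_derive c CF) _.
  by rewrite expr2 -!mulrA.
pose G y := 'D_b (fun y => 'D_a F y) y - 'D_a (fun y => 'D_b F y) x.
have meet (e : R) : 0 < e -> exists p q : heis R,
    [/\ `|p| <= e * (`|a| + `|b|), `|q| <= e * (`|a| + `|b|) &
    'D_b (fun y => 'D_a F y) (x + p) = 'D_a (fun y => 'D_b F y) (x + q)].
  move=> e0; have [s1 [t1 [s101 t101 E1]]] := incr a b e e0.
  have [s2 [t2 [s201 t201 E2]]] := incr b a e e0.
  have bnd (s t : R) c d : 0 <= s <= 1 -> 0 <= t <= 1 ->
      `|s *: (e *: c) + t *: (e *: d)| <= e * (`|c| + `|d|).
    move=> /andP[p0 p1] /andP[q0 q1]; apply: (le_trans (ler_normD _ _)).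
    rewrite !normrZ mulrDr (ger0_norm p0) (ger0_norm q0) (gtr0_norm e0).
    by apply: lerD; rewrite ler_piMl// mulr_ge0// ltW.
  exists (s1 *: (e *: a) + t1 *: (e *: b)), (s2 *: (e *: b) + t2 *: (e *: a)).
  split; [exact: bnd| |].
    by rewrite [`|a| + _]addrC; exact: bnd.
  have e20 : e ^+ 2 != 0 by rewrite expf_neq0// gt_eqF.
  apply: (mulfI e20); rewrite !addrA -E1 -E2.
  by rewrite -!addrA [e *: b + e *: a]addrC; congr (_ + _); rewrite !opprB addrCA [RHS]addrCA;
    congr (_ + _); rewrite addrC.
have c1 : continuous (fun y => 'D_b (fun y => 'D_a F y) y) := Cinfty_continuous Cba.
have c2 : continuous (fun y => 'D_a (fun y => 'D_b F y) y) := Cinfty_continuous Cab.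
apply/eqP; rewrite -subr_eq0 -normr_eq0; apply/eqP/le_anti/andP; split; last exact: normr_ge0.
apply/ler_addgt0Pl => e e0; rewrite addr0.
have half (A B C : R) : `|A - C| < e / 2 -> `|B - C| < e / 2 -> `|A - B| <= e.
  rewrite !ltr_norml => /andP[? ?] /andP[? ?]; rewrite ler_norml; apply/andP; split; lra.
have e2 : 0 < e / 2 by rewrite divr_gt0.
have near_of G' : continuous (G' : heis R -> R) -> exists2 d : R, 0 < d &
    forall p : heis R, `|p| < d -> `|G' x - G' (x + p)| < e / 2.
  move=> cG; have /cvgrPdist_lt/(_ _ e2)/nbhs_ballP[d /= d0 Hd] := cG x.
  exists d => // p pd; apply: Hd.
  by rewrite -ball_normE /ball_/= opprD addrA subrr sub0r normrN.
have [d1 d10 H1] := near_of _ c1; have [d2 d20 H2] := near_of _ c2.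
pose d := Num.min d1 d2; have d0 : 0 < d by rewrite lt_min d10.
(* The summand 1 keeps [M] positive when both directions vanish. *)
pose M := `|a| + `|b| + 1; have M0 : 0 < M by rewrite ltr_wpDl// addr_ge0.
have small : d / (2 * M) * (`|a| + `|b|) < d.
  rewrite /M; have := normr_ge0 a; have := normr_ge0 b.
  move: (`|a|) (`|b|) d d0 => A B d' d'0 B0 A0.
  have M'0 : 0 < 2 * (A + B + 1) by lra.
  by rewrite mulrAC ltr_pdivrMr// ltr_pM2l//; lra.
have [p [q [pe qe pq]]] := meet (d / (2 * M)) ltac:(by rewrite divr_gt0// mulr_gt0).
have pd1 : `|p| < d1.
  by apply: (le_lt_trans pe); apply: (lt_le_trans small); rewrite ge_min lexx.
have qd2 : `|q| < d2.
  by apply: (le_lt_trans qe); apply: (lt_le_trans small); rewrite ge_min lexx orbT.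
have L1 := H1 p pd1; have L2 := H2 q qd2; rewrite -pq in L2.
exact: half L1 L2.
Qed.

Lemma derive_lie F v x h : Cinfty F -> 'D_h (lie v F) x =
  v.1.1 * 'D_h (D1 F) x + v.1.2 * 'D_h (D2 F) x +
  (v.2 + x.1.1 * v.1.2) * 'D_h (D3 F) x + h.1.1 * v.1.2 * D3 F x.
Proof.
move=> CF.
have drv (G : heis R -> R) : Cinfty G -> derivable G x h.
  by move=> CG; apply: diff_derivable; exact: Cinfty_differentiable CG _.
have d1 := drv _ (Cinfty_D1 CF); have d2 := drv _ (Cinfty_D2 CF).
have d3 := drv _ (Cinfty_D3 CF).
have [l cl lE] := linear_heis (v.1.2 : R) 0 0.
have lE' y : v.2 + y.1.1 * v.1.2 = v.2 + l y.
  by rewrite lE; ring.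
have dl : derivable (l : heis R -> R) x h.
  by apply: diff_derivable; exact: linear_differentiable.
have dZ (c : R) (G : heis R -> R) : derivable G x h ->
    derivable (fun y => c * G y) x h /\ 'D_h (fun y => c * G y) x = c * 'D_h G x.
  by move=> dG; split; [exact: (@derivableZ _ _ _ G c x h dG)|exact: (@deriveZ _ _ _ G c x h dG)].
have [dz1 e1] := dZ v.1.1 _ d1; have [dz2 e2] := dZ v.1.2 _ d2.
have dc : derivable (fun y => v.2 + l y) x h.
  exact: (@derivableD _ _ _ (cst v.2) l x h (derivable_cst _ _ _) dl).
have ec : 'D_h (fun y => v.2 + l y) x = h.1.1 * v.1.2.
  transitivity ('D_h (cst v.2 : heis R -> R) x + 'D_h l x).
    exact: (@deriveD _ _ _ (cst v.2) l x h (derivable_cst _ _ _) dl).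
  by rewrite derive_cst add0r derive_linear// lE; ring.
have dm : derivable (fun y => (v.2 + l y) * D3 F y) x h by exact: derivableM.
have em : 'D_h (fun y => (v.2 + l y) * D3 F y) x =
    (v.2 + l x) * 'D_h (D3 F) x + D3 F x * (h.1.1 * v.1.2).
  by rewrite -ec; exact: (@deriveM _ _ (fun y => v.2 + l y) (D3 F) x h dc d3).
rewrite (_ : lie v F = fun y => (v.1.1 * D1 F y + v.1.2 * D2 F y) + (v.2 + l y) * D3 F y); last first.
  by apply/funext => y; rewrite /lie /grad /= lE'.
transitivity ('D_h (fun y => v.1.1 * D1 F y + v.1.2 * D2 F y) x +
  'D_h (fun y => (v.2 + l y) * D3 F y) x).
  have ds := @derivableD _ _ _ (fun y => v.1.1 * D1 F y) (fun y => v.1.2 * D2 F y) x h dz1 dz2.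
  exact: (@deriveD _ _ _ (fun y => v.1.1 * D1 F y + v.1.2 * D2 F y)
    (fun y => (v.2 + l y) * D3 F y) x h ds dm).
rewrite em lE' -e1 -e2 [_ * (h.1.1 * _)]mulrC addrA; congr (_ + _ + _).
exact: (@deriveD _ _ _ (fun y => v.1.1 * D1 F y) (fun y => v.1.2 * D2 F y) x h dz1 dz2).
Qed.

(** The second-order terms cancel by symmetry. What remains is the derivative of the only
    non-constant coefficient, x1 in front of [D3]. *)
Lemma lie_commutator F u v x : Cinfty F ->
  lie u (lie v F) x - lie v (lie u F) x = omega u v * D3 F x.
Proof.
move=> CF.
have S12 : D1 (D2 F) x = D2 (D1 F) x by rewrite !unlock; exact: Schwarz.
have S13 : D1 (D3 F) x = D3 (D1 F) x by rewrite !unlock; exact: Schwarz.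
have S23 : D2 (D3 F) x = D3 (D2 F) x by rewrite !unlock; exact: Schwarz.
have E (a : heis R) : [/\ D1 (lie a F) x =
    a.1.1 * D1 (D1 F) x + a.1.2 * D1 (D2 F) x + (a.2 + x.1.1 * a.1.2) * D1 (D3 F) x +
      1 * a.1.2 * D3 F x,
   D2 (lie a F) x =
    a.1.1 * D2 (D1 F) x + a.1.2 * D2 (D2 F) x + (a.2 + x.1.1 * a.1.2) * D2 (D3 F) x +
      0 * a.1.2 * D3 F x &
   D3 (lie a F) x =
    a.1.1 * D3 (D1 F) x + a.1.2 * D3 (D2 F) x + (a.2 + x.1.1 * a.1.2) * D3 (D3 F) x +
      0 * a.1.2 * D3 F x].
  split.
  - have DE (G : heis R -> R) : D1 G x = 'D_((1, 0, 0) : heis R) G x by rewrite unlock.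
    by have := derive_lie a x (1, 0, 0) CF; rewrite -!DE.
  - have DE (G : heis R -> R) : D2 G x = 'D_((0, 1, 0) : heis R) G x by rewrite unlock.
    by have := derive_lie a x (0, 1, 0) CF; rewrite -!DE.
  - have DE (G : heis R -> R) : D3 G x = 'D_((0, 0, 1) : heis R) G x by rewrite unlock.
    by have := derive_lie a x (0, 0, 1) CF; rewrite -!DE.
rewrite {1 3}/lie /grad /omega /=.
have [-> -> ->] := E v; have [-> -> ->] := E u.
rewrite S12 S13 S23.
move: (D1 (D1 F) x) (D2 (D1 F) x) (D3 (D1 F) x) (D2 (D2 F) x) (D3 (D2 F) x) (D3 (D3 F) x) (D3 F x).
by move=> ? ? ? ? ? ? ?; ring.
Qed.

End SecondDerivatives.

Section Frame.
Variables (R : realType) (Gamma : set (heis R)).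
Implicit Types (f : testfn Gamma) (u v x y X Y Z : heis R).

Lemma vf_commutator u v f :
  vf u (vf v f) - vf v (vf u f) = (omega u v)%:C *: vf (e3 R) f.
Proof.
have rE w (g : testfn Gamma) : re (vf w g) = lie w (re g) by apply/funext => y; rewrite re_vf.
have iE w (g : testfn Gamma) : im (vf w g) = lie w (im g) by apply/funext => y; rewrite im_vf.
apply: testfn_ext2; apply/funext => x.
  rewrite (reZ _ (vf (e3 R) f)) [complex.Re _]/= [complex.Im _]/= mul0r subr0.
  have -> : re (vf u (vf v f) - vf v (vf u f)) x = re (vf u (vf v f)) x - re (vf v (vf u f)) x.
    by rewrite /re testfnD testfnN raddfB.
  by rewrite !rE lie_commutator ?lie_e3//; exact: Cinfty_re.
rewrite (imZ _ (vf (e3 R) f)) [complex.Re _]/= [complex.Im _]/= mul0r addr0.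
have -> : im (vf u (vf v f) - vf v (vf u f)) x = im (vf u (vf v f)) x - im (vf v (vf u f)) x.
  by rewrite /im testfnD testfnN raddfB.
by rewrite !iE lie_commutator ?lie_e3//; exact: Cinfty_im.
Qed.

Lemma cintegral0 F : cintegral F (fun=> 0) = 0 :> R[i].
Proof.
have r0 : Rintegral (@haar R) F (fun=> 0) = 0 by rewrite /Rintegral integral0.
by rewrite /cintegral /= r0.
Qed.

(* If no test function varied along the centre, then [Z] would vanish on test
   functions, so an [L^2] eigenfunction for the eigenvalue [i] would define the
   zero distribution and be an eigenfunction for every complex number. *)
Lemma exists_central_derivative X Y Z : heisenberg_frame Gamma X Y Z ->
  normalized Gamma Z -> exists f, vf (e3 R) f <> 0.
Proof.
rewrite /heisenberg_frame vfieldE => -[_ XY _ _] [F [_ spec _]].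
apply: contrapT => /forallNP H.
have e0 f : vf (e3 R) f = 0 by exact: contrapT (H f).
have Z0 f : vf Z f = 0 by rewrite -XY vf_commutator e0 scaler0.
have [h [L2h hE] h0] : [set mu | exists2 f, L2_eigenspace Gamma F Z mu f &
    sqnorm F f <> 0%E] ('i%C * 1%:~R) by rewrite spec; exists 1.
have dh0 : dist_of_fun F h = (fun=> 0) :> (testfn Gamma -> R[i]^o).
  apply/funext => f; have := congr1 (fun E => E f) hE.
  rewrite /dvfield vfieldE Z0.
  have -> : dist_of_fun F h (0 : testfn Gamma) = 0.
    rewrite /dist_of_fun -[RHS](cintegral0 F); congr cintegral.
    by apply/funext => x; rewrite testfn0 mulr0.
  move=> /eqP; rewrite oppr0 eq_sym scaler_eq0 mulr1 => /orP[|/eqP//].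
  by move=> /eqP/(congr1 (@complex.Im R)) /= /eqP; rewrite oner_eq0.
have : [set mu | exists2 f, L2_eigenspace Gamma F Z mu f &
    sqnorm F f <> 0%E] (2 : R[i]).
  exists h => //; split=> //; rewrite dh0; apply/funext => f.
  by rewrite /dvfield oppr0; exact: esym (scaler0 _ _).
rewrite spec => -[z _] /(congr1 (@complex.Re R)).
rewrite -(rmorph_int (real_complex R)) -(rmorph_nat (real_complex R)) /=.
by rewrite !mul0r mulr0 subrr => /eqP; rewrite eq_sym pnatr_eq0.
Qed.

(** This is what makes the Lie algebra act faithfully on test functions, so that identities between
    operators become identities between vectors. *)
Hypothesis rich : exists f, vf (e3 R) f <> 0.

Lemma omega_eq0 u v : (forall f, vf u (vf v f) = vf v (vf u f)) -> omega u v = 0.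
Proof.
move=> uv; have [f /eqP f0] := rich; apply/eqP.
have := vf_commutator u v f; rewrite uv subrr => /esym/eqP.
rewrite scaler_eq0 (negbTE f0) orbF => /eqP/(congr1 (@complex.Re R)) /= ->.
exact: eqxx.
Qed.

(** A field acting as zero commutes with all the others, hence is central, and a central field is
    tested on a function that varies along the centre. *)
Lemma vf_inj0 v : (forall f, vf v f = 0) -> v = 0.
Proof.
move=> v0; have o0 u : omega u v = 0.
  by apply: omega_eq0 => f; rewrite !v0 linear0.
have := o0 (1, 0, 0); have := o0 (0, 1, 0).
case: v v0 {o0} => [[a b] c] v0; rewrite /omega /= !mul0r !mul1r subr0 sub0r.
move=> /eqP; rewrite oppr_eq0 => /eqP a0 b0; rewrite {}a0 {}b0 in v0 *.
have [f /eqP f0] := rich; have := v0 f; rewrite vf_e3Z => /eqP.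
rewrite scaler_eq0 (negbTE f0) orbF => /eqP/(congr1 (@complex.Re R)) /= ->.
by [].
Qed.

(** If [Z] were not central, then commuting with it would make [X] and [Y] multiples of [Z] modulo
    the centre, and three vectors in a plane are not free. The value of [c] is then read off from
    [X, Y] = Z. *)
Lemma frame_central X Y Z : heisenberg_frame Gamma X Y Z ->
  exists c : R, [/\ c != 0, Z = (0, 0, c) & omega X Y = c].
Proof.
rewrite /heisenberg_frame vfieldE => -[free XY XZ YZ].
have oXZ : omega X Z = 0 by exact: omega_eq0.
have oYZ : omega Y Z = 0 by exact: omega_eq0.
have Z1 : Z.1 = 0.
  apply/eqP; apply: contrapT => /negP Z0.
  have par v : omega v Z = 0 -> exists p q : R, v = p *: Z + (0, 0, q).
    move: Z0; case: v Z {XY XZ YZ oXZ oYZ free} => [[a b] c] [[d e] g] /= Z0.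
    rewrite /omega /= => /eqP; rewrite subr_eq0 => /eqP ae.
    have [d0|d0] := eqVneq d 0.
      have e0 : e != 0 by apply: contra Z0 => /eqP ->; rewrite d0.
      have a0 : a = 0.
        by apply/eqP; rewrite -(mulIr_eq0 _ (mulIf e0)) ae d0 mulr0.
      exists (b / e), (c - b / e * g); rewrite d0 a0; congr (_, _, _) => /=.
      - by rewrite /GRing.scale/= mulr0 addr0.
      - by rewrite /GRing.scale/= addr0 divfK.
      - by rewrite /GRing.scale/= addrC subrK.
    exists (a / d), (c - a / d * g); congr (_, _, _) => /=.
    - by rewrite /GRing.scale/= addr0 divfK.
    - by rewrite /GRing.scale/= addr0 mulrAC ae mulfK.
    - by rewrite /GRing.scale/= addrC subrK.
  have [p [q Xp]] := par _ oXZ; have [p' [q' Yp]] := par _ oYZ.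
  (* The relation q' X - q Y = (q' p - q p') Z eliminates the central parts. It gives q = 0, so that
     [X] itself would be a multiple of [Z]. *)
  have [q'0 /eqP q0 _] : [/\ q' = 0, - q = 0 & - (q' * p - q * p') = 0].
    apply: free; rewrite Xp Yp !scalerDr !scalerA.
    case: Z {Z0 XY XZ YZ oXZ oYZ par Xp Yp} => [[d e] g].
    by congr (_, _, _); rewrite /= /GRing.scale/=; ring.
  rewrite oppr_eq0 in q0; have [+ _ _] : [/\ 1 = 0 :> R, 0 = 0 :> R & - p = 0].
    apply: free; rewrite Xp (eqP q0) scale1r scale0r addr0 scaleNr.
    rewrite (_ : (0, 0, 0) = 0)// addr0 subrr//.
  by move/eqP; rewrite oner_eq0.
have ZE : Z = (0, 0, Z.2) by case: Z Z1 {XY XZ YZ oXZ oYZ free} => [z1 z2] /= ->.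
have c0 : Z.2 != 0.
  apply/eqP => z0; have [_ _ /eqP] : [/\ 0 = 0 :> R, 0 = 0 :> R & 1 = 0 :> R].
    by apply: free; rewrite !scale0r !add0r scale1r ZE z0.
  by rewrite oner_eq0.
exists Z.2; split=> //.
have [f /eqP f0] := rich; have := XY f; rewrite vf_commutator [in RHS]ZE vf_e3Z.
move/eqP; rewrite -subr_eq0 -scalerBl scaler_eq0 (negbTE f0) orbF -rmorphB.
by move=> /eqP/(congr1 (@complex.Re R)) /= /eqP; rewrite subr_eq0 => /eqP.
Qed.

End Frame.

(** * Commutators in the lattice *)

Section LatticeElements.
Variables (R : realType) (Gamma : set (heis R)).
Implicit Types (g h x y u v : heis R).

Definition hlog g : heis R := (g.1.1, g.1.2, g.2 - g.1.1 * g.1.2 / 2).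

Lemma hlogK g : hexp (hlog g) 1 = g.
Proof.
by case: g => [[a b] c]; rewrite /hexp /hlog /=; congr (_, _, _); ring.
Qed.

Lemma lattice_mul g h : is_lattice Gamma -> Gamma g -> Gamma h -> Gamma (hmul g h).
Proof.
move=> [[G0 Gd] _ _] Gg Gh.
have -> : hmul g h = hmul g (hinv (hmul 0 (hinv h))).
  by rewrite /hmul /hinv /=; congr (_, _, _); ring.
by apply: (Gd _ _ Gg); exact: (Gd _ _ G0 Gh).
Qed.

Lemma lattice_inv g : is_lattice Gamma -> Gamma g -> Gamma (hinv g).
Proof.
move=> [[G0 Gd] _ _] Gg; have -> : hinv g = hmul 0 (hinv g).
  by rewrite /hmul /hinv /=; congr (_, _, _); ring.
exact: Gd.
Qed.

(** The source of central lattice elements, hence of the period of the central Fourier modes. *)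
Lemma lattice_commutator g h : is_lattice Gamma -> Gamma g -> Gamma h ->
  Gamma (0, 0, omega g h).
Proof.
move=> lat Gg Gh.
have -> : (0, 0, omega g h) = hmul (hmul g h) (hinv (hmul h g)).
  by rewrite /hmul /hinv /omega /=; congr (_, _, _); ring.
by have [[_ Gd] _ _] := lat; apply: Gd; exact: lattice_mul.
Qed.

(** In a commutative lattice some [u] outside the centre satisfies [omega u g = 0] for all its
    elements. The additive function [omega u] then descends to the quotient, where cocompactness
    bounds it by its values on [K]; yet it is unbounded. *)
Lemma lattice_noncommuting : is_lattice Gamma ->
  exists g h, [/\ Gamma g, Gamma h & omega g h != 0].
Proof.
move=> lat; have [_ _ [K cK covK]] := lat; apply: contrapT => /forallNP H.
have o0 g h : Gamma g -> Gamma h -> omega g h = 0.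
  move=> Gg Gh; apply/eqP; apply: contrapT => /negP n0; apply: (H g).
  by exists h.
have [u u1 uG] : exists2 u : heis R, u.1 != 0 & forall g, Gamma g -> omega u g = 0.
  have [[g Gg g1]|N] := pselect (exists2 g, Gamma g & g.1 != 0).
    by exists g => // h Gh; exact: o0.
  (* Here the lattice lies in the centre, and any non-central [u] will do. *)
  exists ((1, 0, 0) : heis R).
    by apply/eqP => -[/eqP]; rewrite oner_eq0.
  move=> g Gg; have [g1|g1] := eqVneq g.1 0; last by exfalso; apply: N; exists g.
  by rewrite /omega g1 /= !mulr0 subrr.
have co : continuous (omega u).
  by apply: contB; apply: contZ; [exact: continuous_snd2|exact: continuous_fst2].
have coK : compact (omega u @` K).
  by apply: continuous_compact => //; exact: continuous_subspaceT.
have [M [_ HM]] := compact_bounded coK.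
pose B := Num.max M 0 + 1.
have B0 : 0 < B by rewrite ltr_wpDl// le_max lexx orbT.
have bd x : `|omega u x| <= B.
  have [g [k [Gg Kk ->]]] := covK x.
  have -> : omega u (hmul g k) = omega u g + omega u k by rewrite /omega /=; ring.
  rewrite uG// add0r; apply: HM; last by exists k.
  by rewrite ltr_pwDr// le_max lexx.
pose s := u.1.1 ^+ 2 + u.1.2 ^+ 2.
have s0 : 0 < s.
  rewrite lt_def addr_ge0 ?sqr_ge0// andbT paddr_eq0 ?sqr_ge0// !sqrf_eq0.
  apply: contra u1 => /andP[/eqP a0 /eqP b0].
  by rewrite [u.1]surjective_pairing a0 b0.
(* The point is [u] turned by a right angle and scaled so that [omega u] takes the value 2 B, beyond
   the bound B. *)
have := bd (- (2 * B / s) * u.1.2, (2 * B / s) * u.1.1, 0).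
have -> : omega u (- (2 * B / s) * u.1.2, (2 * B / s) * u.1.1, 0) = 2 * B.
  have -> : omega u (- (2 * B / s) * u.1.2, (2 * B / s) * u.1.1, 0) = (2 * B / s) * s.
    by rewrite /omega /s /=; ring.
  by rewrite divfK// gt_eqF.
rewrite ger0_norm; lra.
Qed.

End LatticeElements.

(** * The differential of the automorphism *)

Section Automorphism.
Variables (R : realType) (Gamma : set (heis R)) (Phi : nil_automorphism Gamma).
Implicit Types (f : testfn Gamma) (u v x y g h : heis R) (n : nat).

(** Additivity makes the derivative constant, so p(t) - t q(0) has derivative zero. *)
Lemma additive_linear (p q : R -> R) : {morph p : s t / s + t} ->
  (forall t : R, is_derive t (1 : R) p (q t)) -> forall t, p t = t * q 0.
Proof.
move=> pD dp; have p0 : p 0 = 0 by apply: (@addrI _ (p 0)); rewrite -pD !addr0.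
have qE t : q t = q 0.
  have sh : is_derive (0 : R) (1 : R) (fun s => t + s) 1.
    by apply: is_derive_eq; rewrite /GRing.scale/=; ring.
  have dt : is_derive (t + 0) (1 : R) p (q t) by rewrite addr0.
  have d1 := @is_derive1_comp _ p (fun s => t + s) 0 _ _ dt sh.
  have d2 : is_derive (0 : R) (1 : R) (cst (p t) + p) (0 + q 0) by exact: is_deriveD.
  have e : p \o (fun s => t + s) = cst (p t) + p by apply/funext => s /=; rewrite pD.
  rewrite e mulr1 in d1; have [_ <-] := d1; have [_ ->] := d2.
  by rewrite add0r.
move=> t; have H : p t - t * q 0 = p 0 - 0 * q 0.
  apply: (@is_derive_0_is_cst _ (fun s => p s - s * q 0)) => s.
  have dl : is_derive s (1 : R) (fun s => s * q 0) (q 0).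
    by apply: is_derive_eq; rewrite /GRing.scale/=; ring.
  have := @is_deriveB _ _ _ p (fun s => s * q 0) s 1 _ _ (dp s) dl.
  by rewrite qE subrr.
by apply/eqP; rewrite -subr_eq0 H p0 mul0r subr0.
Qed.

Lemma aut0 : Phi 0 = 0.
Proof.
have := aut_mul Phi 0 0; rewrite hmulg0; case: (Phi 0) => [[a b] c].
rewrite /hmul /= => -[/eqP]; rewrite -{1}[a]addr0 (inj_eq (addrI a)) => /eqP <- /eqP.
rewrite -{1}[b]addr0 (inj_eq (addrI b)) => /eqP <- /eqP.
by rewrite mul0r addr0 -{1}[c]addr0 (inj_eq (addrI c)) => /eqP <-.
Qed.

Lemma aut_diff x : [/\ differentiable (fun y => (Phi y).1.1) x,
  differentiable (fun y => (Phi y).1.2) x & differentiable (fun y => (Phi y).2) x].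
Proof.
by have [C1 C2 C3] := aut_smooth Phi; split; apply: Cinfty_differentiable.
Qed.

Definition daut v : heis R := ('D_v (fun y => (Phi y).1.1) 0,
  'D_v (fun y => (Phi y).1.2) 0, 'D_v (fun y => (Phi y).2) 0).

Lemma dautZD (a b : R) u v : daut (a *: u + b *: v) = a *: daut u + b *: daut v.
Proof.
have [d1 d2 d3] := aut_diff 0.
have L (F : heis R -> R) : differentiable F 0 ->
    'D_(a *: u + b *: v) F 0 = a * 'D_u F 0 + b * 'D_v F 0.
  by move=> dF; rewrite !deriveE// linearD !linearZ.
by congr (_, _, _); exact: L.
Qed.

(** A homomorphism intertwines the left translations by x and by [Phi x], so the chain rule at the
    identity suffices. *)
Lemma lie_aut v (F : heis R -> R) x : Cinfty F ->
  lie v (F \o Phi) x = lie (daut v) F (Phi x).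
Proof.
move=> CF; have CP := aut_smooth Phi.
rewrite -derive_hmul_lie; last exact: Cinfty_comp.
have -> : (F \o Phi) \o hmul x = (F \o hmul (Phi x)) \o Phi.
  by apply/funext => y /=; rewrite (aut_mul Phi).
have CFx : Cinfty (F \o hmul (Phi x)) by apply: Cinfty_comp => //; exact: Cinfty_hmul.
rewrite derive_heis_comp//; last exact: Cinfty_differentiable.
rewrite aut0 !derive_hmul_lie// /lie /grad /=; ring.
Qed.

Lemma vf_aut v f : vf v (pullback Phi f) = pullback Phi (vf (daut v) f).
Proof.
apply: testfn_ext2; apply/funext => x.
  rewrite re_vf; have -> : re (pullback Phi (vf (daut v) f)) x = re (vf (daut v) f) (Phi x) by [].
  by rewrite re_vf; exact: lie_aut (Cinfty_re f).
rewrite im_vf; have -> : im (pullback Phi (vf (daut v) f)) x = im (vf (daut v) f) (Phi x) by [].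
by rewrite im_vf; exact: lie_aut (Cinfty_im f).
Qed.

Lemma pullback_inj f1 f2 : pullback Phi f1 = pullback Phi f2 -> f1 = f2.
Proof.
move=> fg; apply: testfn_ext => x; have [k _ kK] := aut_bij Phi.
by rewrite -(kK x); exact: (congr1 (fun h : testfn Gamma => h (k x)) fg).
Qed.

Hypothesis rich : exists f, vf (e3 R) f <> 0.

(** Faithfulness of the action turns the hypothesis on test functions into an eigenvector equation
    in the Lie algebra. *)
Lemma daut_eigen v (a : R) : pushes_vfield Phi v a -> daut v = a *: v.
Proof.
rewrite /pushes_vfield vfieldE => H; apply/eqP; rewrite -subr_eq0; apply/eqP.
apply: (vf_inj0 rich) => f; apply: pullback_inj.
have E : vf (daut v) f = a%:C *: vf v f.
  by apply: pullback_inj; rewrite -vf_aut H; apply: testfn_ext.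
by rewrite vfD E -scaleNr vfZ rmorphN scaleNr subrr.
Qed.

Lemma hom_flow v (F : heis R -> R) : Cinfty F ->
  (forall s t, F (hexp v (s + t)) = F (hexp v s) + F (hexp v t)) ->
  forall t, F (hexp v t) = t * 'D_v F 0.
Proof.
move=> CF FD t; have h0 y : hmul 0 y = y.
  by case: y => [[a b] c]; rewrite /hmul /= mul0r !add0r addr0.
have dF s : is_derive s (1 : R) (fun t => F (hexp v t)) (lie v F (flow v 0 s)).
  have := is_derive_flow v 0 s (Cinfty_differentiable CF).
  rewrite (_ : (fun s => _) = fun t => F (hexp v t))//.
  by apply/funext => r; rewrite /flow h0.
rewrite (additive_linear FD dF) /flow hexp0 hmulg0 -derive_hmul_lie//.
by rewrite (_ : F \o hmul 0 = F)//; apply/funext => y /=; rewrite h0.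
Qed.

Lemma aut_flow1 v t : (Phi (hexp v t)).1.1 = t * (daut v).1.1 /\
  (Phi (hexp v t)).1.2 = t * (daut v).1.2.
Proof.
have [C1 C2 C3] := aut_smooth Phi; split.
  by apply: (hom_flow C1) => s r; rewrite hexpD (aut_mul Phi).
by apply: (hom_flow C2) => s r; rewrite hexpD (aut_mul Phi).
Qed.

(** [Phi] fixes the centre pointwise, which is why central Fourier modes commute with
    [pullback Phi]. The last coordinate of [Phi] is additive on the centre because the first one
    vanishes there. *)
Lemma aut_central (c t : R) : c != 0 -> daut (0, 0, c) = (0, 0, c) ->
  Phi (0, 0, t) = (0, 0, t).
Proof.
move=> c0 dc.
have ce s : hexp (0, 0, c) s = (0, 0, s * c).
  by rewrite /hexp /=; congr (_, _, _); ring.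
have -> : (0, 0, t) = hexp (0, 0, c) (t / c) by rewrite ce divfK.
have [E1 E2] : (forall s, (Phi (hexp (0, 0, c) s)).1.1 = 0) /\
    (forall s, (Phi (hexp (0, 0, c) s)).1.2 = 0).
  by split=> s; have [] := aut_flow1 (0, 0, c) s; rewrite dc /= mulr0.
have [C1 C2 C3] := aut_smooth Phi.
have E3 s : (Phi (hexp (0, 0, c) s)).2 = s * c.
  rewrite (hom_flow C3 (v := (0, 0, c))).
    by rewrite -[X in _ * X]/((daut (0, 0, c)).2) dc.
  by move=> r s'; rewrite hexpD (aut_mul Phi) /hmul /= E1 mul0r addr0.
rewrite [Phi _]surjective_pairing [(Phi _).1]surjective_pairing E1 E2 E3.
by rewrite ce.
Qed.

Lemma avgt_aut (tau : R) (k : R -> R) (ck : continuous k) f :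
  (forall t, Phi (0, 0, t) = (0, 0, t)) ->
  avgt (0, 0, tau) ck (pullback Phi f) = pullback Phi (avgt (0, 0, tau) ck f).
Proof.
move=> Pc; have E (F : heis R -> R) x :
    avg (0, 0, tau) k (F \o Phi) x = avg (0, 0, tau) k F (Phi x).
  rewrite /avg; congr (int01 _); apply/funext => t /=; congr (_ * F _).
  rewrite /flow (aut_mul Phi); congr hmul.
  have -> : hexp (0, 0, tau) t = (0, 0, t * tau).
    by rewrite /hexp /=; congr (_, _, _); ring.
  exact: Pc.
by apply: testfn_ext2; apply/funext => x; exact: E.
Qed.

Lemma pullback_linear : linear (pullback Phi).
Proof. by move=> a f g; apply: testfn_ext. Qed.

HB.instance Definition _ :=
  GRing.isLinear.Build _ _ _ _ (pullback Phi) pullback_linear.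

Lemma fourier_aut (tau : R) (m : int) f : (forall t, Phi (0, 0, t) = (0, 0, t)) ->
  fourier (0, 0, tau) m (pullback Phi f) = pullback Phi (fourier (0, 0, tau) m f).
Proof. by move=> Pc; rewrite /fourier !avgt_aut// linearD linearZ. Qed.

Lemma iter_aut_lattice n g : Gamma g -> Gamma (iter n Phi g).
Proof.
move=> Gg; elim: n => [//|n IH] /=.
have : (Phi @` Gamma) (Phi (iter n Phi g)) by exists (iter n Phi g).
by rewrite aut_lattice.
Qed.

(** Cramer's rule modulo the centre, with [omega] as the determinant. *)
Lemma frame_coord (X Y v : heis R) (c : R) : c != 0 -> omega X Y = c ->
  v = (omega v Y / c) *: X + (omega X v / c) *: Y +
    (((v.2 - omega v Y / c * X.2 - omega X v / c * Y.2) / c) *: (0, 0, c)).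
Proof.
move=> c0 XY.
have nz : X.1.1 * Y.1.2 - X.1.2 * Y.1.1 != 0 by rewrite -/(omega X Y) XY.
by rewrite -XY /omega; case: X Y v {XY} nz => [[x1 x2] x3] [[y1 y2] y3] [[v1 v2] v3] /= nz;
  congr (_, _, _); rewrite /= /GRing.scale/=; field.
Qed.

(** Up to the factor c, [omega X] reads off the Y-coordinate modulo the centre, which the
    differential contracts by [lambda^-1]. *)
Lemma omega_aut (X Y g : heis R) (c lambda : R) : c != 0 -> omega X Y = c ->
  daut X = lambda *: X -> daut Y = lambda^-1 *: Y -> daut (0, 0, c) = (0, 0, c) ->
  omega X (Phi g) = lambda^-1 * omega X g.
Proof.
move=> c0 XY dX dY dZ; have [E1 E2] := aut_flow1 (hlog g) 1.
rewrite hlogK !mul1r in E1 E2.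
rewrite [LHS]/omega E1 E2 -/(omega X (daut (hlog g))).
have oE : omega X (hlog g) = omega X g by [].
rewrite -oE; set v := hlog g; set b := omega X v.
have [a [d vE]] : exists a d : R, v = a *: X + (b / c) *: Y + d *: (0, 0, c).
  by do 2 eexists; exact: frame_coord.
have -> : daut v = a *: (lambda *: X) + (b / c) *: (lambda^-1 *: Y) + d *: (0, 0, c).
  have L := dautZD 1 d (a *: X + (b / c) *: Y) (0, 0, c).
  rewrite !scale1r in L; rewrite [in LHS]vE; apply: (etrans L).
  by rewrite dautZD dX dY dZ.
have -> : omega X (a *: (lambda *: X) + (b / c) *: (lambda^-1 *: Y) + d *: (0, 0, c)) =
    lambda^-1 * (b / c) * omega X Y.
  by rewrite /omega /= /GRing.scale/=; ring.
by rewrite XY -mulrA divfK.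
Qed.

Lemma omega_iter_aut (X Y g : heis R) (c lambda : R) n : c != 0 -> omega X Y = c ->
  daut X = lambda *: X -> daut Y = lambda^-1 *: Y -> daut (0, 0, c) = (0, 0, c) ->
  omega X (iter n Phi g) = lambda^-1 ^+ n * omega X g.
Proof.
move=> c0 XY dX dY dZ; elim: n => [|n IH] /=; first by rewrite expr0 mul1r.
by rewrite (omega_aut _ c0 XY dX dY dZ) IH exprS mulrA.
Qed.

End Automorphism.

(** * Integrality of the central frequencies *)

Section HaarMeasure.
Variable R : realType.
Local Notation HM := (measurableTypeR R * measurableTypeR R * measurableTypeR R)%type.
Implicit Types (g h x y u v p : HM) (G : HM -> \bar R).
Local Notation leb := (@lebesgue_measure R).

Lemma measurable_shift (a : R) :
  measurable_fun setT (fun t : measurableTypeR R => t + a : measurableTypeR R).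
Proof.
apply: continuous_measurable_fun; apply: contD; last exact: cst_continuous.
by move=> t; exact: cvg_id.
Qed.

Lemma lebesgue_shift (a : R) (A : set R) : measurable A ->
  pushforward leb (fun t => t + a : measurableTypeR R) A = leb A.
Proof.
move=> mA; pose mf := measurable_shift a.
have H := @lebesgue_measure_unique R
  (measure_function_pushforward__canonical__measure_function_Measure leb mf).
apply/esym/H => // _ [[b c]] _ <-; rewrite /= /pushforward.
have -> : (fun t : R => t + a) @^-1` `]b, c] = `]b - a, c - a]%classic.
  apply/seteqP; split=> t /=; rewrite !in_itv /= ltrBlDr lerBrDr.
    by [].
  by [].
by rewrite !lebesgue_measure_itv /= !lte_fin ltrD2r -!EFinB opprB addrA subrK.
Qed.

Lemma integral_shift (a : R) (f : R -> \bar R) : measurable_fun setT f ->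
  (forall t, (0 <= f t)%E) -> (\int[leb]_t f (t + a)%R = \int[leb]_t f t)%E.
Proof.
move=> mf f0; pose ms := measurable_shift a.
transitivity (\int[pushforward leb (fun t => (t + a)%R : measurableTypeR R)]_t f t)%E.
  by rewrite (ge0_integral_pushforward ms) ?preimage_setT.
by apply: eq_measure_integral => A mA _; exact: lebesgue_shift.
Qed.

Lemma measurable_heis (a b c : HM -> R) : measurable_fun setT a ->
  measurable_fun setT b -> measurable_fun setT c ->
  measurable_fun setT (fun p => (a p, b p, c p) : HM).
Proof.
move=> ma mb mc; apply: measurable_fun_pair => //.
exact: (@measurable_fun_pair _ _ _ HM (measurableTypeR R) (measurableTypeR R) a b ma mb).
Qed.

Lemma measurable_coord : [/\ measurable_fun setT (fun p : HM => p.1.1 : R),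
  measurable_fun setT (fun p : HM => p.1.2 : R) & measurable_fun setT (fun p : HM => p.2 : R)].
Proof.
have m1 := @measurable_fst _ _ (measurableTypeR R * measurableTypeR R)%type (measurableTypeR R).
split.
- exact: (measurableT_comp (@measurable_fst _ _ (measurableTypeR R) (measurableTypeR R)) m1).
- exact: (measurableT_comp (@measurable_snd _ _ (measurableTypeR R) (measurableTypeR R)) m1).
- exact: (@measurable_snd _ _ (measurableTypeR R * measurableTypeR R)%type (measurableTypeR R)).
Qed.

(** A named copy of the product measure, to which the measure and sigma-finiteness instances are
    attached; a second product is built on it. *)
Definition leb2 : set (measurableTypeR R * measurableTypeR R) -> \bar R :=
  (leb \x leb)%E.

HB.instance Definition _ := Measure.copy leb2 (leb \x leb)%E.

Lemma leb2_sigma_finite : sigma_finite setT leb2.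
Proof.
have /sigma_finiteP[F [TF ndF Foo]] := sigma_finiteT leb.
exists (fun n => F n `*` F n).
 rewrite -setXTT TF predeqE => -[x y]; split.
    move=> [/= [n _ Fnx] [k _ Gky]]; exists (maxn n k) => //; split.
    - by move: x Fnx; exact/subsetPset/ndF/leq_maxl.
    - by move: y Gky; exact/subsetPset/ndF/leq_maxr.
  by move=> [n _ []/= ? ?]; split; exists n.
move=> k; have [? ?] := Foo k.
split; first exact: measurableX.
by rewrite /leb2 product_measure1E// lte_mul_pinfty// ge0_fin_numE.
Qed.

HB.instance Definition _ := Measure_isSigmaFinite.Build _ _ _ leb2 leb2_sigma_finite.

Definition haarm : {measure set HM -> \bar R} := (leb2 \x leb)%E.

(** A common form for the two kinds of translation: [hmul g] has k = g.1.1, and a central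
    translation has k = 0. *)
Definition shear (a b c k : R) p : HM := (p.1.1 + a, p.1.2 + b, p.2 + (c + k * p.1.2)).

Lemma measurable_shear a b c k : measurable_fun setT (shear a b c k).
Proof.
have [m1 m2 m3] := measurable_coord.
apply: measurable_heis; [exact: measurable_funD|exact: measurable_funD|].
apply: measurable_funD => //; apply: measurable_funD => //.
exact: measurable_funM.
Qed.

(** Tonelli with the last coordinate innermost: for fixed (x, y) the shear is a translation there,
    and what is left is a translation in each of x and y. *)
Lemma haar_shear a b c k G : measurable_fun setT G -> (forall p, (0 <= G p)%E) ->
  (\int[haarm]_p G (shear a b c k p) = \int[haarm]_p G p)%E.
Proof.
move=> mG G0.
have mGs : measurable_fun setT (G \o shear a b c k).
  exact: measurableT_comp mG (measurable_shear a b c k).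
apply: (etrans (@fubini_tonelli1 _ _ _ _ R leb2 leb _ mGs (fun p => G0 _))).
apply: esym; apply: (etrans (@fubini_tonelli1 _ _ _ _ R leb2 leb G mG G0)); apply: esym.
pose F (q : measurableTypeR R * measurableTypeR R) := (\int[leb]_z G (q, z))%E.
have mF : measurable_fun setT F by exact: measurable_fun_fubini_tonelli_F.
have F0 q : (0 <= F q)%E by apply: integral_ge0.
transitivity (\int[leb2]_q F (q.1 + a, q.2 + b)%R)%E.
  apply: eq_integral => q _ /=; rewrite /F /shear /=.
  apply: (@integral_shift (c + k * q.2) (fun z => G ((q.1 + a, q.2 + b), z))) => //.
  exact: measurableT_comp mG (measurable_fun_pair (@measurable_cst _ _ _ _ _ _) (@measurable_id _ _ _)).
have mp : measurable_fun setT (fun q : measurableTypeR R * measurableTypeR R =>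
    (q.1 + a, q.2 + b) : measurableTypeR R * measurableTypeR R).
  apply: measurable_fun_pair.
    exact: (measurableT_comp (measurable_shift a) (@measurable_fst _ _ _ _)).
  exact: (measurableT_comp (measurable_shift b) (@measurable_snd _ _ _ _)).
have mFs : measurable_fun setT (fun q : measurableTypeR R * measurableTypeR R =>
    F (q.1 + a, q.2 + b)).
  exact: measurableT_comp mF mp.
apply: (etrans (@fubini_tonelli1 _ _ _ _ R leb leb _ mFs (fun q => F0 _))).
apply: esym; apply: (etrans (@fubini_tonelli1 _ _ _ _ R leb leb F mF F0)); apply: esym.
pose E (x : measurableTypeR R) := (\int[leb]_y F (x, y))%E.
have mE : measurable_fun setT E by exact: measurable_fun_fubini_tonelli_F.
have E0 (r : R) : (0 <= E r)%E by apply: integral_ge0.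
transitivity (\int[leb]_r E (r + a)%R)%E.
  apply: eq_integral => r _; rewrite /E /fubini_F /=.
  apply: (@integral_shift b (fun s => F (r + a, s))) => //.
  exact: measurableT_comp mF (measurable_fun_pair (@measurable_cst _ _ _ _ _ _) (@measurable_id _ _ _)).
exact: integral_shift.
Qed.

(** An open set is the union of the countably many boxes with rational centre and radius 1/(n+1)
    that it contains, and boxes lie in the product sigma-algebra. *)
Lemma open_heis_measurable (U : set (heis R)) : open U -> measurable U.
Proof.
move=> oU; pose r (n : nat) : R := n.+1%:R^-1.
pose box (i : rat * rat * rat * nat) : set (heis R) :=
  ((ball (ratr i.1.1.1 : R) (r i.2) `*` ball (ratr i.1.1.2 : R) (r i.2)) `*`
   ball (ratr i.1.2 : R) (r i.2)).
pose A i := if `[< box i `<=` U >] then box i else set0.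
have -> : U = \bigcup_i A i.
  apply/seteqP; split=> [x Ux|x [i _]]; last first.
    by rewrite /A; case: asboolP => // iU xi; exact: iU.
  have [e /= e0 xe] := (nbhs_ballP _ _).1 (open_nbhs_nbhs (conj oU Ux)).
  have [n ne] : exists n, r n < e / 2.
    have := archi_boundP (ltW (divr_gt0 (ltr0Sn R 1) e0)); set n := Num.bound _ => ne.
    exists n; rewrite /r invf_plt ?posrE ?divr_gt0//.
    by rewrite invf_div (lt_trans ne)// ltr_nat.
  have rn0 : 0 < r n by rewrite invr_gt0.
  have app (t : R) : exists q : rat, `|ratr q - t| < r n.
    have : t - r n < t + r n by rewrite ltrBlDr -addrA ltrDl addr_gt0.
    move=> /rat_in_itvoo[q]; rewrite in_itv /= => /andP[q1 q2]; exists q.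
    by rewrite ltr_norml; apply/andP; split; lra.
  have [q1 h1] := app x.1.1; have [q2 h2] := app x.1.2; have [q3 h3] := app x.2.
  exists (q1, q2, q3, n) => //; rewrite /A; case: asboolP => [_|[]].
    by rewrite /box /= -!ball_normE.
  move=> y; rewrite /box -!ball_normE /= => -[[y1 y2] y3]; apply: xe.
  have near (s t : R) q : `|ratr q - s| < r n -> `|ratr q - t| < r n -> `|s - t| < e.
    rewrite !ltr_norml => /andP[? ?] /andP[? ?]; apply/andP; split; lra.
  split; [split|]; rewrite -ball_normE /=.
  - exact: near h1 y1.
  - exact: near h2 y2.
  - exact: near h3 y3.
apply: countable_bigcupT_measurable; first exact: countableP.
move=> i; rewrite /A; case: ifP => _ //.
by apply: measurableX; [apply: measurableX|]; exact: measurable_ball.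
Qed.

Lemma continuous_heis_measurable (f : heis R -> R) : continuous f -> measurable_fun setT f.
Proof.
move=> cf; apply: (measurability _ (RGenOpens.measurableE R)).
move=> _ [_ [a [b ->] <-]]; rewrite setTI; apply: open_heis_measurable.
by move/continuousP : cf; apply; exact: interval_open.
Qed.

(** An element is coded by an integer bound on its first coordinate and by its cell in a grid. Two
    elements with the same code have g^-1 h in the ball around 0 that meets the lattice only there.
    The mesh shrinks with that bound because the last coordinate of g^-1 h contains g1 (h2 - g2). *)
Lemma lattice_countable (Gamma : set (heis R)) : is_lattice Gamma -> countable Gamma.
Proof.
move=> lat; have [[G0 Gd] [e e0 He] _] := lat.
pose m g := Num.bound `|g.1.1|; pose d g : R := e / (2 * ((m g).+1)%:R).
pose code g := pickle (m g, Num.floor (g.1.1 / d g), Num.floor (g.1.2 / d g), Num.floor (g.2 / d g)).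
apply/countable_injP; exists code => g h /set_mem Gg /set_mem Gh /(pcan_inj pickleK).
case=> mE; have dE : d h = d g by rewrite /d (congr1 S (esym mE) : m h = m g).
rewrite dE => f1 f2 f3.
have M0 : 0 < ((m g).+1)%:R :> R by rewrite ltr0n.
have d0 : 0 < d g by rewrite divr_gt0// mulr_gt0.
have close (s t : R) : Num.floor (s / d g) = Num.floor (t / d g) -> `|t - s| < d g.
  move=> st; have := floor_itv (s / d g); have := floor_itv (t / d g).
  rewrite st; set z := Num.floor _; rewrite intrD.
  rewrite !ler_pdivlMr// !ltr_pdivrMr// => /andP[? ?] /andP[? ?].
  by rewrite ltr_norml; apply/andP; split; lra.
have c1 := close _ _ f1; have c2 := close _ _ f2; have c3 := close _ _ f3.
have g1 : `|g.1.1| < (m g).+1%:R.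
  by apply: (lt_trans (archi_boundP (normr_ge0 _))); rewrite ltr_nat.
have de : d g * 2 * (m g).+1%:R = e by rewrite /d; move: (_.+1%:R) M0 => M M0; field; rewrite gt_eqF.
have k0 : hmul (hinv g) h = 0.
  apply: He; first by apply: lattice_mul => //; exact: lattice_inv.
  have M1 : 1 <= (m g).+1%:R :> R by rewrite ler1n.
  split; [split|]; rewrite -ball_normE /= sub0r normrN.
  - by rewrite addrC; apply: (lt_le_trans c1); nra.
  - by rewrite addrC; apply: (lt_le_trans c2); nra.
  - have -> : - g.2 + g.1.1 * g.1.2 + h.2 + - g.1.1 * h.1.2 = (h.2 - g.2) - g.1.1 * (h.1.2 - g.1.2) by ring.
    apply: (le_lt_trans (ler_normB _ _)); rewrite normrM.
    have p0 : `|g.1.1| * `|h.1.2 - g.1.2| <= (m g).+1%:R * d g.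
      by apply: ler_pM => //; exact: ltW.
    nra.
have hE : h = hmul g (hmul (hinv g) h).
  by case: (g) (h) => [[? ?] ?] [[? ?] ?]; rewrite /hmul /hinv /=; congr (_, _, _); ring.
by rewrite hE k0 hmulg0.
Qed.

End HaarMeasure.

(** * Fundamental domains and unfolding *)

Section Unfolding.
Variables (R : realType) (Gamma : set (heis R)).
Hypothesis lat : is_lattice Gamma.
Local Notation HM := (measurableTypeR R * measurableTypeR R * measurableTypeR R)%type.
Local Notation haarm := (@haarm R).
Implicit Types (g x y p : HM) (G : HM -> \bar R) (A B F : set HM).

Lemma lattice_enum : exists e : nat -> HM, (forall n, Gamma (e n)) /\
  forall g, Gamma g -> exists n, e n = g.
Proof.
have /countable_injP[f finj] := lattice_countable lat.
have [[G0 _] _ _] := lat.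
have H n : exists g : HM, Gamma g /\ ((exists2 g', Gamma g' & f g' = n) -> f g = n).
  have [[g' Gg' fg']|N] := pselect (exists2 g', Gamma g' & f g' = n).
    by exists g'.
  (* An integer that codes nothing is sent to the identity, so the enumeration may repeat elements;
     [seqDU] in [unfolding] absorbs the repetitions. *)
  by exists 0.
have [e He] := choice H; exists e; split=> [n|g Gg]; first by have [] := He n.
exists (f g); have [Ge] := He (f g); move=> /(_ (ex_intro2 _ _ g Gg erefl)) E.
by apply: finj; rewrite ?inE.
Qed.

Lemma hmulVK g x : hmul (hinv g) (hmul g x) = x.
Proof.
by case: g x => [[a b] c] [[d e] f]; rewrite /hmul /hinv /=; congr (_, _, _); ring.
Qed.

Lemma hmulKV g x : hmul g (hmul (hinv g) x) = x.
Proof.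
by case: g x => [[a b] c] [[d e] f]; rewrite /hmul /hinv /=; congr (_, _, _); ring.
Qed.

Lemma hmul_shear g : hmul g = shear g.1.1 g.1.2 g.2 g.1.1 :> (HM -> HM).
Proof. by apply/funext => p; rewrite /hmul /shear; congr (_, _, _); ring. Qed.

Lemma measurable_hmul g : measurable_fun setT (hmul g : HM -> HM).
Proof. by rewrite hmul_shear; exact: measurable_shear. Qed.

Lemma haar_shear_set a b c k A G : measurable A -> measurable_fun setT G ->
  (forall p, (0 <= G p)%E) ->
  (\int[haarm]_(p in A) G p =
   \int[haarm]_(p in shear a b c k @^-1` A) G (shear a b c k p))%E.
Proof.
move=> mA mG G0; rewrite integral_mkcond [RHS]integral_mkcond.
have mGA : measurable_fun setT (G \_ A).
  by apply/(measurable_restrictT _ mA); exact: measurable_funTS.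
have GA0 p : (0 <= (G \_ A) p)%E by rewrite /patch; case: ifP.
rewrite -(haar_shear a b c k mGA GA0).
apply: eq_integral => p _; rewrite /patch.
suff -> : (shear a b c k p \in A) = (p \in shear a b c k @^-1` A) by [].
by apply/idP/idP; rewrite !inE.
Qed.

Lemma haar_hmul_set g A G : measurable A -> measurable_fun setT G ->
  (forall p, (0 <= G p)%E) -> (forall p, G (hmul g p) = G p) ->
  (\int[haarm]_(p in A) G p = \int[haarm]_(p in hmul g @^-1` A) G p)%E.
Proof.
move=> mA mG G0 Gg; rewrite (haar_shear_set g.1.1 g.1.2 g.2 g.1.1 mA mG G0) -hmul_shear.
by apply: eq_integral => p _; rewrite -[in RHS]Gg.
Qed.

Lemma measurable_preimage_hmul g A : measurable A ->
  measurable (hmul g @^-1` A : set HM).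
Proof. by move=> mA; rewrite -[X in measurable X]setTI; exact: measurable_hmul. Qed.

(* Both sides unfold to sums over the lattice: the part of [F] in [gamma B] is
   translated into [B], and the translates stay disjoint because [F] meets
   each orbit at most once. *)
Lemma unfolding F B G : measurable F -> measurable B ->
  (forall x y g, F x -> F y -> Gamma g -> x = hmul g y -> x = y) ->
  (forall x, F x -> exists2 g, Gamma g & B (hmul (hinv g) x)) ->
  measurable_fun setT G -> (forall p, (0 <= G p)%E) ->
  (forall g p, Gamma g -> G (hmul g p) = G p) ->
  (\int[haarm]_(p in F) G p <= \int[haarm]_(p in B) G p)%E.
Proof.
move=> mF mB injF cov mG G0 Ginv; have [e [Ge esurj]] := lattice_enum.
pose A n := F `&` (hmul (hinv (e n)) @^-1` B).
have mA n : measurable (A n) by apply: measurableI => //; exact: measurable_preimage_hmul.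
have FA : F = \bigcup_n A n.
  apply/seteqP; split=> [x Fx|x [n _ []]//].
  have [g Gg Bg] := cov x Fx; have [n ng] := esurj g Gg.
  by exists n => //; split=> //=; rewrite ng.
have mD n : measurable (seqDU A n).
  by apply: measurableD => //; apply: bigsetU_measurable => i _.
pose E n := (hmul (e n) : HM -> HM) @^-1` seqDU A n.
have mE n : measurable (E n) by exact: measurable_preimage_hmul.
have DA n : seqDU A n `<=` A n by move=> x [].
have tE : trivIset setT E.
  apply/trivIsetP => i j _ _ ij; apply/seteqP; split=> // p [/= Ei Ej].
  have eq : hmul (e i) p = hmul (e j) p.
    apply: (injF _ _ (hmul (e i) (hinv (e j)))).
    - by have [] := DA _ _ Ei.
    - by have [] := DA _ _ Ej.
    - by apply: lattice_mul => //; exact: lattice_inv.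
    - by rewrite -hmulA hmulVK.
  have /trivIsetP/(_ i j I I ij) := @trivIset_seqDU _ A.
  by move/seteqP => [+ _] => /(_ (hmul (e i) p)); apply; split=> //; rewrite eq.
have EB : \bigcup_n E n `<=` B.
  by move=> p [n _ /= /DA[_ /=]]; rewrite hmulVK.
rewrite [X in (integral haarm X _ <= _)%E]FA seqDU_bigcup_eq.
rewrite ge0_integral_bigcup//; last exact: measurable_funTS.
apply: (@le_trans _ _ (\int[haarm]_(p in \bigcup_n E n) G p)%E); last first.
  apply: ge0_subset_integral => //; last exact: measurable_funTS.
  exact: bigcupT_measurable.
rewrite ge0_integral_bigcup//; last exact: measurable_funTS.
rewrite le_eqVlt; apply/orP; left; apply/eqP; apply: eq_eseriesr => n _.
by apply: haar_hmul_set => // p; exact: Ginv.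
Qed.

Lemma fundamental_inj F : fundamental_domain Gamma F ->
  forall x y g, F x -> F y -> Gamma g -> x = hmul g y -> x = y.
Proof.
move=> [_ fdF] x y g Fx Fy Gg xy; have [z [_ zu]] := fdF x.
have [[G0 _] _ _] := lat.
have h0 p : hmul 0 p = p.
  by case: p => [[a b] c]; rewrite /hmul /= mul0r !add0r addr0.
rewrite -(zu x); last by split=> //; exists 0; rewrite ?h0.
by rewrite -(zu y)//; split=> //; exists g.
Qed.

Lemma fundamental_cov F : fundamental_domain Gamma F ->
  forall x, exists2 g, Gamma g & F (hmul (hinv g) x).
Proof.
move=> [_ fdF] x; have [y [[Fy [g Gg ->]] _]] := fdF x.
by exists g => //; rewrite hmulVK.
Qed.

Lemma fundamental_integral F B G : fundamental_domain Gamma F ->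
  fundamental_domain Gamma B ->
  measurable_fun setT G -> (forall p, (0 <= G p)%E) ->
  (forall g p, Gamma g -> G (hmul g p) = G p) ->
  (\int[haarm]_(p in F) G p = \int[haarm]_(p in B) G p)%E.
Proof.
move=> fF fB mG G0 Ginv; apply/le_anti/andP.
have [mF mB] := (fF.1, fB.1).
split; apply: unfolding => //.
- exact: fundamental_inj.
- by move=> x _; exact: fundamental_cov.
- exact: fundamental_inj.
- by move=> x _; exact: fundamental_cov.
Qed.

Definition ztrans (s : R) x : HM := shear 0 0 s 0 x.

Lemma ztransE s x : ztrans s x = hmul x (0, 0, s).
Proof. by rewrite /ztrans /shear /hmul; congr (_, _, _) => /=; ring. Qed.

Lemma fundamental_ztrans F s : fundamental_domain Gamma F ->
  fundamental_domain Gamma (ztrans s @^-1` F).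
Proof.
move=> fF; split.
  have mz : measurable_fun setT (ztrans s) by exact: measurable_shear.
  by have := mz measurableT F fF.1; rewrite setTI.
have zK t x : ztrans (- t) (ztrans t x) = x.
  by rewrite /ztrans /shear /=; case: x => [[a b] c] /=; congr (_, _, _); ring.
have zM t g x : ztrans t (hmul g x) = hmul g (ztrans t x).
  by rewrite !ztransE hmulA.
move=> x; have [y [[Fy [g Gg xy]] yu]] := fF.2 (ztrans s x).
exists (ztrans (- s) y); split.
  split; first by rewrite /= -{1}[s]opprK zK.
  by exists g => //; rewrite -zM -xy zK.
move=> y' [/= Fy' [g' Gg' xy']].
by rewrite (yu (ztrans s y')) ?zK//; split=> //; exists g' => //; rewrite xy' zM.
Qed.

(** A central translation commutes with the lattice, so it carries one fundamental domain to
    another, and the integral of an invariant function does not depend on the domain. *)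
Lemma ztrans_integral F s G : fundamental_domain Gamma F ->
  measurable_fun setT G -> (forall p, (0 <= G p)%E) ->
  (forall g p, Gamma g -> G (hmul g p) = G p) ->
  (\int[haarm]_(p in F) G (ztrans s p) = \int[haarm]_(p in F) G p)%E.
Proof.
move=> fF mG G0 Ginv; rewrite [RHS](haar_shear_set 0 0 s 0 fF.1 mG G0).
apply: fundamental_integral => //.
- exact: fundamental_ztrans.
- exact: measurableT_comp mG (measurable_shear _ _ _ _).
- by move=> g p Gg; rewrite !ztransE -hmulA Ginv.
Qed.

Lemma ztrans_Rintegral F s (f : HM -> R) : fundamental_domain Gamma F ->
  measurable_fun setT f -> (forall g p, Gamma g -> f (hmul g p) = f p) ->
  Rintegral haarm F (fun p => f (ztrans s p)) = Rintegral haarm F f.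
Proof.
move=> fF mf finv; rewrite /Rintegral; congr fine.
have mE : measurable_fun setT (EFin \o f) by exact/measurable_EFinP.
rewrite integralE [RHS]integralE; congr (_ - _)%E.
  transitivity (\int[haarm]_(p in F) (EFin \o f)^\+%E (ztrans s p))%E.
    by apply: eq_integral => p _; rewrite !unlock.
  apply: ztrans_integral => //; first exact: measurable_funepos.
  by move=> g p Gg; rewrite !unlock /= finv.
transitivity (\int[haarm]_(p in F) (EFin \o f)^\-%E (ztrans s p))%E.
  by apply: eq_integral => p _; rewrite !unlock.
apply: ztrans_integral => //; first exact: measurable_funeneg.
by move=> g p Gg; rewrite !unlock /= finv.
Qed.

Lemma haar_cube (I J K : set (measurableTypeR R)) :
  measurable I -> measurable J -> measurable K ->
  haarm ((I `*` J) `*` K) =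
  ((@lebesgue_measure R) I * (@lebesgue_measure R) J * (@lebesgue_measure R) K)%E.
Proof.
move=> mI mJ mK.
apply: (etrans (@product_measure1E _ _ _ _ R (@leb2 R) (@lebesgue_measure R) _ _
  (measurableX mI mJ) mK)).
by rewrite [X in (X * _)%E](@product_measure1E _ _ _ _ R (@lebesgue_measure R)
  (@lebesgue_measure R) _ _ mI mJ).
Qed.

(** Unfolding compares [F] with a cube that contains the compact set [K], and the cube has finite
    volume. *)
Lemma fundamental_finite F : fundamental_domain Gamma F -> (haarm F < +oo)%E.
Proof.
move=> fF; have [_ _ [K cK covK]] := lat.
have [M [_ HM']] := compact_bounded cK.
pose B0 := Num.max M 0 + 1.
have B00 : 0 <= B0 by rewrite addr_ge0// le_max lexx orbT.
pose B : set HM := (`[- B0, B0] `*` `[- B0, B0]) `*` `[- B0, B0].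
have mB : measurable B by apply: measurableX; [apply: measurableX|]; exact: measurable_itv.
have -> : haarm F = (\int[haarm]_(p in F) 1)%E by rewrite integral_cst ?mul1e//; exact: fF.1.
apply: (@le_lt_trans _ _ (\int[haarm]_(p in B) 1)%E).
  apply: unfolding => //; first exact: fF.1.
  - exact: fundamental_inj.
  - move=> x _; have [g [k [Gg Kk ->]]] := covK x; exists g => //.
    rewrite hmulVK; have kB : `|k| <= B0 by apply: HM' => //; rewrite ltr_pwDr// le_max lexx.
    have [k1 k2 k3] := norm_heis_le k.
    by split; [split|]; rewrite /= in_itv /= -ler_norml; apply: (le_trans _ kB).
rewrite integral_cst// mul1e haar_cube; [|exact: measurable_itv..].
by rewrite lebesgue_measure_itv; case: ifP => _ //; rewrite -!EFinM ltry.
Qed.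

End Unfolding.

(** * Integrals of test functions over the nilmanifold *)

Section Modes.
Variables (R : realType) (Gamma : set (heis R)).
Hypothesis lat : is_lattice Gamma.
Local Notation HM := (measurableTypeR R * measurableTypeR R * measurableTypeR R)%type.
Local Notation haarm := (@haarm R).
Variable F : set HM.
Hypothesis fF : fundamental_domain Gamma F.
Implicit Types (f : testfn Gamma) (x y p : HM).

Let mF : measurable F := fF.1.

Let m : R := fine (haarm F).

Let m_fin : haarm F = m%:E.
Proof.
by rewrite /m fineK// ge0_fin_numE// (fundamental_finite lat fF).
Qed.

Let m_ge0 : 0 <= m.
Proof. by rewrite /m fine_ge0. Qed.

Lemma continuous_HM_measurable (G : HM -> R) : continuous (G : heis R -> R) ->
  measurable_fun setT G.
Proof. exact: continuous_heis_measurable. Qed.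

Lemma bounded_integrable (G : HM -> R) (M : R) : continuous (G : heis R -> R) ->
  (forall x, `|G x| <= M) -> haarm.-integrable F (EFin \o G).
Proof.
move=> cG GM; have mG := continuous_HM_measurable cG.
apply: (@le_integrable _ _ _ haarm F mF _ (EFin \o cst M)).
- by apply/measurable_EFinP; exact: measurable_funTS.
- by move=> x _ /=; rewrite lee_fin (le_trans (GM x))// ler_norm.
- apply/integrableP; split; first exact/measurable_EFinP.
  under eq_integral do rewrite /=.
  by rewrite integral_cst// m_fin -EFinM ltry.
Qed.

Lemma Rintegral_bound (G : HM -> R) (M : R) : continuous (G : heis R -> R) ->
  (forall x, `|G x| <= M) -> `|Rintegral haarm F G| <= M * m.
Proof.
move=> cG GM; have iG := bounded_integrable cG GM.
apply: (le_trans (le_normr_Rintegral mF iG)).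
have cN : continuous (fun x : heis R => `|G x|).
  by move=> x; apply: cvg_norm; exact: cG.
have -> : M * m = Rintegral haarm F (cst M) by rewrite Rintegral_cst.
have M0 : 0 <= M by exact: le_trans (normr_ge0 _) (GM 0).
apply: le_Rintegral => //.
- apply: (@bounded_integrable (fun x => `|G x|) M cN) => x.
  by rewrite normr_id.
- apply: (@bounded_integrable (cst M) M); first exact: cst_continuous.
  by move=> x; rewrite /cst ger0_norm.
Qed.

(** Central translation by s leaves the integral of [G] unchanged, while the Taylor remainder at
    order 1 is at most s^2 M2. Hence s times the integral of [D3 G] is at most s^2 M2 m in absolute
    value, and s tends to 0. *)
Lemma Rintegral_D3 (G : heis R -> R) (M0 M1 M2 : R) : Cinfty G ->
  (forall g p, Gamma g -> G (hmul g p) = G p) ->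
  (forall x, `|G x| <= M0) -> (forall x, `|D3 G x| <= M1) ->
  (forall x, `|D3 (D3 G) x| <= M2) -> Rintegral haarm F (D3 G) = 0.
Proof.
move=> CG Ginv B0 B1 B2; have C3 := Cinfty_D3 CG.
have cG := Cinfty_continuous CG; have c3 := Cinfty_continuous C3.
have incr (H : heis R -> R) x s : Cinfty H -> exists2 t : R, 0 <= t <= 1 &
    H (ztrans s x) - H x = s * D3 H (ztrans (t * s) x).
  move=> CH; have [t t01 tE] := heis_MVT x (0, 0, s) (Cinfty_differentiable CH).
  exists t => //.
  have zE r : ztrans r x = x + (0, 0, r) by rewrite /ztrans /shear; case: x {tE} => [[a b] c] /=;
    congr (_, _, _); rewrite /= ?mul0r ?addr0.
  rewrite !zE tE /grad /= !mul0r !add0r; congr (_ * D3 H (_ + _)).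
  by congr (_, _, _); rewrite /= /GRing.scale/= ?mulr0.
pose J := Rintegral haarm F (D3 G).
have key s : 0 < s -> `|J| <= s * (M2 * m).
  move=> s0; have cs : continuous (fun x : heis R => G (ztrans s x)).
    have ch : continuous (fun x : heis R => hmul x (0, 0, s)).
      by apply: continuous_hmul; [move=> x; exact: cvg_id|exact: cst_continuous].
    rewrite (_ : (fun x => _) = fun x => G (hmul x (0, 0, s))).
      exact: cont_comp ch cG.
    by apply/funext => x; rewrite ztransE.
  have i1 := @bounded_integrable (fun x => G (ztrans s x)) M0 cs (fun x => B0 _).
  have i0 := bounded_integrable cG B0.
  have i3 := bounded_integrable c3 B1.
  have cd : continuous (fun x : heis R => G (ztrans s x) - G x) by exact: contB.
  have id : haarm.-integrable F (EFin \o (fun x : HM => G (ztrans s x) - G x)).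
    apply: (@bounded_integrable (fun x => G (ztrans s x) - G x) (M0 + M0)) => // x.
    by apply: (le_trans (ler_normB _ _)); apply: lerD.
  have is3 : haarm.-integrable F (EFin \o (fun x : HM => s * D3 G x)).
    apply: (@bounded_integrable (fun x => s * D3 G x) (s * M1)); first exact: contZ.
    by move=> x; rewrite normrM gtr0_norm// ler_wpM2l// ltW.
  have E : Rintegral haarm F (fun x => G (ztrans s x) - G x - s * D3 G x) = - (s * J).
    rewrite (RintegralB mF id is3) (RintegralB mF i1 i0) (RintegralZl s mF i3).
    have mG : measurable_fun setT (G : HM -> R) by exact: continuous_HM_measurable.
    by rewrite (ztrans_Rintegral lat s fF mG)// subrr sub0r.
  have : `|s * J| <= s * s * M2 * m.
    rewrite -normrN -E; apply: Rintegral_bound.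
      by apply: contB => //; exact: contZ.
    move=> x; have [t t01 ->] := incr G x s CG.
    rewrite -mulrBr; have [r r01 ->] := incr (D3 G) x (t * s) C3.
    have t0 : `|t| <= 1 by case/andP: t01 => t0 t1; rewrite ger0_norm.
    rewrite !normrM (gtr0_norm s0) -!mulrA; apply: ler_wpM2l; first exact: ltW.
    rewrite mulrCA; apply: ler_wpM2l; first exact: ltW.
    by rewrite -[leRHS]mul1r; apply: ler_pM.
  by rewrite normrM (gtr0_norm s0) -!mulrA ler_pM2l.
apply/eqP; rewrite -normr_eq0; apply/eqP/le_anti/andP; split; last exact: normr_ge0.
apply/ler_addgt0Pl => e e0; rewrite addr0.
have M20 : 0 <= M2 by exact: le_trans (normr_ge0 _) (B2 0).
have d0 : 0 < M2 * m + 1 by rewrite ltr_wpDl// mulr_ge0.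
apply: (le_trans (key (e / (M2 * m + 1)) _)); first by rewrite divr_gt0.
by rewrite mulrAC ler_pdivrMr// ler_wpM2l ?ltW// ltrDl.
Qed.

Definition tint f : R[i] := cintegral F f.

Lemma tintE f : tint f = Rintegral haarm F (re f) +i* Rintegral haarm F (im f).
Proof. by []. Qed.

Lemma re_integrable f : haarm.-integrable F (EFin \o (re f : HM -> R)).
Proof.
have [M _ fM] := testfn_bounded f lat.
apply: (@bounded_integrable (re f) M); first exact: cont_re.
by move=> x; exact: le_trans (Re_le_normc _) (fM x).
Qed.

Lemma im_integrable f : haarm.-integrable F (EFin \o (im f : HM -> R)).
Proof.
have [M _ fM] := testfn_bounded f lat.
apply: (@bounded_integrable (im f) M); first exact: cont_im.
by move=> x; exact: le_trans (Im_le_normc _) (fM x).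
Qed.

Lemma tint_linear : linear (tint : testfn Gamma -> R[i]^o).
Proof.
move=> a f g; rewrite !tintE.
have int2 (G1 G2 : HM -> R) (b c : R) : haarm.-integrable F (EFin \o G1) ->
    haarm.-integrable F (EFin \o G2) ->
    Rintegral haarm F (fun x => b * G1 x + c * G2 x) =
    b * Rintegral haarm F G1 + c * Rintegral haarm F G2 /\
    haarm.-integrable F (EFin \o (fun x => b * G1 x + c * G2 x)).
  move=> i1 i2; have j1 := integrableZl mF b i1; have j2 := integrableZl mF c i2.
  split; last by have := integrableD mF j1 j2.
  by rewrite -(RintegralZl b mF i1) -(RintegralZl c mF i2) -RintegralD.
have [e1 k1] := int2 _ _ (complex.Re a) (- complex.Im a) (re_integrable f) (im_integrable f).
have [e2 k2] := int2 _ _ (complex.Re a) (complex.Im a) (im_integrable f) (re_integrable f).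
have [e3 _] := int2 _ _ 1 1 k1 (re_integrable g).
have [e4 _] := int2 _ _ 1 1 k2 (im_integrable g).
have -> : re (a *: f + g) = fun x => 1 * (complex.Re a * re f x + - complex.Im a * im f x) + 1 * re g x.
  by apply/funext => x; rewrite reD reZ; ring.
have -> : im (a *: f + g) = fun x => 1 * (complex.Re a * im f x + complex.Im a * re f x) + 1 * im g x.
  by apply/funext => x; rewrite imD imZ; ring.
rewrite e3 e4 e1 e2.
set p1 := Rintegral haarm F (re f); set p2 := Rintegral haarm F (im f).
set p3 := Rintegral haarm F (re g); set p4 := Rintegral haarm F (im g).
clearbody p1 p2 p3 p4; case: a {e1 e2 e3 e4 k1 k2} => ar ai.
by congr (_ +i* _); rewrite /=; ring.
Qed.

Lemma tint_vf_e3 f : tint (vf (e3 R) f) = 0.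
Proof.
have [M0 _ B0] := testfn_bounded f lat.
have [M1 _ B1] := testfn_bounded (vf (e3 R) f) lat.
have [M2 _ B2] := testfn_bounded (vf (e3 R) (vf (e3 R) f)) lat.
have r1 (g : testfn Gamma) : re (vf (e3 R) g) = D3 (re g).
  by apply/funext => x; rewrite re_vf lie_e3.
have i1 (g : testfn Gamma) : im (vf (e3 R) g) = D3 (im g).
  by apply/funext => x; rewrite im_vf lie_e3.
rewrite tintE r1 i1.
rewrite (Rintegral_D3 (M0 := M0) (M1 := M1) (M2 := M2) (Cinfty_re f)).
- rewrite (Rintegral_D3 (M0 := M0) (M1 := M1) (M2 := M2) (Cinfty_im f))//.
  + by move=> g p Gg; rewrite /im testfn_inv.
  + by move=> x; exact: le_trans (Im_le_normc _) (B0 x).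
  + by move=> x; rewrite -i1; exact: le_trans (Im_le_normc _) (B1 x).
  + by move=> x; rewrite -!i1; exact: le_trans (Im_le_normc _) (B2 x).
- by move=> g p Gg; rewrite /re testfn_inv.
- by move=> x; exact: le_trans (Re_le_normc _) (B0 x).
- by move=> x; rewrite -r1; exact: le_trans (Re_le_normc _) (B1 x).
- by move=> x; rewrite -!r1; exact: le_trans (Re_le_normc _) (B2 x).
Qed.

End Modes.

Section Products.
Variables (R : realType) (Gamma : set (heis R)).
Implicit Types (f g : testfn Gamma) (x : heis R).

Lemma tmul_subproof f g : (fun x => f x * g x : R[i]^o) \in testpred Gamma.
Proof.
have [[Cr Ci] inv] := testfnP f; have [[Dr Di] inv'] := testfnP g.
rewrite inE; split; last by move=> gm x Gg; rewrite inv// inv'.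
have ReE x : complex.Re (f x * g x) = re f x * re g x + - 1 * (im f x * im g x).
  by rewrite /re /im; case: (f x) (g x) => [a b] [c d] /=; ring.
have ImE x : complex.Im (f x * g x) = re f x * im g x + im f x * re g x.
  by rewrite /re /im; case: (f x) (g x) => [a b] [c d].
split.
- rewrite (_ : (fun x => _) = fun x => re f x * re g x + - 1 * (im f x * im g x)); last exact/funext.
  by apply: CinftyD; apply: CinftyM => //; [exact: Cinfty_cst|exact: CinftyM].
- rewrite (_ : (fun x => _) = fun x => re f x * im g x + im f x * re g x); last exact/funext.
  by apply: CinftyD; exact: CinftyM.
Qed.

Definition tmul f g : testfn Gamma := TestFn (tmul_subproof f g).

Lemma tmulE f g x : tmul f g x = f x * g x. Proof. by []. Qed.

Lemma lie_mul v (F G : heis R -> R) x : Cinfty F -> Cinfty G ->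
  lie v (fun y => F y * G y) x = lie v F x * G x + F x * lie v G x.
Proof.
move=> CF CG; have dF := Cinfty_differentiable CF; have dG := Cinfty_differentiable CG.
have E h : 'D_h (fun y => F y * G y) x = F x * 'D_h G x + G x * 'D_h F x.
  exact: (@deriveM _ _ F G x h (diff_derivable (dF x)) (diff_derivable (dG x))).
have EE : [/\ D1 (fun y => F y * G y) x = F x * D1 G x + G x * D1 F x,
  D2 (fun y => F y * G y) x = F x * D2 G x + G x * D2 F x &
  D3 (fun y => F y * G y) x = F x * D3 G x + G x * D3 F x].
  by rewrite !unlock; split; exact: E.
by rewrite /lie /grad; have [-> -> ->] := EE; ring.
Qed.

Lemma vf_tmul v f g : vf v (tmul f g) = tmul (vf v f) g + tmul f (vf v g).
Proof.
have Cm (F G : heis R -> R) : Cinfty F -> Cinfty G -> Cinfty (fun y => F y * G y).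
  exact: CinftyM.
have [rf jf] := (Cinfty_re f, Cinfty_im f); have [rg jg] := (Cinfty_re g, Cinfty_im g).
have rm (a b : testfn Gamma) x : re (tmul a b) x = re a x * re b x - im a x * im b x.
  by rewrite /re /im tmulE; case: (a x) (b x) => [? ?] [? ?].
have jm (a b : testfn Gamma) x : im (tmul a b) x = re a x * im b x + im a x * re b x.
  by rewrite /re /im tmulE; case: (a x) (b x) => [? ?] [? ?].
apply: testfn_ext2; apply/funext => x.
  rewrite re_vf (reD (tmul _ g)) !rm !re_vf !im_vf.
  rewrite (_ : re (tmul f g) = fun y => 1 * (re f y * re g y) + -1 * (im f y * im g y)); last first.
    by apply/funext => y; rewrite rm; ring.
  rewrite lie_lin; [|exact: Cinfty_differentiable (Cm _ _ _ _)..].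
  by rewrite !lie_mul//; ring.
rewrite im_vf (imD (tmul _ g)) !jm !re_vf !im_vf.
rewrite (_ : im (tmul f g) = fun y => 1 * (re f y * im g y) + 1 * (im f y * re g y)); last first.
  by apply/funext => y; rewrite jm; ring.
rewrite lie_lin; [|exact: Cinfty_differentiable (Cm _ _ _ _)..].
by rewrite !lie_mul//; ring.
Qed.

End Products.

(* [haar] is typed over the Borel structure of [R], [haarm] over that of
   [measurableTypeR R]: the measurable sets are convertible, the integrals are
   not. *)
Lemma integral_HM (R : realType) (F : set (heis R)) (G : heis R -> R) : measurable F ->
  continuous G -> (forall x, 0 <= G x) ->
  (\int[@haar R]_(x in F) (G x)%:E = \int[@haarm R]_(x in F) (G x)%:E)%E.
Proof.
move=> mF cG G0.
pose i (x : measurableTypeR R * measurableTypeR R * measurableTypeR R) : heis R := x.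
have mi : measurable_fun setT i by move=> _ A mA; rewrite setTI.
have := @ge0_integral_pushforward _ _ _ _ _ i mi (@haarm R) F (EFin \o G) mF.
apply.
- by apply/measurable_EFinP; apply: measurable_funTS; exact: continuous_heis_measurable.
- by move=> x _; rewrite /= lee_fin.
Qed.

Section ModeInteger.
Variables (R : realType) (Gamma : set (heis R)).
Hypothesis lat : is_lattice Gamma.
Local Notation HM := (measurableTypeR R * measurableTypeR R * measurableTypeR R)%type.
Local Notation haarm := (@haarm R).
Variable F : set HM.
Hypothesis fF : fundamental_domain Gamma F.
Implicit Types (f : testfn Gamma) (p : HM).

Let sq f (x : HM) : R := normc (f x) ^+ 2.

Let sqE f x : sq f x = re f x * re f x + im f x * im f x.
Proof.
rewrite /sq /re /im; case: (f x) => [a b] /=.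
by rewrite sqr_sqrtr ?addr_ge0 ?sqr_ge0.
Qed.

Lemma continuous_sq f : continuous (sq f : heis R -> R).
Proof.
rewrite (_ : (sq f : heis R -> R) = fun x => re f x * re f x + im f x * im f x).
  apply: contD.
    by apply: contM; exact: cont_re.
  by apply: contM; exact: cont_im.
by apply/funext => x; exact: sqE.
Qed.

Let sq_ge0 f x : 0 <= sq f x. Proof. exact: sqr_ge0. Qed.

Lemma testfn_L2 f : L2 Gamma F f.
Proof.
split.
- by move=> g x Gg; exact: testfn_inv.
- by apply: continuous_HM_measurable; exact: cont_re.
- by apply: continuous_HM_measurable; exact: cont_im.
have [M M0 fM] := testfn_bounded f lat.
have := @bounded_integrable _ _ lat F fF (sq f) (M ^+ 2) (@continuous_sq f).
have h x : `|sq f x| <= M ^+ 2.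
  by rewrite ger0_norm// lerXn2r// ?nnegrE ?normc_ge0'//; exact: fM.
move=> /(_ h) /integrableP[_]; rewrite /sqnorm (integral_HM fF.1 (@continuous_sq f) (sq_ge0 f)).
have -> : (\int[haarm]_(x in F) `|(EFin \o sq f) x| = \int[haarm]_(x in F) (sq f x)%:E)%E.
  by apply: eq_integral => x _; rewrite /= ger0_norm.
exact.
Qed.

(** If the norm vanished, the open set [U], on which the square exceeds d, would be null: countably
    many pieces cover it, each inside one translate of [F], and each is null by unfolding. But [U]
    contains a box of positive volume. *)
Lemma sqnorm_neq0 f : f <> 0 -> sqnorm F f <> 0%E.
Proof.
move=> f0; rewrite /sqnorm (integral_HM fF.1 (@continuous_sq f) (sq_ge0 f)) => S0.
apply: f0; apply: testfn_ext => x; apply: contrapT => fx0.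
have sx0 : 0 < sq f x.
  rewrite exprn_gt0// lt_neqAle normc_ge0' andbT eq_sym.
  by apply/eqP => /normc_eq0.
have [G0 _ _] := lat.
pose d := sq f x / 2; have d0 : 0 < d by rewrite divr_gt0.
pose U : set HM := [set y | d < sq f y].
have mU : measurable U.
  apply: open_heis_measurable.
  have := (@open_comp _ _ (sq f : heis R -> R) [set t | d < t]).
  by apply; [move=> y _; exact: continuous_sq|exact: open_gt].
have [e [eG eS]] := lattice_enum lat.
pose A n : set HM := U `&` (hmul (hinv (e n)) @^-1` F).
have mA n : measurable (A n).
  by apply: measurableI => //; apply: measurable_preimage_hmul; exact: fF.1.
have A0 n : haarm (A n) = 0%E.
  have inj (y z g : HM) : A n y -> A n z -> Gamma g -> y = hmul g z -> y = z.
    move=> [_ Fy] [_ Fz] Gg yz; rewrite -(hmulKV (e n) y) -(hmulKV (e n) z).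
    congr (hmul _ _).
    apply: (fundamental_inj lat fF Fy Fz (g := hmul (hinv (e n)) (hmul g (e n)))).
      apply: lattice_mul => //; first exact: lattice_inv.
      exact: lattice_mul.
    by rewrite yz -!hmulA hmulKV.
  have := unfolding lat (mA n) fF.1 inj (fun y _ => fundamental_cov fF y) (G := EFin \o sq f).
  move=> H.
  have {}H : (\int[haarm]_(p in A n) (sq f p)%:E <= 0)%E.
    rewrite -S0; apply: H.
    - by apply/measurable_EFinP; apply: continuous_HM_measurable; exact: continuous_sq.
    - by move=> y; rewrite lee_fin.
    - by move=> g y Gg; rewrite /= /sq testfn_inv.
  apply/eqP; rewrite -measure_le0.
  have : (\int[haarm]_(p in A n) cst d%:E p <= 0)%E.
    apply: le_trans H; apply: ge0_le_integral => //.
    - by move=> y _; rewrite lee_fin ltW.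
    - apply/measurable_EFinP; apply: measurable_funTS.
      by apply: (@continuous_HM_measurable R (sq f)); exact: (@continuous_sq f).
    - by move=> y [Uy _]; rewrite lee_fin ltW.
  by rewrite integral_cst// pmule_rle0// lte_fin.
have U0 : haarm U = 0%E.
  apply/eqP; rewrite -measure_le0.
  have : (haarm U <= \sum_(0 <= n <oo) haarm (A n))%E.
    apply: measure_sigma_subadditive => // y Uy.
    have [g Gg Fg] := fundamental_cov fF y; have [n en] := eS g Gg.
    by exists n => //; split=> //; rewrite en.
  by rewrite eseries0// => n _ _; exact: A0.
have : nbhs (x : heis R) (U : set (heis R)).
  have oU : open (U : set (heis R)).
    by apply: (@open_comp _ _ (sq f : heis R -> R) [set t | d < t]);
      [move=> y _; exact: continuous_sq|exact: open_gt].
  apply: open_nbhs_nbhs; split=> //; rewrite /U /= /d ltr_pdivrMr//; lra.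
move=> /nbhs_ballP[r /= r0 rU].
pose I (a : R) : set (measurableTypeR R) := `]a - r, a + r[%classic.
have mI a : measurable (I a) by exact: measurable_itv.
have lI a : lebesgue_measure (I a) = (2 * r)%:E.
  rewrite lebesgue_measure_itv /= lte_fin ifT; last by lra.
  by rewrite -EFinB; congr (_%:E); ring.
have : (haarm ((I x.1.1 `*` I x.1.2) `*` I x.2) <= haarm U)%E.
  apply: le_measure; rewrite ?inE//.
    by apply: measurableX => //; exact: measurableX.
  move=> y [[I1 I2] I3]; apply: rU.
  have b (s t : R) : I s t -> ball s r t.
    rewrite /I /= in_itv/= => /andP[st ts].
    by rewrite /ball /= ltr_norml; apply/andP; split; lra.
  by split; [split|]; exact: b.
rewrite U0 haar_cube// !lI -!EFinM lee_fin leNgt; apply/negP; rewrite negbK.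
by rewrite !mulr_gt0.
Qed.

(** The integral of a central derivative vanishes, so Leibniz moves the field from [phi] to [f]; the
    sign this costs is the one in [dvfield]. *)
Lemma dist_of_fun_central (c nu : R) f : vf (0, 0, c) f = ('i%C * nu%:C) *: f ->
  dvfield (0, 0, c) (@dist_of_fun _ Gamma F f) = ('i%C * nu%:C) *: @dist_of_fun _ Gamma F f.
Proof.
move=> vff; apply/funext => phi.
have lt := tint_linear lat fF.
have tD (a b : testfn Gamma) : tint F (a + b) = tint F a + tint F b.
  by have := lt 1 a b; rewrite !scale1r.
have t0 : tint F (0 : testfn Gamma) = 0.
  have := tD 0 0; rewrite addr0 => /eqP.
  by rewrite -[X in X == _]addr0 (inj_eq (addrI _)) eq_sym => /eqP.
have tZ a (b : testfn Gamma) : tint F (a *: b) = a * tint F b.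
  by have := lt a b 0; rewrite !addr0 t0 addr0.
have E : tint F (vf (0, 0, c) (tmul f phi)) = 0.
  by rewrite vf_e3Z tZ (tint_vf_e3 lat fF) mulr0.
rewrite /dvfield vfieldE.
change (- tint F (tmul f (vf (0, 0, c) phi)) = ('i%C * nu%:C) * tint F (tmul f phi)).
rewrite vf_tmul tD vff in E.
have tm : tmul (('i%C * nu%:C) *: f) phi = ('i%C * nu%:C) *: tmul f phi.
  by apply: testfn_ext => x; rewrite testfnZ !tmulE testfnZ mulrA.
rewrite tm tZ in E.
by apply/eqP; rewrite eq_sym -subr_eq0 opprK E.
Qed.

End ModeInteger.

(** A smooth eigenfunction is one in L^2 in the sense of distributions, so its eigenvalue lies in
    the prescribed spectrum. *)
Lemma mode_integer (R : realType) (Gamma : set (heis R)) (c nu : R) (f : testfn Gamma) :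
  is_lattice Gamma -> normalized Gamma (0, 0, c) -> f <> 0 ->
  vf (0, 0, c) f = ('i%C * nu%:C) *: f -> exists z : int, nu = z%:~R.
Proof.
move=> lat [F [fF specE _]] f0 vff.
have : [set mu | exists2 f, L2_eigenspace Gamma F (0, 0, c) mu f & sqnorm F f <> 0%E]
    ('i%C * nu%:C).
  exists (f : heis R -> R[i]^o); last exact: (sqnorm_neq0 lat fF).
  split; first exact: testfn_L2.
  exact: dist_of_fun_central.
rewrite specE => -[z _ zE]; exists z.
have i0 : ('i%C : R[i]) != 0 by exact: neq0Ci.
have := mulfI i0 zE; rewrite -(rmorph_int (real_complex R)) => /complexI.
by move->.
Qed.

(** * Bases of Jordan type *)

Section Lowering.
Variables (K : fieldType) (V : lmodType K) (I : finType) (L : {linear V -> V}).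
Variables (P : V -> Prop) (d : I -> V) (e : nat -> I -> V) (a : nat -> K).
Hypotheses (P0 : P 0) (PB : forall b u v, P u -> P v -> P (b *: u + v)).
Hypotheses (PL : forall v, P v -> P (L v)) (Pe : forall k i, P (e k i)).
Hypotheses (a0 : forall k, a k != 0) (Le : forall k i, iter k L (e k i) = a k *: d i).
Hypothesis Ld : forall i, L (d i) = 0.
Hypothesis dP : forall v, P v -> L v = 0 ->
  exists! c : {ffun I -> K}, v = \sum_i c i *: d i.

Lemma iter_linear n : linear (iter n L).
Proof. by elim: n => [|n IH] b u v //=; rewrite IH linearP. Qed.

Lemma iter0l n : iter n L 0 = 0.
Proof. by elim: n => //= n ->; rewrite linear0. Qed.

Lemma iterDl n u v : iter n L (u + v) = iter n L u + iter n L v.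
Proof. by have := iter_linear n 1 u v; rewrite !scale1r. Qed.

Lemma iterZl n b u : iter n L (b *: u) = b *: iter n L u.
Proof. by have := iter_linear n b u 0; rewrite iter0l !addr0. Qed.

Lemma iter_sum n (J : finType) (F : J -> V) :
  iter n L (\sum_j F j) = \sum_j iter n L (F j).
Proof. exact: (big_morph _ (iterDl n) (iter0l n)). Qed.

Lemma iter_lowered k n i : (k < n)%N -> iter n L (e k i) = 0.
Proof.
move=> kn; rewrite -(subnK kn) iterD iterS Le linearZ /= Ld scaler0; exact: iter0l.
Qed.

Lemma iter_comb n (c : nat -> I -> K) :
  iter n L (\sum_(k < n) \sum_i c k i *: e k i) = 0.
Proof.
rewrite iter_sum big1// => k _; rewrite iter_sum big1// => i _.
by rewrite iterZl iter_lowered// scaler0.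
Qed.

Lemma d_free (c : I -> K) : \sum_i c i *: d i = 0 -> forall i, c i = 0.
Proof.
move=> c0 i; have [c' [_ u]] := dP P0 (linear0 L).
have E1 : c' = [ffun=> 0] by apply: u; rewrite big1// => j _; rewrite ffunE scale0r.
have E2 : c' = finfun c.
  by apply: u; rewrite -[LHS]c0; apply: eq_bigr => j _; rewrite ffunE.
by have := congr1 (fun f : {ffun I -> K} => f i) E2; rewrite E1 !ffunE.
Qed.

(** The power n of [L] kills the layers below n and sends layer n to nonzero multiples of the
    independent vectors [d i], so the top coefficients vanish first. *)
Lemma lowered_free n (c : nat -> I -> K) :
  \sum_(k < n) \sum_i c k i *: e k i = 0 -> forall k i, (k < n)%N -> c k i = 0.
Proof.
elim: n => // n IH; rewrite big_ord_recr /= => S0.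
have cn i : c n i = 0.
  have : iter n L (\sum_i c n i *: e n i) = 0.
    by have := congr1 (iter n L) S0; rewrite iterDl iter_comb add0r iter0l.
  rewrite iter_sum => T0; apply/(mulIf (a0 n)); rewrite mul0r.
  apply: (d_free (c := fun i => c n i * a n)) i; rewrite -[RHS]T0.
  by apply: eq_bigr => i _; rewrite iterZl Le scalerA.
move=> k i; rewrite ltnS leq_eqVlt => /predU1P[->//|kn].
apply: IH => //; rewrite -[RHS]S0 [X in _ + X]big1 ?addr0// => j _.
by rewrite cn scale0r.
Qed.

(** The image of [v] under the power n of [L] lies in the kernel of [L]. A combination of layer n
    with the same image is subtracted, and the rest is killed by a lower power. *)
Lemma lowered_span n v : P v -> iter n L v = 0 ->
  exists c : nat -> I -> K, v = \sum_(k < n) \sum_i c k i *: e k i.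
Proof.
elim: n v => [|n IH] v Pv Lv.
  by exists (fun _ _ => 0); rewrite big_ord0.
have PLn : P (iter n L v) by elim: (n) => //= m; exact: PL.
have [b [bE _]] := dP PLn Lv.
have Ps : P (\sum_i (- (b i / a n)) *: e n i).
  apply: (big_ind P) => // [u w Pu Pw|i _].
    by rewrite -[u]scale1r; exact: PB.
  by rewrite -[_ *: _]addr0; exact: PB.
have [||c cE] := IH (v + \sum_i (- (b i / a n)) *: e n i).
- by rewrite -[v]scale1r; exact: PB.
- rewrite iterDl iter_sum bE -big_split big1// => i _ /=.
  by rewrite iterZl Le scalerA mulNr divfK// scaleNr subrr.
exists (fun k i => if (k < n)%N then c k i else b i / a n).
rewrite big_ord_recr /= ltnn.
under eq_bigr => k _ do rewrite ltn_ord.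
rewrite -cE -addrA -big_split big1 ?addr0// => i _ /=.
by rewrite scaleNr addNr.
Qed.

(** Of the vectors [e k i] only the image under the power k of [L] is prescribed, so the statement
    applies to the eigenvectors [Yk] and to the modified vectors [Dk] alike. *)
Lemma lowered_basis n v : P v -> iter n L v = 0 ->
  exists! c : {ffun 'I_n * I -> K}, v = \sum_q c q *: e q.1 q.2.
Proof.
have pairE (c : nat -> I -> K) :
    \sum_(k < n) \sum_i c k i *: e k i = \sum_(q : 'I_n * I) c q.1 q.2 *: e q.1 q.2.
  by rewrite (pair_bigA _ (fun (k : 'I_n) i => c k i *: e k i)).
move=> Pv Lv; have [c cE] := lowered_span Pv Lv.
exists [ffun q : 'I_n * I => c q.1 q.2]; split.
  by rewrite cE pairE; apply: eq_bigr => q _; rewrite ffunE.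
move=> c' cE'; apply/ffunP => -[k i]; rewrite ffunE /=.
pose c2 (m : nat) j := if insub m is Some m' then c' (m', j) else 0.
have c2E (m : 'I_n) j : c2 m j = c' (m, j) by rewrite /c2 valK.
have := @lowered_free n (fun m j => c m j - c2 m j) _ k i (ltn_ord k).
rewrite c2E => H; apply/eqP; rewrite -subr_eq0; apply/eqP; apply: H.
under eq_bigr => m _ do under eq_bigr => j _ do rewrite scalerBl.
under eq_bigr => m _ do rewrite sumrB.
rewrite sumrB -cE pairE {}cE'; apply/eqP; rewrite subr_eq0; apply/eqP.
by apply: eq_bigr => -[m j] _; rewrite c2E.
Qed.

End Lowering.

(** * Fields and push-forward on distributions *)

Section DistributionAlgebra.
Variables (R : realType) (Gamma : set (heis R)).
Local Notation dist := (testfn Gamma -> R[i]^o).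
Implicit Types (D E : dist) (f : testfn Gamma) (v : heis R).

Lemma dvfield_linear v : linear (@dvfield R Gamma v).
Proof.
by move=> a D E; apply/funext => f; rewrite /dvfield /= opprD scalerN.
Qed.

HB.instance Definition _ v := GRing.isLinear.Build R[i] dist dist *:%R
  (@dvfield R Gamma v) (@dvfield_linear v).

Lemma distributions_comb (b : R[i]) D E : is_lattice Gamma ->
  distributions D -> distributions E -> distributions (b *: D + E).
Proof.
move=> lat /(distP _ lat)[lD [C [W [C0 H]]]] /(distP _ lat)[lE [C' [W' [C0' H']]]].
apply/(distP _ lat); split=> [a f g|].
  change (b * D (a *: f + g) + E (a *: f + g) = a * (b * D f + E f) + (b * D g + E g)).
  rewrite lD lE.
  change (b * (a * D f + D g) + (a * E f + E g) = a * (b * D f + E f) + (b * D g + E g)).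
  by ring.
have B0 : 0 <= normc b by exact: normc_ge0'.
exists (normc b * C + C'), (W ++ W'); split; first by rewrite addr_ge0// mulr_ge0.
move=> f; apply: (le_trans (le_normcD _ _)); rewrite ComplexField.Normc.normcM.
have S0 V : 0 <= \sum_(w <- V) seminorm w f.
  by apply: sumr_ge0 => w _; exact: seminorm_ge0.
rewrite big_cat /= mulrDl; apply: lerD.
  rewrite -mulrA ler_wpM2l//; apply: (le_trans (H f)).
  by rewrite ler_wpM2l// lerDl.
by apply: (le_trans (H' f)); rewrite ler_wpM2l// lerDr.
Qed.

Variable Phi : nil_automorphism Gamma.

Lemma push_linear : linear (@push_dist R Gamma Phi).
Proof. by []. Qed.

HB.instance Definition _ := GRing.isLinear.Build R[i] dist dist *:%R
  (@push_dist R Gamma Phi) push_linear.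

Lemma push_dvfield v (a : R) D : linear D -> pushes_vfield Phi v a ->
  push_dist Phi (dvfield v D) = a%:C *: dvfield v (push_dist Phi D).
Proof.
move=> lD pv; have [l lE] := linear_pack lD.
by apply/funext => f; rewrite /push_dist /dvfield /= pv lE linearZ /= scalerN.
Qed.

Variables X Y Z : heis R.
Hypothesis frame : heisenberg_frame Gamma X Y Z.

(** Duality reverses the order of composition, and the sign in [dvfield] compensates: distributions
    carry the same bracket [X, Y] = Z as test functions. *)
Lemma dvfield_XY D : linear D ->
  dvfield X (dvfield Y D) = dvfield Y (dvfield X D) + dvfield Z D.
Proof.
move=> lD; have [l lE] := linear_pack lD; have [_ XY _ _] := frame.
apply/funext => f.
have -> : (dvfield Y (dvfield X D) + dvfield Z D) f = - - D (vfield X (vfield Y f)) - D (vfield Z f).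
  by [].
by rewrite -XY lE linearB /= opprB opprK addrC subrK /dvfield opprK.
Qed.

Lemma dvfield_XZ D : dvfield X (dvfield Z D) = dvfield Z (dvfield X D).
Proof. by have [_ _ XZ _] := frame; apply/funext => f; rewrite /dvfield /= XZ. Qed.

Lemma dvfield_YZ D : dvfield Y (dvfield Z D) = dvfield Z (dvfield Y D).
Proof. by have [_ _ _ YZ] := frame; apply/funext => f; rewrite /dvfield /= YZ. Qed.

Lemma Z_mode_dvX z D : Z_mode Z z D -> Z_mode Z z (dvfield X D).
Proof. by move=> ZD; rewrite /Z_mode /= -dvfield_XZ ZD linearZ. Qed.

Lemma Z_mode_dvY z D : Z_mode Z z D -> Z_mode Z z (dvfield Y D).
Proof. by move=> ZD; rewrite /Z_mode /= -dvfield_YZ ZD linearZ. Qed.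

Lemma iter_dist v k D : distributions D -> distributions (iter k (dvfield v) D).
Proof. by move=> dD; elim: k => //= k; exact: dist_vf. Qed.

Lemma Z_mode_iterY z k D : Z_mode Z z D -> Z_mode Z z (iter k (dvfield Y) D).
Proof. by move=> ZD; elim: k => //= k; exact: Z_mode_dvY. Qed.

Section Lower.
Variables (z : int) (D : dist).
Hypotheses (dD : distributions D) (ZD : Z_mode Z z D) (XD : dvfield X D = 0).
Let zeta : R[i] := 'i%C * z%:~R.

Lemma dvX_iterY k :
  dvfield X (iter k.+1 (dvfield Y) D) = (k.+1%:R * zeta) *: iter k (dvfield Y) D.
Proof.
elim: k => [|k IH].
  by rewrite /= dvfield_XY ?XD ?linear0 ?add0r ?mul1r; [exact: ZD|exact: dist_linear].
rewrite iterS dvfield_XY; last exact: dist_linear (iter_dist _ _ dD).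
rewrite IH linearZ /= (Z_mode_iterY k.+1 ZD) -scalerDl; congr (_ *: _).
by rewrite -[k.+2%:R]natr1 mulrDl mul1r.
Qed.

Lemma iterX_iterY k :
  iter k (dvfield X) (iter k (dvfield Y) D) = (k`!%:R * zeta ^+ k) *: D.
Proof.
elim: k => [|k IH]; first by rewrite /= mul1r scale1r.
rewrite iterSr dvX_iterY iterZl IH scalerA; congr (_ *: _).
by rewrite factS natrM exprS mulrACA.
Qed.

End Lower.

Variable lambda : R.
Hypothesis pY : pushes_vfield Phi Y lambda^-1.

Lemma push_iterY k D : distributions D -> push_dist Phi (iter k (dvfield Y) D) =
  ((lambda^-1 ^+ k)%:C) *: iter k (dvfield Y) (push_dist Phi D).
Proof.
move=> dD; elim: k => [|k IH]; first by rewrite /= expr0 scale1r.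
rewrite iterS (push_dvfield _ pY); last exact: dist_linear (iter_dist _ _ dD).
by rewrite IH linearZ /= scalerA -rmorphM exprS.
Qed.

End DistributionAlgebra.

Lemma powR_resonance (R : realType) (lambda : R) k : 0 < lambda ->
  lambda `^ (- k%:R - 2^-1) = lambda^-1 ^+ k * lambda `^ (- 2^-1).
Proof.
move=> l0; rewrite powRD; last by rewrite (gt_eqF l0) implybT.
by rewrite powRN powR_mulrn ?exprVn// ltW.
Qed.

(** The constant comes from splitting u lambda^(-3/2) Y D + u lambda^(-1/2) D as u lambda^(-3/2) (Y
    D + D) + (1 - lambda^-1) u lambda^(-1/2) D. *)
Definition jordan_coef (R : realType) (k j : nat) (lambda : R) : R[i] :=
  if (k == 1%N) && (j == 0%N) then (1 - lambda^-1)%:C else 0.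

Section JordanBasis.
Variables (R : realType) (Gamma : set (heis R)) (Phi : nil_automorphism Gamma).
Variables (X Y Z : heis R) (lambda : R).
Local Notation dist := (testfn Gamma -> R[i]^o).
Hypotheses (lat : is_lattice Gamma) (frame : heisenberg_frame Gamma X Y Z).
Hypotheses (lambda1 : 1 < lambda) (pY : pushes_vfield Phi Y lambda^-1).
Variables (z : int) (I : finType) (u : I -> R[i]) (D : I -> dist).
Hypotheses (z0 : z != 0) (basisD : is_basis (inv_dist X 1 `&` Z_mode Z z) D).
Hypothesis pushD : forall i, push_dist Phi (D i) = (u i * (lambda `^ (- 2^-1))%:C) *: D i.

Let lambda0 : 0 < lambda. Proof. exact: lt_trans ltr01 lambda1. Qed.

Let zeta : R[i] := 'i%C * z%:~R.

Let zeta0 : zeta != 0.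
Proof. by rewrite mulf_neq0 ?intr_eq0// neq0Ci. Qed.

Let dD i : distributions (D i). Proof. by have [/(_ i)[[]]] := basisD. Qed.
Let XD i : dvfield X (D i) = 0. Proof. by have [/(_ i)[[]]] := basisD. Qed.
Let ZD i : Z_mode Z z (D i). Proof. by have [/(_ i)[]] := basisD. Qed.

Let P (E : dist) := distributions E /\ Z_mode Z z E.

Let P0 : P 0.
Proof.
split; last by rewrite /Z_mode /= linear0 scaler0.
apply/(distP _ lat); split=> [a f g|]; first by rewrite scaler0 addr0.
exists 0, [::]; split=> // f; rewrite mul0r /=.
by rewrite expr0n addr0 sqrtr0.
Qed.

Let PB b E F : P E -> P F -> P (b *: E + F).
Proof.
move=> [dE ZE] [dF ZF]; split; last first.
  by rewrite /Z_mode /= linearP /= ZE ZF !scalerDr !scalerA (mulrC b).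
exact: distributions_comb.
Qed.

(** A perturbation [w k i] killed by the power k of [X] does not change the image of the k-th vector
    under that power, which is all that [lowered_basis] looks at. *)
Lemma Y_lowered_basis (e : nat -> I -> dist) (w : nat -> I -> dist) K :
  (forall k i, e k i = iter k (dvfield Y) (D i) + w k i) ->
  (forall k i, P (w k i) /\ iter k (dvfield X) (w k i) = 0) ->
  is_basis (inv_dist X K `&` Z_mode Z z) (fun ki : 'I_K * I => e ki.1 ki.2).
Proof.
move=> eE wP.
have Pe k i : P (e k i).
  have [Pw _] := wP k i; rewrite eE -[iter _ _ _]scale1r; apply: PB => //.
  by split; [exact: iter_dist|exact: (Z_mode_iterY frame)].
have Le k i : iter k (dvfield X) (e k i) = (k`!%:R * zeta ^+ k) *: D i.
  have [_ Xw] := wP k i.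
  by rewrite eE iterDl Xw addr0 (iterX_iterY frame (dD i) (ZD i) (XD i)).
have a0 k : k`!%:R * zeta ^+ k != 0.
  by rewrite mulf_neq0 ?expf_neq0// pnatr_eq0 -lt0n fact_gt0.
split=> [[k i]|E [[dE XE] ZE]].
  have [dk Zk] := Pe k i; split=> //; split=> //=.
  exact: (iter_lowered Le XD).
apply: (lowered_basis P0 PB _ Pe a0 Le XD _ (conj dE ZE) XE).
- by move=> v [dv Zv]; split; [exact: dist_vf|exact: (Z_mode_dvX frame)].
- by move=> v [dv Zv] Xv; have [_ h] := basisD; exact: h.
Qed.

Definition Yk k i : dist := iter k (dvfield Y) (D i).

Lemma Yk_basis K :
  is_basis (inv_dist X K `&` Z_mode Z z) (fun ki : 'I_K * I => Yk ki.1 ki.2).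
Proof.
apply: (@Y_lowered_basis Yk (fun _ _ => 0)) => k i; first by rewrite addr0.
by split=> //; exact: iter0l.
Qed.

Lemma push_Yk k i : push_dist Phi (Yk k i) =
  (u i * (lambda `^ (- k%:R - 2^-1))%:C) *: Yk k i.
Proof.
rewrite /Yk (push_iterY pY k (dD i)) pushD iterZl scalerA powR_resonance//.
by congr (_ *: _); rewrite rmorphM mulrCA.
Qed.

Lemma Yk_neq0 k i : Yk k i <> 0.
Proof.
move=> Y0; have [_ h] := Yk_basis k.+1.
have [|c [_ cu]] := h 0; first by have [d0 Z0] := P0; split=> //; split=> //; exact: iter0l.
pose q : 'I_k.+1 * I := (ord_max, i).
have E1 : c = [ffun=> 0] by apply: cu; rewrite big1// => j _; rewrite ffunE scale0r.
have E2 : c = [ffun p => (p == q)%:R].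
  apply: cu; rewrite (bigD1 q)//= ffunE eqxx scale1r Y0 big1 ?addr0// => j jq.
  by rewrite ffunE (negbTE jq) scale0r.
have := congr1 (fun f : {ffun 'I_k.+1 * I -> R[i]} => f q) E2.
by rewrite E1 !ffunE eqxx => /eqP; rewrite eq_sym oner_eq0.
Qed.

Lemma Yk_inv_dist k i : inv_dist_oo X (Yk k i).
Proof.
have [h _] := Yk_basis k.+1.
by exists k.+1 => //; have [] := h (ord_max, i).
Qed.

Lemma Yk_eigenstate k i : ruelle_eigenstate Phi X (Yk k i).
Proof.
split; [exact: Yk_inv_dist|exact: Yk_neq0|].
by exists (u i * (lambda `^ (- k%:R - 2^-1))%:C), 1%N => /=; rewrite push_Yk subrr.
Qed.

Lemma Yk_resonance k i : ruelle_resonance Phi X (u i * (lambda `^ (- k%:R - 2^-1))%:C).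
Proof. by exists (Yk k i); split; [exact: Yk_inv_dist|exact: Yk_neq0|exact: push_Yk]. Qed.

Lemma mode_resonance K (mu : R[i]) E : inv_dist X K E -> Z_mode Z z E -> E <> 0 ->
  push_dist Phi E = mu *: E ->
  exists i k, mu = u i * (lambda `^ (- k%:R - 2^-1))%:C.
Proof.
move=> XE ZE E0 pE; have [_ h] := Yk_basis K.
have [a [aE au]] := h E (conj XE ZE).
have [q aq] : exists q, a q != 0.
  apply: contrapT => /forallNP a0; apply: E0; rewrite aE big1// => q _.
  by have /negP := a0 q; rewrite negbK => /eqP ->; rewrite scale0r.
pose nu (q : 'I_K * I) := u q.2 * (lambda `^ (- (q.1 : nat)%:R - 2^-1))%:C.
exists q.2, (q.1 : nat); rewrite -/(nu q).
(* Because [E] is an eigenvector, adding (nu - mu) a to its coordinates a gives coordinates of [E]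
   again. Uniqueness makes the added terms vanish, so nu q = mu wherever a q is nonzero. *)
have S0 : a = [ffun p => a p + (nu p - mu) * a p].
  apply: au; rewrite [LHS]aE; under [RHS]eq_bigr do rewrite ffunE scalerDl.
  rewrite big_split /= -[LHS]addr0; congr (_ + _).
  under eq_bigr do rewrite mulrBl scalerBl.
  rewrite sumrB; apply/esym/eqP; rewrite subr_eq0; apply/eqP.
  transitivity (push_dist Phi E).
    rewrite [in RHS]aE linear_sum; apply: eq_bigr => p _.
    by rewrite linearZ /= push_Yk scalerA mulrC.
  by rewrite pE [in LHS]aE scaler_sumr; apply: eq_bigr => p _; rewrite scalerA.
have := congr1 (fun f : {ffun 'I_K * I -> R[i]} => f q) S0.
rewrite ffunE => /eqP; rewrite -subr_eq0 opprD addNKr oppr_eq0 mulf_eq0 (negbTE aq) orbF.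
by rewrite subr_eq0 => /eqP ->.
Qed.

(* Adding the eigenvector [D i] to the eigenvector [Y (D i)] makes the matrix of
   [push_dist Phi] triangular but not diagonal. *)
Definition Dk k i : dist := Yk k i + (if k == 1%N then D i else 0).

Lemma Dk_basis K :
  is_basis (inv_dist X K `&` Z_mode Z z) (fun ki : 'I_K * I => Dk ki.1 ki.2).
Proof.
apply: (@Y_lowered_basis Dk (fun k i => if k == 1%N then D i else 0)) => // k i.
case: eqP => [->|_]; first by split=> //=; split.
by split=> //; exact: iter0l.
Qed.

Lemma Dk_span k i : ruelle_eigenstate_span Phi X (Dk k i).
Proof.
rewrite /Dk; case: eqP => [->|_].
  exists 2%N, (fun j : 'I_2 => if j == ord0 then Yk 1 i else Yk 0 i); split.
    by move=> j; case: ifP => _; exact: Yk_eigenstate.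
  by rewrite big_ord_recl big_ord1.
exists 1%N, (fun=> Yk k i); split=> [_|]; first exact: Yk_eigenstate.
by rewrite big_ord1 addr0.
Qed.

Lemma push_Dk k i :
  push_dist Phi (Dk k i) = (u i * (lambda `^ (- k%:R - 2^-1))%:C) *: Dk k i +
    \sum_(j < k) (jordan_coef k j lambda * u i * (lambda `^ (- j%:R - 2^-1))%:C) *: Dk j i.
Proof.
rewrite /jordan_coef; have [->|k1] := eqVneq k 1%N; last first.
  rewrite big1 => [|j _]; last by rewrite !mul0r scale0r.
  by rewrite addr0 /Dk (negbTE k1) addr0 push_Yk.
have D1 : Dk 1 i = Yk 1 i + D i by [].
have D0 : Dk 0 i = D i by rewrite /Dk /Yk addr0.
have pD : push_dist Phi (Yk 1 i + D i) = push_dist Phi (Yk 1 i) + push_dist Phi (D i).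
  by [].
rewrite big_ord1 /nat_of_ord D0 D1 pD push_Yk pushD scalerDr -addrA.
congr (_ + _); rewrite -scalerDl; congr (_ *: _).
rewrite !powR_resonance// expr1 expr0 mul1r rmorphB rmorph1 rmorphM /=.
ring.
Qed.

End JordanBasis.

(** * Resonances *)

Section Resonances.
Variables (R : realType) (Gamma : set (heis R)) (Phi : nil_automorphism Gamma).
Local Notation dist := (testfn Gamma -> R[i]^o).
Hypothesis lat : is_lattice Gamma.
Variables (X Y : heis R) (c lambda : R).
Hypotheses (c0 : c != 0) (XYc : omega X Y = c) (lambda1 : 1 < lambda).
Hypotheses (dX : daut Phi X = lambda *: X) (dY : daut Phi Y = lambda^-1 *: Y).
Hypothesis dZ : daut Phi (0, 0, c) = (0, 0, c).
Variables g1 g2 : heis R.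
Hypotheses (G1 : Gamma g1) (G2 : Gamma g2) (g12 : omega g1 g2 != 0).
Implicit Types (D E : dist) (f g : testfn Gamma).

Let tau := omega g1 g2.
Let v1 := hlog g1.
Let v2 := hlog g2.

Let Gw : Gamma (0, 0, tau). Proof. exact: lattice_commutator. Qed.

Let Gv1 : Gamma (hexp v1 1). Proof. by rewrite hlogK. Qed.

Let Gv2 : Gamma (hexp v2 1). Proof. by rewrite hlogK. Qed.

Let e3E t : (0, 0, t) = t *: e3 R.
Proof. by rewrite /e3; congr (_, _, _); rewrite /= /GRing.scale/= ?mulr0 ?mulr1. Qed.

Let span12 w : exists a b t : R, w = a *: v1 + b *: v2 + t *: e3 R.
Proof.
have o12 : omega v1 v2 = tau by [].
have := frame_coord w g12 o12; rewrite e3E scalerA => wE.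
by do 3 eexists; exact: wE.
Qed.

(** For large n the argument has absolute value below pi, where the cosine is injective on
    nonnegative numbers. *)
Lemma cos_scaled_eq1 (b : R) : (forall n, cos (lambda^-1 ^+ n * b) = 1) -> b = 0.
Proof.
move=> cb; have l0 : 0 < lambda by exact: lt_trans ltr01 lambda1.
have q1 : `|lambda^-1| < 1 by rewrite gtr0_norm ?invr_gt0// invf_lt1.
have qb : lambda^-1 ^+ n * b @[n --> \oo] --> (0 * b).
  by apply: cvgMl; exact: cvg_expr.
have [n _ /(_ n (leqnn n)) nb] : \forall n \near \oo, `|lambda^-1 ^+ n * b| < pi.
  rewrite mul0r in qb; move/cvgr0Pnorm_lt : qb; apply; exact: pi_gt0.
have : `|lambda^-1 ^+ n * b| = 0.
  apply: cos_inj.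
  - by rewrite in_itv /= normr_ge0 ltW.
  - by rewrite in_itv /= lexx pi_ge0.
  - by rewrite cos_norm cos0 cb.
move/eqP; rewrite normr_eq0 mulf_eq0 expf_eq0 invr_eq0 (gt_eqF l0) andbF /=.
by move/eqP.
Qed.

Lemma invariant_of_eigen E (k : nat) (f1 f2 : R) : linear E -> E <> 0 ->
  (forall g, E (vf (e3 R) g) = 0) -> iter k (dvfield X) E = 0 ->
  (forall g, E (vf v1 g) = ('i%C * f1%:C) * E g) ->
  (forall g, E (vf v2 g) = ('i%C * f2%:C) * E g) ->
  forall w g, E (vf w g) = 0.
Proof.
move=> lE E0 E3 XE E1 E2; have [l lE'] := linear_pack lE.
have ED f g : E (f + g) = E f + E g by rewrite lE' linearD.
have EZ (a : R) f : E (a%:C *: f) = a%:C * E f by rewrite lE' linearZ.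
have eig w : exists t : R, forall g, E (vf w g) = ('i%C * t%:C) * E g.
  have [a [b [t ->]]] := span12 w; exists (a * f1 + b * f2) => g.
  rewrite !vfD !vfZ !ED !EZ E1 E2 E3 mulr0 addr0 rmorphD !rmorphM /=; ring.
have [f Ef] : exists f, E f <> 0.
  by apply: contrapT => /forallNP H; apply: E0; apply/funext => f; exact: contrapT (H f).
have EX g : E (vf X g) = 0.
  have [t tE] := eig X; rewrite tE; suff -> : t = 0 by rewrite mulr0 mul0r.
  (* [X] acts on [E] by a scalar, and a scalar with a vanishing power is zero. *)
  have XkE m : iter m (dvfield X) E = (- ('i%C * t%:C)) ^+ m *: E.
    elim: m => [|m IH]; first by rewrite expr0 scale1r.
    rewrite iterS IH linearZ /= exprSr -scalerA; congr (_ *: _).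
    by apply/funext => h; rewrite /dvfield vfieldE tE -mulNr.
  have := congr1 (fun F : dist => F f) XE; rewrite XkE => /eqP.
  rewrite (_ : (_ *: E) f = (- ('i%C * t%:C)) ^+ k * E f)// (_ : (0 : dist) f = 0)//.
  rewrite mulf_eq0 (introF eqP Ef) orbF expf_eq0 oppr_eq0 mulf_eq0.
  rewrite (negbTE (neq0Ci _)) /= => /andP[_ /eqP/(congr1 (@complex.Re R))] //.
have [b bE] := eig Y.
have decomp w g : E (vf w g) = ('i%C * (omega X w / c * b)%:C) * E g.
  rewrite {1}(frame_coord w c0 XYc) e3E scalerA.
  rewrite !vfD !vfZ !ED !EZ EX E3 bE !mulr0 add0r addr0 rmorphM /=; ring.
have b0 gm : Gamma gm -> omega X gm * b = 0.
  move=> Ggm.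
  suff : omega X gm / c * b = 0.
    move/eqP; rewrite mulrAC mulf_eq0 invr_eq0 (negbTE c0) orbF => /eqP //.
  apply: cos_scaled_eq1 => n.
  have Gn := iter_aut_lattice Phi n Ggm.
  rewrite !mulrA -(omega_iter_aut gm n c0 XYc dX dY dZ).
  have Gh : Gamma (hexp (hlog (iter n Phi gm)) 1) by rewrite hlogK.
  exact: (cos_eigen g12 Gw lE E3 (decomp (hlog (iter n Phi gm))) Gh E0).
(* Otherwise [omega X] would vanish on [g1] and [g2], which are independent modulo the centre; [X]
   would then be central, against [c != 0]. *)
have bz : b = 0.
  have := b0 _ G1; have := b0 _ G2; move: g12 c0; rewrite -XYc /omega.
  case: (X) (Y) (g1) (g2) => [[x1 x2] ?] [[y1 y2] ?] [[a1 a2] ?] [[d1 d2] ?] /=.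
  move=> t0 cc h2 h1; apply/eqP; apply: contraNT cc => bn.
  have e1 : x1 * a2 - x2 * a1 = 0 by apply/(mulIf bn); rewrite h1 mul0r.
  have e2 : x1 * d2 - x2 * d1 = 0 by apply/(mulIf bn); rewrite h2 mul0r.
  have x10 : x1 = 0.
    apply/(mulIf t0); rewrite mul0r.
    have -> : x1 * (a1 * d2 - a2 * d1) = a1 * (x1 * d2 - x2 * d1) - d1 * (x1 * a2 - x2 * a1) by ring.
    by rewrite e1 e2 !mulr0 subr0.
  have x20 : x2 = 0.
    apply/(mulIf t0); rewrite mul0r.
    have -> : x2 * (a1 * d2 - a2 * d1) = a2 * (x1 * d2 - x2 * d1) - d2 * (x1 * a2 - x2 * a1) by ring.
    by rewrite e1 e2 !mulr0 subr0.
  by rewrite x10 x20 !mul0r subr0.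
by move=> w g; rewrite decomp bz mulr0 mulr0 mul0r.
Qed.

Lemma zero_mode_resonance D (k : nat) (mu : R[i]) : distributions D -> D <> 0 ->
  (forall g, D (vf (e3 R) g) = 0) -> iter k (dvfield X) D = 0 ->
  push_dist Phi D = mu *: D -> mu = 1.
Proof.
move=> dD D0 D3 XD pD.
have [n1 D10] := torus_mode_neq0 g12 Gw lat dD D3 Gv1 D0.
pose T1 := torus_mode (Gamma := Gamma) tau v1 n1; pose D1 : dist := D \o T1.
have T1C w g : vf w (T1 g) = T1 (vf w g) by exact: vf_torus_modeC.
have dD1 : distributions D1 by exact: dist_good (good_torus_mode g12 Gw _ _).
have D13 g : D1 (vf (e3 R) g) = 0 by rewrite /D1 /= -T1C.
have [n2 E0] := torus_mode_neq0 g12 Gw lat dD1 D13 Gv2 D10.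
pose T2 := torus_mode (Gamma := Gamma) tau v2 n2; pose E : dist := D1 \o T2.
have T2C w g : vf w (T2 g) = T2 (vf w g) by exact: vf_torus_modeC.
have dE : distributions E by exact: dist_good (good_torus_mode g12 Gw _ _).
have [l lE] := linear_pack (dist_linear dD).
have DZ a g : D (a *: g) = a * D g by rewrite lE linearZ.
have [l1 lE1] := linear_pack (dist_linear dD1).
have D1Z a g : D1 (a *: g) = a * D1 g by rewrite lE1 linearZ.
have XE : iter k (dvfield X) E = 0.
  have -> : iter k (dvfield X) E = (iter k (dvfield X) D) \o T1 \o T2.
    elim: k {XD} => [//|k IH]; rewrite !iterS IH; apply/funext => g.
    by rewrite /dvfield vfieldE /= T1C T2C.
  by rewrite XD.
have inv : forall w g, E (vf w g) = 0.
  apply: (invariant_of_eigen (dist_linear dE) E0 _ XE (f1 := freq R n1) (f2 := freq R n2)).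
  - by move=> g; rewrite /E /= -T2C.
  - by move=> g; rewrite /E /= -T2C /D1 /= -T1C (vf_torus_mode g12 Gw _ _ Gv1) DZ.
  - by move=> g; rewrite /E /= -T2C (vf_torus_mode g12 Gw _ _ Gv2) D1Z.
have E1 : E (test_one Gamma) <> 0.
  move=> E10; apply: E0; apply/funext => f.
  by rewrite -[LHS]/(E f) (invariant_unique g12 Gw Gv1 Gv2 span12 f (dist_linear dE) inv) E10 mulr0.
have [a aE] : exists a, T2 (test_one Gamma) = a *: test_one Gamma.
  have [a0 a0E] := fourier_one Gamma (0, 0, tau) 0.
  have [a aE] := fourier_one Gamma v2 n2.
  by exists (a0 * a); rewrite /T2 /torus_mode a0E linearZ /= aE scalerA.
have [b bE] : exists b, T1 (test_one Gamma) = b *: test_one Gamma.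
  have [b0 b0E] := fourier_one Gamma (0, 0, tau) 0.
  have [b bE] := fourier_one Gamma v1 n1.
  by exists (b0 * b); rewrite /T1 /torus_mode b0E linearZ /= bE scalerA.
have D1n : D (test_one Gamma) != 0.
  apply/eqP => D10'; apply: E1.
  by rewrite /E /= aE D1Z /D1 /= bE DZ D10' !mulr0.
have := congr1 (fun F : dist => F (test_one Gamma)) pD.
have -> : push_dist Phi D (test_one Gamma) = D (test_one Gamma).
  by congr (D _); exact: val_inj.
move=> /esym /eqP; rewrite -[X in _ == X]mul1r => /eqP; exact: mulIf.
Qed.

Lemma central_mode_resonance D (k : nat) (mu : R[i]) :
  normalized Gamma (0, 0, c) ->
  distributions D -> D <> 0 -> iter k (dvfield X) D = 0 -> push_dist Phi D = mu *: D ->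
  mu = 1 \/ exists (z : int) (E : dist), [/\ z != 0, E <> 0,
    inv_dist X k E, Z_mode (0, 0, c) z E & push_dist Phi E = mu *: E].
Proof.
move=> nrm dD D0 XD pD.
have [n E0] := central_mode_neq0 Gw lat dD D0.
pose T := fourier (Gamma := Gamma) (0, 0, tau) n; pose E : dist := D \o T.
have gT : good T by exact: good_fourier_central.
have [lT TC _] := gT.
have dE : distributions E by exact: dist_good.
have XE : iter k (dvfield X) E = 0.
  have -> : iter k (dvfield X) E = (iter k (dvfield X) D) \o T.
    elim: k {XD} => [//|k IH]; rewrite !iterS IH; apply/funext => g.
    by rewrite /dvfield vfieldE /= TC.
  by rewrite XD.
have pE : push_dist Phi E = mu *: E.
  apply/funext => f; rewrite /push_dist /E /= /T fourier_aut; last first.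
    by move=> t; exact: aut_central c0 dZ.
  by have := congr1 (fun F : dist => F (T f)) pD.
have [l lE] := linear_pack (dist_linear dD).
have DZ a g : D (a *: g) = a * D g by rewrite lE linearZ.
have Tw f : vf (0, 0, tau) (T f) = ('i%C * (freq R n)%:C) *: T f.
  by apply: vf_fourier => x; exact: central_period.
have T3 t f : vf (0, 0, t) (T f) = ('i%C * (t / tau * freq R n)%:C) *: T f.
  have -> : (0, 0, t) = (t / tau) *: (0, 0, tau) :> heis R.
    by rewrite e3E (e3E tau) scalerA divfK.
  by rewrite vfZ Tw scalerA; congr (_ *: _); rewrite rmorphM /=; ring.
have [n0|n0] := eqVneq n 0.
  left; apply: (zero_mode_resonance dE E0 _ XE pE) => g.
  by rewrite /E /= -TC T3 n0 freq0 mulr0 mulr0 scale0r lE linear0.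
right; have [f Tf] : exists f, T f <> 0.
  apply: contrapT => /forallNP H; apply: E0; apply/funext => f /=.
  by have /contrapT Tf0 := H f; rewrite -[LHS]/(D (T f)) Tf0 lE linear0.
have [z zE] := mode_integer lat nrm Tf (T3 c f).
(* The sign changes because [dvfield] is the transposed field with a minus sign, while [z] is the
   frequency on test functions. *)
exists (- z), E; split=> //.
- have fn : freq R n != 0 by rewrite freq_eq0.
  have ct : c / tau != 0 by rewrite mulf_neq0// invr_eq0.
  by rewrite oppr_eq0 -(intr_eq0 R) -zE mulf_neq0.
- apply/funext => g; rewrite /dvfield vfieldE /E /= -TC T3 zE DZ.
  change (- (('i%C * (z%:~R)%:C) * D (T g)) = ('i%C * (- z)%:~R) * D (T g)).
  by rewrite mulrNz -(rmorph_int (real_complex R)) mulrN mulNr.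
Qed.

(** The push-forward of the mean [J] is again killed by all fields, since the differential of [Phi]
    is onto; by uniqueness it is a multiple of [J], and both take the value 1 at the constant
    function 1. *)
Lemma one_resonance : ruelle_resonance Phi X 1.
Proof.
pose J : dist := invariant_mean tau v1 v2.
have J1 : J (test_one Gamma) = 1 by exact: invariant_mean1.
have dJ : distributions J by exact: invariant_mean_dist.
have JV w g : J (vf w g) = 0 by exact: invariant_mean_vf.
have [l lE] := linear_pack (dist_linear dJ).
exists J; split.
- exists 1%N => //; split=> //=; apply/funext => f.
  by rewrite /dvfield vfieldE JV oppr0.
- by move=> J0; have := oner_neq0 R[i]; rewrite -J1 J0 eqxx.
rewrite scale1r; apply/funext => f.
have lp : linear (push_dist Phi J).
  by move=> a g h; rewrite /push_dist linearP lE linearP.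
have pV w g : push_dist Phi J (vf w g) = 0.
  have l0 : lambda != 0 by rewrite gt_eqF// (lt_trans ltr01).
  (* The differential is inverted on the frame, by dividing each coordinate by its eigenvalue. *)
  have [a [b [t wE]]] : exists a b t : R, w = daut Phi (a *: X + b *: Y + t *: (0, 0, c)).
    have := frame_coord w c0 XYc; set a := _ / c; set b := _ / c; set t := _ / c => wE.
    exists (a / lambda), (b * lambda), t.
    rewrite -[a / lambda *: X + _]scale1r dautZD scale1r dautZD dX dY dZ.
    by rewrite !scalerA divfK// mulfK.
  by rewrite /push_dist wE -vf_aut JV.
rewrite (invariant_unique g12 Gw Gv1 Gv2 span12 f lp pV) -/J.
have -> : push_dist Phi J (test_one Gamma) = J (test_one Gamma).
  by congr (J _); exact: val_inj.
by rewrite J1 mulr1.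
Qed.

End Resonances.

Theorem theorem5p3 (R : realType) :
  exists c : nat -> nat -> R -> R[i],
    (forall lambda : R, 1 < lambda ->
       exists k j : nat, (j < k)%N /\ c k j lambda <> 0) /\
    forall (Gamma : set (heis R)) (Phi : nil_automorphism Gamma)
        (X Y Z : heis R) (lambda : R),
      is_lattice Gamma ->
      heisenberg_frame Gamma X Y Z ->
      1 < lambda ->
      pushes_vfield Phi X lambda ->
      pushes_vfield Phi Y lambda^-1 ->
      pushes_vfield Phi Z 1 ->
      normalized Gamma Z ->
    forall (u : forall z : int, 'I_`|z|%N -> R[i])
        (D : forall z : int, 'I_`|z|%N -> testfn Gamma -> R[i]^o),
      (forall z : int, z != 0 ->
         [/\ is_basis (inv_dist X 1 `&` Z_mode Z z) (D z),
             forall i, push_dist Phi (D z i) =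
               (u z i * (lambda `^ (- 2^-1))%:C) *: D z i
           & forall i, `|u z i| = 1]) ->
      ruelle_resonance Phi X =
        [set 1] `|`
        [set mu | exists (z : int) (i : 'I_`|z|%N) (k : nat),
           z != 0 /\ mu = u z i * (lambda `^ (- k%:R - 2^-1))%:C] /\
      exists Dk : nat -> forall z : int, 'I_`|z|%N -> testfn Gamma -> R[i]^o,
        [/\ forall (z : int) (i : 'I_`|z|%N) (k : nat), z != 0 ->
              ruelle_eigenstate_span Phi X (Dk k z i),
            forall (z : int) (K : nat), z != 0 -> (0 < K)%N ->
              is_basis (inv_dist X K `&` Z_mode Z z)
                (fun ki : 'I_K * 'I_`|z|%N => Dk ki.1 z ki.2)
          & forall (z : int) (i : 'I_`|z|%N) (k : nat), z != 0 ->
              push_dist Phi (Dk k z i) =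
                (u z i * (lambda `^ (- k%:R - 2^-1))%:C) *: Dk k z i +
                \sum_(j < k)
                  (c k j lambda * u z i * (lambda `^ (- j%:R - 2^-1))%:C)
                    *: Dk j z i].
Proof.
exists (@jordan_coef R).
split=> [lambda lambda1|].
  exists 1%N, 0%N; split=> //=; apply/eqP.
  rewrite -(rmorph0 (real_complex R)) (inj_eq (@complexI R)) subr_eq0.
  by rewrite -[1]invr1 (inj_eq invr_inj) lt_eqF.
move=> Gamma Phi X Y Z lambda lat frame lambda1 pX pY pZ nrm u D DP.
have rich := exists_central_derivative frame nrm.
have [c [c0 Zc XYc]] := frame_central rich frame.
have dX := daut_eigen rich pX; have dY := daut_eigen rich pY.
have dZ : daut Phi (0, 0, c) = (0, 0, c).
  by have := daut_eigen rich pZ; rewrite scale1r Zc.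
have [g1 [g2 [G1 G2 g12]]] := lattice_noncommuting lat.
split; last first.
  exists (fun k z i => Dk Y (D z) k i); split=> [z i k z0|z K z0 K0|z i k z0];
    have [basis pushD _] := DP z z0.
  - exact: (Dk_span lat frame lambda1 pY z0 basis pushD).
  - exact: (Dk_basis lat frame z0 basis).
  - exact: (push_Dk lambda1 pY basis pushD).
apply/seteqP; split=> mu.
- move=> [E [[k k0 [dE XE]] E0 pE]].
  rewrite Zc in nrm.
  have [->|[z [F [z0 F0 [dF XF] ZF pF]]]] :=
    central_mode_resonance lat c0 XYc lambda1 dX dY dZ G1 G2 g12 nrm dE E0 XE pE.
    by left.
  right; have [basis pushD _] := DP z z0.
  rewrite -Zc in ZF.
  have [i [j ->]] := mode_resonance lat frame lambda1 pY z0 basis pushD (conj dF XF) ZF F0 pF.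
  by exists z, i, j.
- move=> [->|[z [i [k [z0 ->]]]]].
    exact: (one_resonance lat c0 XYc lambda1 dX dY dZ G1 G2 g12).
  have [basis pushD _] := DP z z0.
  exact: (Yk_resonance lat frame lambda1 pY z0 basis pushD).
Qed.
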